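(* Suppose that there exist a continuous function $w\ge 1$ on $S$, constants $\rho, b\ge 0$, and a nondecreasing sequence $\{S_k\}$ of subsets of $S$ such that: (1) $\int_S w(y)\,q(dy|x,a)\le \rho w(x)+b$ for all $(x,a)\in K$; (2) $\inf_{x\notin S_k} w(x)\uparrow +\infty$ as $k\to\infty$ (with $\inf\varnothing:=\infty$); (3) $S_k\uparrow S$ and $\sup_{a\in A(x),\,x\in S_k}|q(\{x\}|x,a)|<\infty$ for all $k\ge 1$. Then, for each policy $\pi\in\Pi$, $x\in S$ and $t\ge 0$: (a) $P^\pi_x(T_\infty=\infty)=1$ and $P^\pi_x(\xi_t\in S)=1$. (b) $E^\pi_x[w(\xi_t)]\le e^{\rho t}w(x)+\frac{b}{\rho}(e^{\rho t}-1)$ if $\rho\neq 0$, and $E^\pi_x[w(\xi_t)]\le w(x)+bt$ if $\rho=0$. (c) For each $D\in\mathcal B(S)$ with $\sup_{x\in D}q^*(x)<\infty$, $$P^\pi_x(\xi_t\in D)=I_D(x)+E^\pi_x\Big[\int_0^t\int_A \pi(da|e,s)\,q(D|\xi_{s-}(e),a)\,ds\Big].$$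
   Context: Model. $S$ (states) and $A$ (actions) are Polish spaces with Borel $\sigma$-algebras $\mathcal B(S),\mathcal B(A)$; for each $x\in S$, $A(x)\subseteq A$ is a Borel set of admissible actions; $K:=\{(x,a): x\in S, a\in A(x)\}$ is a Borel subset of $S\times A$. The transition rates $q(\cdot|x,a)$, $(x,a)\in K$, satisfy: for fixed $(x,a)$, $q(\cdot|x,a)$ is a signed measure on $\mathcal B(S)$, and for fixed $D\in\mathcal B(S)$, $q(D|\cdot)$ is real-valued and Borel measurable on $K$; $0\le q(D|x,a)<\infty$ whenever $x\notin D\in\mathcal B(S)$; $q(S|x,a)=0$; and $q^*(x):=\sup_{a\in A(x)}|q(\{x\}|x,a)|<\infty$ for all $x\in S$. State process. Adjoin isolated points: $S_\infty:=S\cup\{x_\infty\}$, $A_\infty:=A\cup\{a_\infty\}$, $A(x_\infty):=\{a_\infty\}$, $q(\cdot|x_\infty,a_\infty)\equiv 0$. $\mathbb R_+:=(0,\infty)$, $\mathbb R_+^0:=[0,\infty)$. $\Omega$ consists of all sequences $e=(x_0,\theta_1,x_1,\theta_2,x_2,\ldots)$ in $(S\times\mathbb R_+)^\infty$ together with all sequences $(x_0,\theta_1,x_1,\ldots,\theta_{k-1},x_{k-1},\infty,x_\infty,\infty,x_\infty,\ldots)$, $k\ge1$, $x_l\in S$, $\theta_l\in\mathbb R_+$; $\mathcal F$ is the natural (product) $\sigma$-algebra. Put $T_0:=0$, $T_k:=\theta_1+\cdots+\theta_k$, $T_\infty:=\lim_k T_k$, $X_k:=x_k$, $\Theta_k:=\theta_k$,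 $h_k:=(x_0,\theta_1,x_1,\ldots,\theta_k,x_k)$; $\xi_t:=x_k$ if $T_k\le t<T_{k+1}$ and $\xi_t:=x_\infty$ if $t\ge T_\infty$; $\xi_{t-}$ is the left limit ($\xi_{t-}=x_k$ for $T_k<t\le T_{k+1}$, $\xi_{0-}:=x_0$, $\xi_{t-}=x_\infty$ after absorption). Let $\mu^*(dt,dx):=\sum_{k\ge0}I_{\{T_k<\infty\}}\delta_{(T_k,X_k)}(dt,dx)$, $\mathcal F_t:=\sigma\{\mu^*([0,s]\times D): s\in[0,t], D\in\mathcal B(S)\}$, $\mathcal F_{s-}:=\bigvee_{t<s}\mathcal F_t$; the predictable $\sigma$-algebra on $\Omega\times\mathbb R_+^0$ is generated by the sets $B\times\{0\}$ ($B\in\mathcal F_0$) and $C\times(s,\infty)$ ($C\in\mathcal F_{s-}$, $s>0$). Policies. A policy is a transition probability $\pi(da|e,t)$ from $\Omega\times\mathbb R_+^0$ with the predictable $\sigma$-algebra to $(A_\infty,\mathcal B(A_\infty))$ such that $\pi(A(\xi_{t-}(e))|e,t)\equiv1$. $\Pi$ is the set of all policies. Probability measure. For $\pi\in\Pi$ and a probability measure $\gamma$ on $S$, the predictable intensity $m(D|e,t):=\int_A\pi(da|e,t)\,q(D\setminus\{\xi_{t-}(e)\}|\xi_{t-}(e),a)$ has a representation $m(D|e,t)=m_k(D|h_k(e),t-T_k)$ on $\{T_k<t\le T_{k+1}\}$. $P^\pi_\gamma$ is the unique probability measure on $(\Omega,\mathcal F)$ such that $x_0$ has law $\gamma$ and,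 given $h_k$ with $x_k\in S$, $P^\pi_\gamma(\Theta_{k+1}\in dt,X_{k+1}\in dx|h_k)=m_k(dx|h_k,t)e^{-\int_0^t m_k(S|h_k,v)dv}dt$ and $P^\pi_\gamma(\Theta_{k+1}=\infty,X_{k+1}=x_\infty|h_k)=e^{-\int_0^\infty m_k(S|h_k,v)dv}$. $E^\pi_\gamma$ is its expectation; $P^\pi_x,E^\pi_x$ denote the case $\gamma=\delta_x$. $I_D$ is the indicator function of $D$. *)

(* Defs.v *)
From HB Require Import structures.
From mathcomp Require Import all_boot all_order all_algebra.
From mathcomp Require Import all_classical all_reals all_analysis.
From mathcomp Require Import measurable_realfun.

Set Implicit Arguments.
Unset Strict Implicit.
Unset Printing Implicit Defensive.

Import Order.TTheory GRing.Theory Num.Theory.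
Import numFieldNormedType.Exports.

Local Open Scope classical_set_scope.
Local Open Scope ring_scope.

(* Separable and completely metrizable; the metric is not part of the data. *)
Definition polish (R : realType) (T : topologicalType) : Prop :=
  (exists2 C : set T, countable C & dense C) /\
  exists d : T -> T -> R,
    [/\ (forall x y, d x y = 0 <-> x = y),
        (forall x y, d x y = d y x),
        (forall x y z, d x z <= d x y + d y z),
        (forall x (U : set T), nbhs x U <->
           exists2 r : R, 0 < r & [set y | d x y < r] `<=` U) &
        (forall u : nat -> T,
           (forall r : R, 0 < r -> exists N, forall m n,
              (N <= m)%N -> (N <= n)%N -> d (u m) (u n) < r) ->
           exists l : T, u @ \oo --> l)].

Notation borelType T := (g_sigma_algebraType (@open T)).

(* [option T] is [T] with an isolated point [None] added, so its sigma-algebra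
   is that of a disjoint sum. *)
Definition option_display : measure_display -> measure_display.
Proof. exact. Qed.

Section option_measurable.
Context d (T : measurableType d).

Let option_measurable (D : set (option T)) : Prop :=
  measurable (Some @^-1` D).

Let option_measurable0 : option_measurable set0.
Proof. by rewrite /option_measurable preimage_set0. Qed.

Let option_measurableC D : option_measurable D -> option_measurable (~` D).
Proof. by rewrite /option_measurable preimage_setC; exact: measurableC. Qed.

Let option_measurable_bigcup (F : (set (option T))^nat) :
  (forall i, option_measurable (F i)) -> option_measurable (\bigcup_i F i).
Proof.
by rewrite /option_measurable preimage_bigcup => ?; exact: bigcup_measurable.
Qed.

HB.instance Definition _ := @isMeasurable.Build (option_display d) (option T)
  option_measurable option_measurable0 option_measurableC
  option_measurable_bigcup.

End option_measurable.

Section charge_integral.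
Context d (T : measurableType d) (R : realType).
Variable nu : {charge set T -> \bar R}.

Lemma hahn_pair :
  exists PN : set T * set T, hahn_decomposition nu PN.1 PN.2.
Proof. by have [P [N nuPN]] := Hahn_decomposition nu; exists (P, N). Qed.

(* Integral against a signed measure, through its Jordan decomposition. *)
Definition charge_integral (f : T -> \bar R) : \bar R :=
  let nuPN := projT2 (cid hahn_pair) in
  (\int[jordan_pos nuPN]_y f y - \int[jordan_neg nuPN]_y f y)%E.

End charge_integral.

Section rates.
Context d d' (S : measurableType d) (A : measurableType d') (R : realType).
Variables (adm : S -> set A) (q : S -> A -> {charge set S -> \bar R}).

Definition adm_graph : set (S * A) := [set xa | adm xa.1 xa.2].

Definition qstar (x : S) : \bar R :=
  ereal_sup [set `|q x a [set x]|%E | a in adm x].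

(* [q x a] is only meaningful for [adm x a]; its values being charges, they are
   real on measurable sets. *)
Definition transition_rates : Prop :=
  [/\ (forall x, measurable (adm x)),
      measurable adm_graph,
      (forall D, measurable D ->
         measurable_fun adm_graph (fun xa => q xa.1 xa.2 D)),
      (forall x a D, adm x a -> measurable D -> ~ D x -> 0 <= q x a D)%E &
      (forall x a, adm x a -> q x a setT = 0)%E /\
      (forall x, qstar x < +oo)%E].

Definition adm_ext (x : option S) : set (option A) :=
  if x is Some y then Some @` adm y else [set None].

(* Zero at the cemetery and outside the graph of admissible pairs, where the
   rates are not defined. *)
Definition q_ext (x : option S) (a : option A) (D : set S) : \bar R :=
  match x, a with
  | Some y, Some b => ((fun yb => q yb.1 yb.2 D) \_ adm_graph) (y, b)
  | _, _ => 0%E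
  end.

End rates.

(* [sojourn k] is theta_(k+1), the time spent in the state x_k = [state k]. *)
Definition is_trajectory (S : Type) (R : realType)
    (state : nat -> option S) (sojourn : nat -> \bar R) : Prop :=
  (forall k, range Some (state k) /\ (0 < sojourn k < +oo)%E) \/
  exists k, [/\ (forall l, (l <= k)%N -> range Some (state l)),
                (forall l, (l < k)%N -> 0 < sojourn l < +oo)%E &
                (forall l, (k <= l)%N ->
                   sojourn l = +oo%E /\ state l.+1 = None)].

Record trajectory (S : Type) (R : realType) := Trajectory {
  state : nat -> option S ;
  sojourn : nat -> \bar R ;
  trajectoryP : is_trajectory state sojourn }.

Section trajectory_pointed.
Context (S : pointedType) (R : realType).

HB.instance Definition _ := gen_eqMixin (trajectory S R).
HB.instance Definition _ := gen_choiceMixin (trajectory S R).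

Let point_state (k : nat) : option S := if k is 0%N then Some point else None.

Let point_trajectoryP : is_trajectory point_state (fun=> +oo%E : \bar R).
Proof.
by right; exists 0%N; split => // l; rewrite leqn0 => /eqP ->; exists point.
Qed.

HB.instance Definition _ :=
  isPointed.Build (trajectory S R) (Trajectory point_trajectoryP).

End trajectory_pointed.

Section process.
Context d (S : measurableType d) (R : realType).
Implicit Types (e : trajectory S R) (t s : R) (k : nat).

Definition cylinder : set (set (trajectory S R)) :=
  [set G | (exists k (D : set (option S)),
              measurable D /\ G = (fun e => state e k) @^-1` D) \/
           (exists k (B : set (\bar R)),
              measurable B /\ G = (fun e => sojourn e k) @^-1` B)].

Definition jump_time e k : \bar R := (\sum_(i < k) sojourn e i)%E.

Definition explosion_time e : \bar R := limn (jump_time e).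

Definition xi e t : option S :=
  xget None [set y | exists2 k,
    (jump_time e k <= t%:E < jump_time e k.+1)%E & y = state e k].

(* The left limit of [xi e] for [t < explosion_time e]; [None] from then on. *)
Definition xi_left e t : option S :=
  if t == 0 then state e 0%N else
  xget None [set y | exists2 k,
    (jump_time e k < t%:E <= jump_time e k.+1)%E & y = state e k].

Definition mu_star e (B : set (R * option S)) : \bar R :=
  (\sum_(0 <= k <oo | (jump_time e k < +oo)%E)
     \d_(fine (jump_time e k), state e k) B)%E.

Definition filtration t : set (set (trajectory S R)) :=
  <<s [set G | exists s (D : set S) (B : set (\bar R)),
         [/\ 0 <= s <= t, measurable D, measurable B &
             G = (fun e => mu_star e (`[0, s] `*` (Some @` D))) @^-1` B]] >>.

Definition filtration_left s : set (set (trajectory S R)) :=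
  <<s \bigcup_(t in `[0, s[) filtration t >>.

(* Subsets of [Omega * [0, +oo[], seen in [Omega * R]: negative times form a
   single extra block, of which no property is required anywhere. *)
Definition predictable_gen : set (set (trajectory S R * R)) :=
  [set G | (exists2 B, filtration 0 B & G = B `*` [set 0]) \/
           (exists s C, [/\ 0 < s, filtration_left s C &
                            G = C `*` `]s, +oo[])].

(* h_k, as the pair of x_0 and the k-tuple of the (theta_i, x_i), 1 <= i <= k *)
Definition history k e : option S * k.-tuple (\bar R * option S) :=
  (state e 0%N, [tuple (sojourn e i, state e i.+1) | i < k]).

End process.

Notation Omega S R := (g_sigma_algebraType (@cylinder _ S R)).
Notation predictableType S R := (g_sigma_algebraType (@predictable_gen _ S R)).

Section policy.
Context d d' (S : measurableType d) (A : measurableType d') (R : realType).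
Variables (adm : S -> set A) (q : S -> A -> {charge set S -> \bar R}).
Variable pi : R.-pker (predictableType S R) ~> (option A).

Definition policy : Prop := forall (e : trajectory S R) (t : R),
  0 <= t -> pi (e, t) (adm_ext adm (xi_left e t)) = 1%E.

Definition integrated_rate (e : trajectory S R) (t : R) (D : set S) : \bar R :=
  (\int[pi (e, t)]_(a in range Some) q_ext adm q (xi_left e t) a D)%E.

Definition intensity (e : trajectory S R) (t : R) (D : set S) : \bar R :=
  integrated_rate e t (D `\` [set y | Some y = xi_left e t]).

Definition represents_intensity
    (m : forall k, option S * k.-tuple (\bar R * option S) ->
         R -> set S -> \bar R) : Prop :=
  (forall k D, measurable D ->
     measurable_fun setT (fun hu => m k hu.1 hu.2 D)) /\
  (forall k (e : trajectory S R) t D, measurable D ->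
     (jump_time e k < t%:E <= jump_time e k.+1)%E ->
     intensity e t D = m k (history k e) (t - fine (jump_time e k)) D).

(* [P] is P^pi_gamma: the conditional laws given h_k are expressed by
   integrating over the events {h_k \in H, x_k \in S}. *)
Definition process_law (gamma : probability S R)
    (P : probability (Omega S R) R) : Prop :=
  exists2 m, represents_intensity m &
  [/\ (forall D, measurable D ->
         P [set e | (Some @` D) (state e 0%N)] = gamma D),
      (forall k H (G : set R) D,
         measurable H -> measurable G -> G `<=` `]0%R, +oo[ -> measurable D ->
         P [set e | [/\ H (history k e), range Some (state e k),
                        (EFin @` G) (sojourn e k) &
                        (Some @` D) (state e k.+1)]] =
         \int[P]_(e in [set e | H (history k e) /\ range Some (state e k)])
           \int[lebesgue_measure]_(u in G)
             (m k (history k e) u D *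
              expeR (- \int[lebesgue_measure]_(v in `[0%R, u])
                         m k (history k e) v setT)))%E &
      (forall k H, measurable H ->
         P [set e | [/\ H (history k e), range Some (state e k),
                        sojourn e k = +oo & state e k.+1 = None]] =
         \int[P]_(e in [set e | H (history k e) /\ range Some (state e k)])
           expeR (- \int[lebesgue_measure]_(v in `[0%R, +oo[)
                      m k (history k e) v setT))%E].

End policy.

(* Main.v *)
Require Import Defs.
From HB Require Import structures.
From mathcomp Require Import all_boot all_order all_algebra.
From mathcomp Require Import all_classical all_reals all_analysis.
From mathcomp Require Import measurable_realfun.

From mathcomp Require Import ring lra.

Set Implicit Arguments.
Unset Strict Implicit.
Unset Printing Implicit Defensive.

Import Order.TTheory GRing.Theory Num.Theory.
Import numFieldNormedType.Exports.

Local Open Scope classical_set_scope.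
Local Open Scope ring_scope.

(** Everything rests on one identity for a single sojourn. Given the history
    [h_k], the time [Theta] until the next jump has hazard rate [m_k(S|h_k,.)],
    so that the measure counting the jumps into [D] has compensator
    [m_k(D|h_k,u) du] on [u <= Theta]:

      E[f(h_k,Theta); x_(k+1) in D] = E[int_0^Theta f(h_k,u) m_k(D|h_k,u) du].

    This is [compensator_formula], in the notation of trajectories
    [jump_compensator]. It holds because [P(Theta >= u | h_k)] is the
    exponential of minus the integrated hazard rate ([integral_exp_survival]),
    which is the factor by which the conditional density of a jump at time [u]
    differs from [m_k].

    Part (c) counts visits. Up to time [t], the number of arrivals in [D] minus
    the number of departures from [D] is [I_D(xi_t) - I_D(x_0)]
    ([forward_equation]). By the compensator formula, the expected number of
    arrivals is the integral of the rate of jumping into [D] from another point,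
    and the expected number of departures is that of the total jump rate while
    the process is in [D]. The latter is at most [M t] when the jump rates are
    at most [M] on [D] ([sum_departures_le]), so the subtraction makes sense;
    and the difference of the two rates is [q(D|x,a)], because
    [q(D|x,a) = q(D \ x|x,a) - I_D(x) q(S \ x|x,a)] ([q_ext_split]).

    Part (b) is a Lyapunov argument. Let [v(r,y)] be the value at time [r] of
    the solution of [z' = rho z + b] with [z(0) = w(y)]; it is the bound claimed
    for the mean weight at a time [r] after a visit to [y]. Let
    the energy of step [k] be [E[v(t - T_k, x_k); T_k <= t]]. Integrating the
    drift inequality against the compensator over one sojourn gives
    [energy_step]:

      E[w(x_k); T_k <= t < T_(k+1)] + energy (k+1) <= energy k.

    Summed over [k], the first terms make up [E[w(xi_t)]], and the energy of
    step [0] is [v(t,x)].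

    Part (a) combines the two estimates. The energies are bounded by [v(t,x)],
    so [P(T_k <= t, w(x_k) > c) <= v(t,x) / c] for every [k]. The jump rates are
    bounded on [w <= c], since this set lies in some [S_j], so the probabilities
    of [T_(k+1) <= t, w(x_k) <= c] have a finite sum over [k]. Hence
    [P(T_k <= t for all k) <= v(t,x) / c] for every [c] ([prob_explosion0]). *)

(** * Equality of weighted push-forwards *)

Section weighted_pushforward.
Local Open Scope ereal_scope.
Context d d' (X : measurableType d) (Y : measurableType d') (R : realType).
Variables (mu : {measure set X -> \bar R}) (phi : X -> Y) (g : X -> \bar R).
Hypotheses (mphi : measurable_fun setT phi) (mg : measurable_fun setT g).
Hypothesis g0 : forall x, 0 <= g x.

(* The side conditions are arguments so that the measure instance below can
   refer to them. *)
Definition weighted_pushforward of measurable_fun setT phi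
    & measurable_fun setT g & (forall x, 0 <= g x) : set Y -> \bar R :=
  fun A => \int[mu]_(x in phi @^-1` A) g x.

Local Notation nu := (weighted_pushforward mphi mg g0).

Let nu0 : nu set0 = 0.
Proof. by rewrite /weighted_pushforward preimage_set0 integral_set0. Qed.

Let nu_ge0 A : 0 <= nu A.
Proof. exact: integral_ge0. Qed.

Let nu_sigma_additive : semi_sigma_additive nu.
Proof.
move=> F mF tF mUF; rewrite /weighted_pushforward preimage_bigcup.
have mphiF n : measurable (phi @^-1` F n) by rewrite -[_ @^-1` _]setTI; exact: mphi.
rewrite ge0_integral_bigcup//.
- by apply: is_cvg_nneseries => n _ _; exact: integral_ge0.
- exact: measurable_funTS.
- apply/trivIsetP => i j _ _ ij; rewrite -preimage_setI.
  by move/trivIsetP : tF => ->//; rewrite preimage_set0.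
Qed.

HB.instance Definition _ :=
  isMeasure.Build _ _ _ nu nu0 nu_ge0 nu_sigma_additive.

Import HBNNSimple.

Lemma integral_weighted_pushforward (f : Y -> \bar R) :
  measurable_fun setT f -> (forall y, 0 <= f y) ->
  \int[nu]_y f y = \int[mu]_x (f (phi x) * g x).
Proof.
move=> mf f0; pose s := nnsfun_approx measurableT mf.
have s_cvg y : EFin \o s ^~ y @ \oo --> f y by exact: cvg_nnsfun_approx.
have s_nd y : {homo (fun n => (s n y)%:E) : a b / (a <= b)%N >-> a <= b}.
  by move=> a b ab; rewrite lee_fin; exact/lefP/nd_nnsfun_approx.
have s_le n y : (s n y)%:E <= f y.
  by rewrite /s nnsfun_approxE; exact: le_approx.
have ms n : measurable_fun setT (fun x => (s n (phi x))%:E).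
  by apply/measurable_EFinP; apply: measurableT_comp.
transitivity (limn (fun n => \int[nu]_y (s n y)%:E)).
  rewrite -monotone_convergence//=.
  - by apply: eq_integral => y _; apply/esym/cvg_lim => //; exact: s_cvg.
  - by move=> n; exact/measurable_EFinP.
  - by move=> n y _; rewrite lee_fin.
transitivity (limn (fun n => \int[mu]_x ((s n (phi x))%:E * g x))); last first.
  rewrite -monotone_convergence//=.
  - apply: eq_integral => x _; apply/cvg_lim => //.
    have [gfin|goo] := boolP (g x \is a fin_num); first by apply: cvgeZr => //; exact: s_cvg.
    have [f0x|fx0] := eqVneq (f (phi x)) 0.
      rewrite f0x mul0e (_ : (fun _ => _) = cst 0); first exact: cvg_cst.
      apply/funext => n /=; have := s_le n (phi x).
      rewrite f0x => sn0; suff -> : (s n (phi x))%:E = 0 by rewrite mul0e.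
      by apply/eqP; rewrite eq_le sn0 lee_fin/=.
    apply: cvgeM; [exact: mule_def_neq0_infty|exact: s_cvg|exact: cvg_cst].
  - move=> n. by apply: emeasurable_funM.
  - by move=> n x _; rewrite mule_ge0 ?lee_fin.
  - by move=> x _ a b ab; rewrite lee_wpmul2r//; exact: s_nd.
congr (limn _); apply/funext => n.
have mphis (r : R) : measurable (phi @^-1` (s n @^-1` [set r])).
  by rewrite -[_ @^-1` _]setTI; exact: mphi.
transitivity (\sum_(r \in range (s n)) r%:E * nu (s n @^-1` [set r])).
  under eq_integral do rewrite fimfunE -fsumEFin//.
  rewrite ge0_integral_fsum//; last 2 first.
  - by move=> r; exact/measurable_EFinP/measurable_funM.
  - by move=> r y _; rewrite nnfun_muleindic_ge0.
  apply: eq_fsbigr => r _.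
  by rewrite integralZl_indic_nnsfun//= integral_indic// setIT.
transitivity (\sum_(r \in range (s n))
    \int[mu]_x (r%:E * ((\1_(phi @^-1` (s n @^-1` [set r])) x)%:E * g x))).
  apply: eq_fsbigr => r; rewrite inE => -[y _ rE].
  have r_ge0 : (0 <= r)%R by rewrite -rE.
  rewrite ge0_integralZl//; last 2 first.
  - by apply: emeasurable_funM => //; exact/measurable_EFinP.
  - by move=> x _; rewrite mule_ge0// lee_fin.
  congr (_ * _); rewrite /= /weighted_pushforward integral_mkcond.
  apply: eq_integral => x _; rewrite patchE indicE.
  by case: (x \in _); rewrite ?mul1e ?mul0e.
rewrite -ge0_integral_fsum//.
- apply: eq_integral => x _; rewrite (fimfunE (s n)) -fsumEFin//.
  rewrite ge0_mule_fsuml; last by move=> r; rewrite nnfun_muleindic_ge0.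
  apply: eq_fsbigr => r _. rewrite EFinM muleA.
  by rewrite !indicE.
- move=> r; apply: emeasurable_funM => //; apply: emeasurable_funM => //.
  exact/measurable_EFinP/measurable_indic.
- move=> r x _; rewrite muleA mule_ge0//.
  exact: (nnfun_muleindic_ge0 (s n) r (phi x)).
Qed.

End weighted_pushforward.

(** The way in which the conditional laws are used: an identity known for the
    indicators of a pi-system extends to all nonnegative measurable functions,
    since two weighted push-forwards that are finite and agree on the pi-system
    are the same measure. *)
Lemma integral_comp_eq d1 d2 d (X1 : measurableType d1) (X2 : measurableType d2)
    (Y : measurableType d) (R : realType)
    (mu1 : {measure set X1 -> \bar R}) (mu2 : {measure set X2 -> \bar R})
    (phi1 : X1 -> Y) (phi2 : X2 -> Y) (g1 : X1 -> \bar R) (g2 : X2 -> \bar R)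
    (G : set (set Y)) :
  measurable_fun setT phi1 -> measurable_fun setT phi2 ->
  measurable_fun setT g1 -> measurable_fun setT g2 ->
  (forall x, 0 <= g1 x)%E -> (forall x, 0 <= g2 x)%E ->
  measurable = <<s G >> -> setI_closed G -> G setT ->
  (forall A, G A -> \int[mu1]_(x in phi1 @^-1` A) g1 x =
                    \int[mu2]_(x in phi2 @^-1` A) g2 x)%E ->
  (\int[mu1]_x g1 x < +oo)%E ->
  forall f : Y -> \bar R, measurable_fun setT f -> (forall y, 0 <= f y)%E ->
  (\int[mu1]_x (f (phi1 x) * g1 x) = \int[mu2]_x (f (phi2 x) * g2 x))%E.
Proof.
move=> mphi1 mphi2 mg1 mg2 g10 g20 GE GI GT E12 fin1 f mf f0.
rewrite -(integral_weighted_pushforward mu1 mphi1 mg1 g10)//.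
rewrite -(integral_weighted_pushforward mu2 mphi2 mg2 g20)//.
apply: eq_measure_integral => A mA _.
apply: (measure_unique G (fun=> setT)) => //.
by rewrite bigcup_const.
Qed.

(** * Survival function of a bounded hazard rate *)

Lemma measurable_expeR (R : realType) : measurable_fun setT (@expeR R).
Proof.
have -> : @expeR R = (fun x => if x == -oo%E then 0%E else er_map expR x).
  by apply/funext => -[r| |].
apply: measurable_fun_ifT => //=.
  by apply: measurable_fun_eqe.
exact: (@measurable_er_map _ (measurableTypeR R) _ _ (@measurable_expR R)).
Qed.

(** A function whose increments are quadratic in the step has derivative zero.
    Subdividing [[0, r]] gives this without differentiability, which would fail
    below: the hazard rate is only measurable. *)
Lemma quadratic_increment_cst (R : realType) (F : R -> R) (C r : R) : 0 <= r ->
  (forall a b, 0 <= a -> a <= b -> b <= r -> `|F b - F a| <= C * (b - a) ^+ 2) ->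
  F r = F 0.
Proof.
move=> r0 FC; apply/eqP; rewrite -subr_eq0 -normr_le0.
have C0 : 0 <= C * r ^+ 2.
  by have := FC 0 r (lexx _) r0 (lexx _); rewrite subr0; exact: le_trans.
have bound n : `|F r - F 0| <= C * r ^+ 2 / n.+1%:R.
  pose a i : R := r * i%:R / n.+1%:R.
  have aE i : a i.+1 - a i = r / n.+1%:R.
    by rewrite /a -mulrBl -mulrBr -natrB// subSnn mulr1.
  have a_ge0 i : 0 <= a i by rewrite divr_ge0// mulr_ge0.
  have -> : F r - F 0 = \sum_(0 <= i < n.+1) (F (a i.+1) - F (a i)).
    rewrite telescope_sumr// /a mulr0 mul0r mulfK//.
  apply: (le_trans (ler_norm_sum _ _ _)).
  have -> : C * r ^+ 2 / n.+1%:R = \sum_(0 <= i < n.+1) C * (r / n.+1%:R) ^+ 2.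
    by rewrite sumr_const_nat subn0 -mulr_natr; field; rewrite nat1r pnatr_eq0.
  rewrite !big_mkord; apply: ler_sum => -[i ilt] _ /=.
  rewrite -(aE i); apply: FC => //.
    by rewrite -subr_ge0 aE divr_ge0.
  by rewrite /a ler_pdivrMr// ler_wpM2l// ler_nat.
rewrite leNgt; apply/negP => d0.
have [n nd] : exists n : nat, C * r ^+ 2 / `|F r - F 0| < n.+1%:R.
  by exists (Num.bound (C * r ^+ 2 / `|F r - F 0|)); rewrite (lt_trans (archi_boundP _))
     ?divr_ge0 ?ltr_nat.
move: nd; rewrite ltr_pdivrMr// [_ * `|_|]mulrC -ltr_pdivrMr//.
by rewrite ltNge bound.
Qed.

(** Convexity of the exponential, in the form of the two supporting lines. *)
Lemma expRN_secant (R : realType) (a b : R) :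
  expR (- b) * (b - a) <= expR (- a) - expR (- b) <= expR (- a) * (b - a).
Proof.
have -> : expR (- b) = expR (- a) * expR (a - b).
  by rewrite -expRD addrA addNr add0r.
have Eab : expR (a - b) * expR (b - a) = 1.
  by rewrite -expRD -opprB addNr expR0.
have := expR_ge0 (- a); have := expR_ge0 (a - b).
have := expR_ge1Dx (a - b); have := expR_ge1Dx (b - a).
move: Eab; set e := expR (- a); set x := expR (a - b); set y := expR (b - a).
move: (a - b) (b - a) (opprB a b) => u v <-{v}.
move: e x y => e x y xy1 hy hx x0 e0.
apply/andP; split.
  have -> : e - e * x = e * (1 - x) by rewrite mulrBr mulr1.
  rewrite -mulrA ler_wpM2l//.
  have := ler_wpM2l x0 hy; rewrite mulrDr mulr1 xy1; lra.
have -> : e - e * x = e * (1 - x) by rewrite mulrBr mulr1.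
by rewrite ler_wpM2l//; lra.
Qed.

Lemma Rintegral_weight_bounds d (T : measurableType d) (R : realType)
    (mu : {measure set T -> \bar R}) (D : set T) (f g : T -> R) (c C : R) :
  measurable D -> mu.-integrable D (EFin \o f) ->
  mu.-integrable D (EFin \o (fun x => f x * g x)) ->
  (forall x, D x -> 0 <= f x) -> (forall x, D x -> c <= g x <= C) ->
  c * \int[mu]_(x in D) f x <= \int[mu]_(x in D) (f x * g x) <=
  C * \int[mu]_(x in D) f x.
Proof.
move=> mD intf intfg f0 gC.
have intZ k : mu.-integrable D (EFin \o (fun x => k * f x)).
  by apply: (eq_integrable _ _ _ _ (integrableZl mD k intf)) => // x _ /=; rewrite EFinM.
rewrite -!RintegralZl//; apply/andP; split; apply: le_Rintegral => // x Dx;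
  have /andP[cg gC'] := gC x Dx.
- by rewrite mulrC ler_wpM2l// f0.
- by rewrite [leRHS]mulrC ler_wpM2l// f0.
Qed.

Section exponential_survival.
Context (R : realType) (f : R -> R) (M : R).
Local Notation mu := (@lebesgue_measure R).
Hypotheses (mf : measurable_fun setT f) (f0 : forall x, 0 <= f x)
  (fM : forall x, f x <= M).

Let M0 : 0 <= M. Proof. exact: le_trans (f0 0) (fM 0). Qed.

Let bounded_integrable (g : R -> R) (i : interval R) : measurable_fun setT g ->
  (mu [set` i] < +oo)%E -> (forall x, 0 <= g x <= M) ->
  mu.-integrable [set` i] (EFin \o g).
Proof.
move=> mg ifin gM; apply: measurable_bounded_integrable => //.
  exact: measurable_funTS.
exists M; split; first exact: num_real.
by move=> N MN x _ /=; have /andP[? ?] := gM x; rewrite ger0_norm// (le_trans _ (ltW MN)).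
Qed.

Let itv_lty (a b : itv_bound R) (x y : R) :
  (BLeft x <= a)%O -> (b <= BRight y)%O -> (mu [set` Interval a b] < +oo)%E.
Proof.
move=> xa yb; apply: (@le_lt_trans _ _ (mu `[x, y])).
  apply: le_measure; rewrite ?inE//; exact: subset_itvScc.
by rewrite /= lebesgue_measure_itv/=; case: ifP => // _; rewrite -EFinB ltry.
Qed.

Let increment (g : R -> R) a b : measurable_fun setT g ->
  (forall x, 0 <= g x <= M) -> 0 <= a -> a <= b ->
  \int[mu]_(x in `[0, b]) g x - \int[mu]_(x in `[0, a]) g x =
  \int[mu]_(x in `]a, b]) g x.
Proof.
move=> mg gM a0 ab; apply: Rintegral_itvB; rewrite ?bnd_simp//.
by apply: bounded_integrable => //; apply: (@itv_lty _ _ 0 b); rewrite bnd_simp.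
Qed.

Let const_increment (c a b : R) : 0 <= a -> a <= b ->
  \int[mu]_(x in `]a, b]) c = c * (b - a).
Proof.
move=> a0 ab; rewrite Rintegral_cst//= lebesgue_measure_itv/= lte_fin.
by move: ab; rewrite le_eqVlt => /predU1P[->|->//]; rewrite ltxx subrr.
Qed.

Let L v := \int[mu]_(x in `[0, v]) f x.

Let fbound x : 0 <= f x <= M. Proof. by rewrite f0 fM. Qed.

Let L_increment a b : 0 <= a -> a <= b -> 0 <= L b - L a <= M * (b - a).
Proof.
move=> a0 ab; rewrite increment//.
rewrite Rintegral_ge0//= -const_increment// le_Rintegral//.
- by apply: bounded_integrable => //; apply: (@itv_lty _ _ a b); rewrite bnd_simp.
- apply: bounded_integrable => //; last by move=> x; rewrite M0 lexx.
  by apply: (@itv_lty _ _ a b); rewrite bnd_simp.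
Qed.

Let L_nd : nondecreasing_fun L.
Proof.
move=> a b ab; have [a0|a0] := leP 0 a.
  by rewrite -subr_ge0; have /andP[] := L_increment a0 ab.
rewrite {1}/L set_itv_ge ?bnd_simp -?ltNge// Rintegral_set0.
exact: Rintegral_ge0.
Qed.

Let h x := f x * expR (- L x).

Let mh : measurable_fun setT h.
Proof.
apply: measurable_funM => //; apply: measurableT_comp => //.
by apply: measurableT_comp => //; exact: nondecreasing_measurable.
Qed.

Let L0 x : 0 <= L x. Proof. exact: Rintegral_ge0. Qed.

Let hbound x : 0 <= h x <= M.
Proof.
rewrite /h mulr_ge0 ?expR_ge0//= -[leRHS]mulr1 ler_pM ?expR_ge0//.
by rewrite -expR0 ler_expR oppr_le0.
Qed.

Let K v := \int[mu]_(x in `[0, v]) h x.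

Let K_increment a b : 0 <= a -> a <= b ->
  expR (- L b) * (L b - L a) <= K b - K a <= expR (- L a) * (L b - L a).
Proof.
move=> a0 ab; rewrite !increment//.
have fin : (mu `]a, b] < +oo)%E by apply: (@itv_lty _ _ a b); rewrite bnd_simp.
have intf : mu.-integrable `]a, b] (EFin \o f) by exact: bounded_integrable.
have inth : mu.-integrable `]a, b] (EFin \o h) by exact: bounded_integrable.
apply: Rintegral_weight_bounds => // x; rewrite /= in_itv/= => /andP[/ltW ax xb].
by rewrite !ler_expR !lerN2 !L_nd.
Qed.

(** With [L] the integral of [f], the two sides have the same increments up to a
    quadratic error: on [[a, b]] the integral on the left is, like the increment
    of [- expR (- L)], between [expR (- L b) * (L b - L a)] and
    [expR (- L a) * (L b - L a)], and these differ by at most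
    [M ^+ 2 * (b - a) ^+ 2]. *)
Lemma Rintegral_exp_survival r : 0 <= r ->
  \int[mu]_(x in `[0, r]) (f x * expR (- \int[mu]_(y in `[0, x]) f y)) =
  1 - expR (- \int[mu]_(y in `[0, r]) f y).
Proof.
move=> r0; rewrite -/(K r) -/(L r).
have K0 : K 0 = 0 by rewrite /K set_itv1 Rintegral_set1.
have L00 : L 0 = 0 by rewrite /L set_itv1 Rintegral_set1.
suff : K r + expR (- L r) = K 0 + expR (- L 0).
  by rewrite K0 L00 oppr0 expR0; lra.
apply: (@quadratic_increment_cst _ (fun v => K v + expR (- L v)) (M ^+ 2)) => //.
move=> a b a0 ab _.
have /andP[Kl Ku] := K_increment a0 ab.
have /andP[Ll Lu] := L_increment a0 ab.
have /andP[El Eu] := expRN_secant (L a) (L b).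
have E1 c : expR (- L c) <= 1 by rewrite -expR0 ler_expR oppr_le0.
have D0 : 0 <= expR (- L a) - expR (- L b).
  by apply: le_trans El; rewrite mulr_ge0 ?expR_ge0.
have DL : expR (- L a) - expR (- L b) <= L b - L a.
  by apply: (le_trans Eu); rewrite -[leRHS]mul1r ler_wpM2r.
have DLL : (expR (- L a) - expR (- L b)) * (L b - L a) <= M ^+ 2 * (b - a) ^+ 2.
  rewrite -exprMn expr2 ler_pM//.
  exact: le_trans Lu.
apply: le_trans DLL => {Lu DL}; rewrite /=.
move: (K a) (K b) (L a) (L b) (expR _) (expR _) Kl Ku Ll El Eu D0.
move=> Ka Kb La Lb Ea Eb Kl Ku Ll El Eu D0; rewrite mulrBl ler_norml; lra.
Qed.

End exponential_survival.

Lemma integral_exp_survival (R : realType) (f : R -> \bar R) (M r : R) :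
  measurable_fun setT f -> (forall x, 0 <= f x <= M%:E)%E -> 0 <= r ->
  (\int[lebesgue_measure]_(x in `[0%R, r])
     (f x * expeR (- \int[lebesgue_measure]_(y in `[0%R, x]) f y)) =
   1 - expeR (- \int[lebesgue_measure]_(y in `[0%R, r]) f y))%E.
Proof.
move=> mf fM r0.
have ffin x : f x \is a fin_num.
  have /andP[f0 fle] := fM x.
  by rewrite ge0_fin_numE// (le_lt_trans fle)// ltry.
pose g := fine \o f.
have fE x : f x = (g x)%:E by rewrite /g/= fineK.
have mg : measurable_fun setT g by exact: measurableT_comp.
have g0 x : 0 <= g x by rewrite -lee_fin -fE; have /andP[] := fM x.
have gM x : g x <= M by rewrite -lee_fin -fE; have /andP[] := fM x.
have M0 : 0 <= M := le_trans (g0 0) (gM 0).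
have Efin x : (\int[lebesgue_measure]_(y in `[0%R, x]) f y =
    (\int[lebesgue_measure]_(y in `[0%R, x]) g y)%:E)%E.
  transitivity (\int[lebesgue_measure]_(y in `[0%R, x]) (g y)%:E)%E.
    by apply: eq_integral => y _; exact: fE.
  rewrite /Rintegral fineK//.
  rewrite ge0_fin_numE; last by apply: integral_ge0 => y _; rewrite lee_fin.
  apply: (@le_lt_trans _ _ (\int[lebesgue_measure]_(y in `[0%R, x]) M%:E)%E).
    apply: ge0_le_integral => //.
    - by move=> y _; rewrite lee_fin.
    - by apply: measurable_funTS; exact/measurable_EFinP.
    - by move=> y _; rewrite lee_fin.
  rewrite integral_cst// lte_mul_pinfty ?lee_fin//= lebesgue_measure_itv/=.
  by case: ifP => // _; rewrite -EFinB ltry.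
rewrite Efin /= -EFinB -(Rintegral_exp_survival mg g0 gM r0).
transitivity (\int[lebesgue_measure]_(x in `[0%R, r])
  (g x * expR (- \int[lebesgue_measure]_(y in `[0, x]) g y))%:E)%E.
  by apply: eq_integral => x _; rewrite Efin fE.
rewrite /Rintegral fineK//.
rewrite ge0_fin_numE; last first.
  by apply: integral_ge0 => y _; rewrite lee_fin mulr_ge0 ?expR_ge0.
apply: (@le_lt_trans _ _ (\int[lebesgue_measure]_(y in `[0%R, r]) M%:E)%E).
  apply: ge0_le_integral => //.
  - by move=> y _; rewrite lee_fin mulr_ge0 ?expR_ge0.
  - apply/measurable_EFinP; apply: measurable_funTS.
    apply: measurable_funM => //; apply: measurableT_comp => //.
    apply: measurableT_comp => //; apply: nondecreasing_measurable => //.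
    move=> a b ab; rewrite -lee_fin -!Efin; apply: ge0_subset_integral => //.
    + exact: measurable_funTS.
    + by move=> y _; have /andP[] := fM y.
    + by apply: subset_itvl; rewrite bnd_simp.
  - move=> y _; rewrite lee_fin -[leRHS]mulr1 ler_pM ?expR_ge0//.
    by rewrite -expR0 ler_expR oppr_le0 Rintegral_ge0.
rewrite integral_cst// lte_mul_pinfty ?lee_fin//= lebesgue_measure_itv/=.
by case: ifP => // _; rewrite -EFinB ltry.
Qed.

(** * Compensator of a single jump *)

Lemma adde_cancell (R : realType) (x y z : \bar R) :
  (x \is a fin_num -> x + y = x + z -> y = z)%E.
Proof.
by move=> xfin xyz; rewrite -(addeK y xfin) -(addeK z xfin) addeC [(y + x)%E]addeC
   [(z + x)%E]addeC xyz addeC.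
Qed.

Lemma lty_bounded (R : realType) (z : \bar R) : (z < +oo)%E ->
  exists2 M : R, 0 <= M & (z <= M%:E)%E.
Proof.
move: z => [r _|//|_]; last by exists 0; rewrite ?leNye.
by exists `|r|; rewrite ?lee_fin ?ler_norm.
Qed.

Lemma eq_lee (R : realType) (x y : \bar R) : x = y -> (x <= y)%E.
Proof. by move=> ->. Qed.

Lemma eq_indic (T T' : Type) (R : pzRingType) (A : set T) (B : set T') x y :
  (A x <-> B y) -> \1_A x = \1_B y :> R.
Proof.
move=> AB; rewrite !indicE; congr ((nat_of_bool _)%:R).
by apply/idP/idP; rewrite !inE => /AB.
Qed.

Lemma integral_indicM d (T : measurableType d) (R : realType)
    (mu : {measure set T -> \bar R}) (D : set T) (f : T -> \bar R) :
  (\int[mu]_(x in D) f x = \int[mu]_x (f x * (\1_D x)%:E))%E.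
Proof.
rewrite integral_mkcond; apply: eq_integral => x _.
by rewrite patchE indicE; case: (x \in D); rewrite ?mule1 ?mule0.
Qed.

Lemma integral_setI_indicM d (T : measurableType d) (R : realType)
    (mu : {measure set T -> \bar R}) (A B : set T) (f : T -> \bar R) :
  (\int[mu]_(x in A `&` B) f x = \int[mu]_(x in A) ((\1_B x)%:E * f x))%E.
Proof.
rewrite integral_mkcondr; apply: eq_integral => x _.
by rewrite patchE indicE; case: (x \in B); rewrite ?mul1e ?mul0e.
Qed.

Lemma measurable_fun_indicE d d' (T : measurableType d) (T' : measurableType d')
    (R : realType) (A : set T') (phi : T -> T') :
  measurable A -> measurable_fun setT phi ->
  measurable_fun setT (fun x => (\1_A (phi x))%:E : \bar R).
Proof.
move=> mA mphi; by apply/measurable_EFinP; exact: measurableT_comp.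
Qed.

Lemma measurable_preimage d d' (T : measurableType d) (T' : measurableType d')
    (phi : T -> T') (A : set T') :
  measurable_fun setT phi -> measurable A -> measurable (phi @^-1` A).
Proof. by move=> mphi mA; rewrite -[X in measurable X]setTI; exact: mphi. Qed.

Section running_integral.
Local Open Scope ereal_scope.
Context d (Y : measurableType d) (R : realType) (r : Y * R -> \bar R).
Hypotheses (mr : measurable_fun setT r) (r0 : forall z, 0 <= r z).

Lemma measurable_running_integral : measurable_fun setT
  (fun z : Y * R => \int[lebesgue_measure]_(v in `[0%R, z.2]) r (z.1, v)).
Proof.
pose A : set ((Y * R) * R) := [set z | (0%R <= z.2)%R /\ (z.2 <= z.1.2)%R].
have mA : measurable A.
  rewrite (_ : A = snd @^-1` `[0%R, +oo[%classic `&`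
      (fun z : (Y * R) * R => (z.2 <= z.1.2)%R) @^-1` [set true]); last first.
    by apply/seteqP; split => z /=; rewrite in_itv/= andbT.
  apply: measurableI; first exact: measurable_preimage.
  apply: measurable_preimage => //; apply: measurable_fun_ler => //.
  exact: measurableT_comp.
pose F (z : (Y * R) * R) := r (z.1.1, z.2) * (\1_A z)%:E.
rewrite (_ : (fun _ => _) = fun z => \int[lebesgue_measure]_v F (z, v)).
  apply: measurable_fun_fubini_tonelli_F.
    apply: emeasurable_funM; last exact/measurable_EFinP/measurable_indic.
    apply: measurableT_comp => //; apply: measurable_fun_pair => //=.
    exact: measurableT_comp.
  by move=> z; rewrite mule_ge0 ?lee_fin.
apply/funext => z; rewrite integral_indicM; apply: eq_integral => v _.
rewrite /F/=; congr (_ * (_)%:E); rewrite !indicE; congr ((nat_of_bool _)%:R).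
apply/idP/idP; rewrite !inE/= in_itv/=; first by move/andP.
by move=> [-> ->].
Qed.

End running_integral.

Section exposure_times.
Local Open Scope ereal_scope.
Context d (T : measurableType d) (R : realType).

Lemma measurable_exposure (r : \bar R) :
  measurable [set u : R | 0 < u%:E <= r].
Proof.
rewrite (_ : [set _ | _] = `]0%R, +oo[%classic `&`
    (fun u : R => u%:E <= r) @^-1` [set true]); last first.
  apply/seteqP; split => u /=; rewrite in_itv/= andbT lte_fin; first by move/andP.
  by move=> [-> ->].
apply: measurableI => //.
by apply: measurable_preimage => //; apply: measurable_fun_lee.
Qed.

Lemma measurable_exposure_graph (theta : T -> \bar R) : measurable_fun setT theta ->
  measurable [set z : T * R | 0 < z.2%:E <= theta z.1].
Proof.
move=> mtheta; rewrite (_ : [set _ | _] = snd @^-1` `]0%R, +oo[%classic `&`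
    (fun z : T * R => z.2%:E <= theta z.1) @^-1` [set true]); last first.
  apply/seteqP; split => z /=; rewrite in_itv/= andbT lte_fin; first by move/andP.
  by move=> [-> ->].
apply: measurableI; first exact: measurable_preimage.
apply: measurable_preimage => //; apply: measurable_fun_lee => //.
  exact/measurable_EFinP.
exact: measurableT_comp.
Qed.

End exposure_times.

(** On [alive], the clock [theta] has hazard rate [total] given [h]. The event
    [E] is that of a ring of a certain kind, of hazard rate [rate] given [h]. *)
Section compensator.
Local Open Scope ereal_scope.
Context d d' (Omega : measurableType d) (Y : measurableType d') (R : realType).
Variables (P : probability Omega R).
Variables (h : Omega -> Y) (alive : set Omega) (theta : Omega -> \bar R).
Hypotheses (mh : measurable_fun setT h) (malive : measurable alive)
  (mtheta : measurable_fun setT theta) (theta_gt0 : forall e, 0 < theta e).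
Variable total : Y * R -> \bar R.
Hypotheses (mtotal : measurable_fun setT total) (total0 : forall z, 0 <= total z).
Hypothesis total_bounded : forall e, alive e ->
  exists M : R, forall u, total (h e, u) <= M%:E.

Local Notation leb := (@lebesgue_measure R).

Definition survival (z : Y * R) : \bar R :=
  expeR (- \int[leb]_(v in `[0%R, z.2]) total (z.1, v)).

Definition conditional_law (rate : Y * R -> \bar R) (E : set Omega) :=
  forall (H : set Y) (G : set R),
  measurable H -> measurable G -> G `<=` `]0%R, +oo[ ->
  P [set e | [/\ E e, H (h e) & (EFin @` G) (theta e)]] =
  \int[P]_(e in [set e | H (h e) /\ alive e])
    \int[leb]_(u in G) (rate (h e, u) * survival (h e, u)).

Hypothesis total_law : conditional_law total alive.

Let measurable_survival : measurable_fun setT survival.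
Proof.
apply: measurableT_comp; first exact: measurable_expeR.
by apply: measurableT_comp => //; exact: measurable_running_integral.
Qed.

Let survival0 z : 0 <= survival z. Proof. exact: expeR_ge0. Qed.

Let survival_le1 z : survival z <= 1.
Proof.
by rewrite -expeR0 lee_expeR oppe_le0 integral_ge0.
Qed.

Let survival_fin z : survival z \is a fin_num.
Proof. by rewrite ge0_fin_numE// (le_lt_trans (survival_le1 z)) ?ltry. Qed.

Let integral_total_survival e u : alive e -> (0 <= u)%R ->
  \int[leb]_(v in `]0%R, u[) (total (h e, v) * survival (h e, v)) =
  1 - survival (h e, u).
Proof.
move=> ea u0; have [M totM] := total_bounded ea.
have mtot : measurable_fun setT (fun v => total (h e, v)).
  exact: measurableT_comp.
rewrite -(@integral_exp_survival _ (fun v => total (h e, v)) M)//; last first.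
  by move=> v; rewrite total0 totM.
rewrite integral_itv_bndo_bndc ?integral_itv_obnd_cbnd//;
  by apply: measurable_funTS; apply: emeasurable_funM => //; exact: measurableT_comp.
Qed.

(** Integrating the law of [theta] over [[0, u[] gives the probability that the
    clock has not rung before [u]: it is [survival] at [u]. *)
Let tail (F : Y -> \bar R) (u : R) : measurable_fun setT F -> (forall y, 0 <= F y) ->
  (0 < u)%R ->
  \int[P]_e (F (h e) * (\1_(alive `&` [set e : Omega | (u%:E <= theta e)%E]) e)%:E) =
  \int[P]_e (F (h e) * ((\1_alive e)%:E * survival (h e, u))).
Proof.
move=> mF F0 u0.
have mge : measurable [set e | u%:E <= theta e].
  by rewrite -[X in measurable X]setTI; exact: emeasurable_fun_c_infty.
have mge' := measurableI _ _ malive mge.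
have msurv : measurable_fun setT (fun e => survival (h e, u)).
  by apply: measurableT_comp => //; exact: measurable_fun_pair.
have mg2 : measurable_fun setT (fun e => (\1_alive e)%:E * survival (h e, u)).
  by apply: emeasurable_funM => //; exact/measurable_EFinP/measurable_indic.
apply: (@integral_comp_eq _ _ _ _ _ _ _ _ _ h h _ _ measurable) => //.
- exact/measurable_EFinP/measurable_indic.
- by move=> e; rewrite mule_ge0 ?lee_fin.
- by rewrite sigma_algebra_id//; exact: sigma_algebra_measurable.
- by move=> A B mA mB; exact: measurableI.
- move=> A mA.
  have mhA : measurable (h @^-1` A) by exact: measurable_preimage.
  have mB := measurableI _ _ mhA malive.
  rewrite integral_indic//.
  rewrite -integral_setI_indicM.
  have mlt : measurable [set e | theta e < u%:E].
    by rewrite -[X in measurable X]setTI; exact: emeasurable_fun_infty_o.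
  have P_lt : P (h @^-1` A `&` alive `&` [set e | theta e < u%:E]) =
      \int[P]_(e in h @^-1` A `&` alive) (1 - survival (h e, u)).
    transitivity (P [set e | [/\ alive e, A (h e) & (EFin @` `]0%R, u[) (theta e)]]).
      congr (P _); apply/seteqP; split => e /=.
        move=> [[Ah ea]] eu; split => //; exists (fine (theta e)).
          have ef : theta e \is a fin_num.
            by rewrite ge0_fin_numE ?(ltW (theta_gt0 e))// (lt_trans eu) ?ltry.
          by rewrite in_itv/= -!lte_fin fineK// theta_gt0 eu.
        rewrite fineK// ge0_fin_numE ?(ltW (theta_gt0 e))// (lt_trans eu) ?ltry//.
      by move=> [ea Ah [v]]; rewrite /= in_itv/= => /andP[_ vu] <-; rewrite lte_fin.
    rewrite total_law//; last first.
      by move=> v /=; rewrite !in_itv/= => /andP[->].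
    apply: eq_integral => e; rewrite inE => -[_ ea].
    by rewrite integral_total_survival// ltW.
  have P_sum : P (h @^-1` A `&` alive `&` [set e | theta e < u%:E]) +
      P (h @^-1` A `&` (alive `&` [set e | u%:E <= theta e])) =
      P (h @^-1` A `&` alive).
    rewrite -measureU//.
    + congr (P _); apply/seteqP; split => e /=; first by move=> [[]|[? []]].
      by move=> [Ah ea]; case: (ltP (theta e) u%:E) => eu; [left|right].
    + exact: measurableI.
    + exact: measurableI.
    + by apply/seteqP; split => // e /= [[_ lt]] [_ [_]]; rewrite leNgt lt.
  have int_sum : \int[P]_(e in h @^-1` A `&` alive) (1 - survival (h e, u)) +
      \int[P]_(e in h @^-1` A `&` alive) survival (h e, u) =
      P (h @^-1` A `&` alive).
    rewrite -ge0_integralD//; last 3 first.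
    + by move=> e _; rewrite sube_ge0 ?survival_fin ?survival_le1.
    + by apply: emeasurable_funB => //; exact: measurable_funTS.
    + exact: measurable_funTS.
    rewrite (eq_integral (cst 1)) ?integral_cst ?mul1e// => e _.
    by rewrite subeK.
  have Pfin : P (h @^-1` A `&` alive `&` [set e | theta e < u%:E]) \is a fin_num.
    by apply: fin_num_measure; exact: measurableI.
  move: P_sum; rewrite -int_sum -P_lt => P_sum.
  by rewrite setIC; apply: (adde_cancell Pfin).
- rewrite integral_indic// setIT (le_lt_trans (probability_le1 _ _))//.
  exact: ltry.
Qed.

Variables (rate : Y * R -> \bar R) (E : set Omega).
Hypotheses (mrate : measurable_fun setT rate) (rate0 : forall z, 0 <= rate z).
Hypotheses (mE : measurable E) (E_theta : forall e, E e -> theta e < +oo).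
Hypothesis rate_law : conditional_law rate E.

Let density (z : Omega * R) : \bar R := (\1_alive z.1)%:E *
  ((\1_(`]0%R, +oo[%classic : set R) z.2)%:E *
   (rate (h z.1, z.2) * survival (h z.1, z.2))).

Let mhz : measurable_fun setT (fun z : Omega * R => (h z.1, z.2)).
Proof. by apply: measurable_fun_pair => //; exact: measurableT_comp. Qed.

Let mdensity : measurable_fun setT density.
Proof.
apply: emeasurable_funM; first exact: measurable_fun_indicE.
apply: emeasurable_funM; first exact: measurable_fun_indicE.
by apply: emeasurable_funM; exact: measurableT_comp.
Qed.

Let density0 z : 0 <= density z.
Proof. by rewrite /density !mule_ge0 ?lee_fin. Qed.

Let mjump : measurable_fun setT (fun e => (h e, fine (theta e))).
Proof. by apply: measurable_fun_pair => //; exact: measurableT_comp. Qed.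

Let joint_law (f : Y * R -> \bar R) : measurable_fun setT f -> (forall z, 0 <= f z) ->
  \int[P]_e (f (h e, fine (theta e)) * (\1_E e)%:E) =
  \int[P \x leb]_z (f (h z.1, z.2) * density z).
Proof.
move=> mf f0.
pose rect := [set A `*` B | A in (@measurable _ Y) & B in (@measurable _ R)].
apply: (@integral_comp_eq _ _ _ _ _ _ _ P (P \x leb)
  (fun e => (h e, fine (theta e))) (fun z => (h z.1, z.2))
  (fun e => (\1_E e)%:E) density rect) => //.
- exact/measurable_EFinP/measurable_indic.
- exact: measurable_prod_measurableType.
- move=> _ _ [A mA [B mB <-]] [A' mA' [B' mB' <-]]; exists (A `&` A'); first exact: measurableI.
  by exists (B `&` B'); [exact: measurableI|rewrite setXI].
- by exists setT => //; exists setT => //; rewrite setXTT.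
- move=> _ [A mA [B mB <-]].
  have mB0 : measurable (B `&` `]0%R, +oo[%classic) by exact: measurableI.
  rewrite integral_indic//; last exact: (measurable_preimage mjump (measurableX mA mB)).
  transitivity (P [set e | [/\ E e, A (h e) &
      (EFin @` (B `&` `]0%R, +oo[%classic)) (theta e)]]).
    congr (P _); apply/seteqP; split => e /=.
      move=> [Ee [Ah Bt]]; split => //; exists (fine (theta e)).
        split=> //; rewrite /= in_itv/= andbT fine_gt0// theta_gt0/=.
        exact: E_theta.
      by rewrite fineK// ge0_fin_numE ?(ltW (theta_gt0 _))// E_theta.
    by move=> [Ee Ah [v [Bv v0] vt]]; rewrite -vt.
  rewrite rate_law//.
  rewrite [RHS]integral_indicM fubini_tonelli1; last 2 first.
  + apply: emeasurable_funM => //; apply/measurable_EFinP/measurable_indic.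
    exact: (measurable_preimage mhz (measurableX mA mB)).
  + by move=> z; rewrite mule_ge0 ?lee_fin.
  rewrite integral_indicM; apply: eq_integral => e _; rewrite /fubini_F.
  rewrite -ge0_integralZr//; last 2 first.
  + by apply: measurable_funTS; apply: emeasurable_funM; apply: measurableT_comp.
  + by move=> v _; rewrite mule_ge0.
  rewrite [LHS]integral_indicM.
  apply: eq_integral => v _; rewrite /density /= !indicE.
  rewrite (_ : (e \in [set e | A (h e) /\ alive e]) = (h e \in A) && (e \in alive));
    last by apply/idP/andP; rewrite !inE.
  rewrite in_setI.
  rewrite (_ : ((e, v) \in _) = (h e \in A) && (v \in B)); last first.
    by apply/idP/andP; rewrite !inE.
  case: (h e \in A); case: (e \in alive); case: (v \in B); case: (v \in _);
    by rewrite /= ?(mule0, mul0e, mule1, mul1e).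
- rewrite integral_indic// setIT (le_lt_trans (probability_le1 _ _))//.
  exact: ltry.
Qed.

(** By [joint_law] the left side is the integral over [u] of the expectation of
    [f (h, u) * rate (h, u) * survival (h, u)]. By [tail], [survival (h, u)] may
    be replaced in the expectation by the indicator of [u <= theta]. *)
Lemma compensator_formula (f : Y * R -> \bar R) :
  measurable_fun setT f -> (forall z, 0 <= f z) ->
  \int[P]_(e in E) f (h e, fine (theta e)) =
  \int[P]_(e in alive) \int[leb]_(u in [set u : R | (0 < u%:E <= theta e)%E])
    (f (h e, u) * rate (h e, u)).
Proof.
move=> mf f0; rewrite integral_indicM joint_law//.
pose k (z : Omega * R) : \bar R := (\1_alive z.1)%:E *
  ((\1_[set z : Omega * R | (0 < z.2%:E <= theta z.1)%E] z)%:E *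
   (f (h z.1, z.2) * rate (h z.1, z.2))).
have mk : measurable_fun setT k.
  apply: emeasurable_funM; first exact: measurable_fun_indicE.
  apply: emeasurable_funM; last first.
    by apply: emeasurable_funM; exact: measurableT_comp.
  by apply/measurable_EFinP/measurable_indic; exact: measurable_exposure_graph.
have k0 z : 0 <= k z by rewrite /k !mule_ge0 ?lee_fin.
have mfd : measurable_fun setT (fun z => f (h z.1, z.2) * density z).
  by apply: emeasurable_funM => //; exact: measurableT_comp.
have fd0 z : 0 <= f (h z.1, z.2) * density z by rewrite mule_ge0.
transitivity (\int[P \x leb]_z k z); last first.
  rewrite fubini_tonelli1; [|exact: mk|exact: k0]; rewrite [RHS]integral_indicM.
  apply: eq_integral => e _; rewrite /fubini_F.
  have mexp : measurable [set u : R | (0 < u%:E <= theta e)%E].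
    exact: measurable_exposure.
  rewrite muleC -ge0_integralZl//; last 2 first.
  - by apply: measurable_funTS; apply: emeasurable_funM; apply: measurableT_comp.
  - by move=> v _; rewrite mule_ge0.
  rewrite [RHS]integral_indicM; apply: eq_integral => u _.
  rewrite /k/= !indicE.
  rewrite (_ : ((e, u) \in _) = (u \in [set u : R | (0 < u%:E <= theta e)%E])).
    by rewrite -muleA; congr (_ * _); rewrite muleC.
  by apply/idP/idP; rewrite !inE.
rewrite fubini_tonelli2; [|exact: mfd|exact: fd0].
rewrite fubini_tonelli2; [|exact: mk|exact: k0].
apply: eq_integral => u _; rewrite /fubini_G.
have [u0|u0] := ltP 0%R u; last first.
  rewrite !integral0_eq// => e _.
    rewrite /k/= [\1_ [set _ | _] _]indicE memNset ?mul0e ?mule0//=.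
    by rewrite lte_fin ltNge u0.
  rewrite /density/= [\1_`]0%R, +oo[ _]indicE memNset ?mul0e ?mule0//=.
  by rewrite in_itv/= ltNge u0.
have := @tail (fun y => f (y, u) * rate (y, u)) u.
move=> /(_ _ _ u0) tailE.
rewrite (eq_integral (fun e => f (h e, u) * rate (h e, u) *
  ((\1_alive e)%:E * survival (h e, u)))); last first.
  move=> e _; rewrite /density/= [\1_`]0%R, +oo[ _]indicE mem_set/=; last first.
    by rewrite in_itv/= u0.
  by rewrite mul1e -!muleA; congr (_ * _); rewrite muleCA.
rewrite -tailE; last 2 first.
- by apply: emeasurable_funM; apply: measurableT_comp.
- by move=> y; rewrite mule_ge0.
apply: eq_integral => e _; rewrite muleC /k/= [RHS]muleA; congr (_ * _).
rewrite -EFinM indicI !indicE; congr (_ * _)%:E; congr ((nat_of_bool _)%:R).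
by apply/idP/idP; rewrite !inE/= lte_fin u0.
Qed.

End compensator.

(** * Transition rates out of a state *)
Section charge_with_one_negative_atom.
Local Open Scope ereal_scope.
Context d (T : measurableType d) (R : realType).
Variables (nu : {charge set T -> \bar R}) (y : T).
Hypothesis my : measurable [set y].
Hypothesis nu_ge0 : forall D, measurable D -> ~ D y -> 0 <= nu D.

Let integral_split (m : {finite_measure set T -> \bar R}) :
  exists2 r : R, m [set y] = r%:E & forall f : T -> R,
  measurable_fun setT (EFin \o f) -> (forall x, 0 <= f x)%R ->
  \int[m]_x (f x)%:E = (f y * r)%:E + \int[m]_(x in ~` [set y]) (f x)%:E.
Proof.
exists (fine (m [set y])); first by rewrite fineK// fin_num_measure.
move=> f mf f0; rewrite -[in LHS](setUv [set y]) ge0_integral_setU//=.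
- rewrite EFinM fineK ?fin_num_measure//.
  rewrite (eq_integral (cst (f y)%:E)) ?integral_cst//.
  by move=> x; rewrite inE => ->.
- exact: measurableC.
- by rewrite setUv.
- by move=> x _; rewrite lee_fin.
- by rewrite disj_set2E setICr.
Qed.

Import HBNNSimple.

(** The negative part of [nu] is carried by [y], so that the bound on the
    integral of [f] is a bound on its integral away from [y]. It is stated for a
    simple function below [f] because the averages over actions and over
    trajectories are taken later of finite sums of values [nu D], and [f] is
    recovered at the very end by monotone convergence. *)
Lemma charge_integral_simple_le (f : T -> R) (s : {nnsfun T >-> R}) (C : R) :
  measurable_fun setT f -> (forall x, 0 <= f x)%R -> (forall x, s x <= f x)%R ->
  charge_integral nu (EFin \o f) <= C%:E ->
  \sum_(c \in range s) c%:E * nu (s @^-1` [set c] `\ y) <=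
  C%:E - (f y)%:E * nu [set y].
Proof.
move=> mf f0 sf; rewrite /charge_integral.
move: (cid _) => PN /=.
move: (svalP PN); set Pos := (sval PN).1; set Neg := (sval PN).2 => nuPN.
have [_ [mN negN] _ _] := nuPN.
have mEf : measurable_fun setT (EFin \o f) by exact/measurable_EFinP.
have f0' x : 0 <= (EFin \o f) x by rewrite lee_fin.
have mCy : measurable (~` [set y]) by exact: measurableC.
have jneg0 D : measurable D -> ~ D y -> jordan_neg nuPN D = 0.
  move=> mD Dy; rewrite jordan_negE cjordan_negE /crestr0 mem_set//= /crestr.
  apply/eqP; rewrite oppe_eq0; apply/eqP/le_anti/andP; split.
    by apply: negN => //; exact: measurableI.
  by apply: nu_ge0 => [|[]//]; exact: measurableI.
have jposE D : measurable D -> ~ D y -> jordan_pos nuPN D = nu D.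
  move=> mD Dy; rewrite [RHS](jordan_decomp nuPN)// /cadd/= cscaleN1.
  by have := jneg0 D mD Dy; rewrite jordan_negE => ->; rewrite oppe0 adde0.
have [jp jpE ->//] := integral_split (jordan_pos nuPN).
have [jn jnE ->//] := integral_split (jordan_neg nuPN).
have jatom : nu [set y] = jp%:E - jn%:E.
  by rewrite -jpE -jnE [LHS](jordan_decomp nuPN)// /cadd/= cscaleN1.
rewrite [X in _ - (_ + X)]null_set_integral//; last 2 first.
- exact: measurable_funTS.
- by apply: jneg0 => // /(_ erefl).
rewrite adde0 jatom.
have sumE : \sum_(c \in range s) c%:E * nu (s @^-1` [set c] `\ y) <=
    \int[jordan_pos nuPN]_(x in ~` [set y]) (f x)%:E.
  apply: (@le_trans _ _ (\int[jordan_pos nuPN]_(x in ~` [set y]) (s x)%:E)).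
    rewrite (eq_integral (fun x => \sum_(c \in range s)
        (c * \1_(s @^-1` [set c]) x)%:E)); last first.
      by move=> x _; rewrite (fimfunE s) -fsumEFin.
    rewrite ge0_integral_fsum//; last 2 first.
    - move=> c; apply: measurable_funTS.
      exact/measurable_EFinP/measurable_funM.
    - by move=> c x _; rewrite nnfun_muleindic_ge0.
    rewrite le_eqVlt; apply/orP; left; apply/eqP; apply: eq_fsbigr => c _.
    rewrite integralZl_indic_nnsfun//; congr (_ * _).
    have mc : measurable (s @^-1` [set c] `&` ~` [set y]) by exact: measurableI.
    by rewrite integral_indic// setDE; apply/esym; apply: jposE => // -[_]; exact.
  apply: ge0_le_integral => //.
  - by move=> x _; rewrite lee_fin.
  - exact/measurable_EFinP/measurable_funTS.
  - exact: measurable_funTS.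
  - by move=> x _; rewrite lee_fin.
move=> bound; apply: (le_trans sumE); move: bound.
have : 0 <= \int[jordan_pos nuPN]_(x in ~` [set y]) (f x)%:E.
  by apply: integral_ge0 => x _; rewrite lee_fin.
case: (\int[_]_(x in _) _) => [i| |]//.
by rewrite -?EFinM -?EFinB -?EFinD -?EFinB !lee_fin => _; lra.
Qed.

End charge_with_one_negative_atom.

Section rates_at_a_state.
Local Open Scope ereal_scope.
Context d d' (S : measurableType d) (A : measurableType d') (R : realType).
Variables (adm : S -> set A) (q : S -> A -> {charge set S -> \bar R}).
Hypothesis rates : transition_rates adm q.
Hypothesis measurable_point : forall y : S, measurable [set y].
Variable y : S.

Local Notation out a D := (q_ext adm q (Some y) a (D `\ y)).

Let mout D : measurable D -> measurable (D `\ y).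
Proof. by move=> mD; exact: measurableD. Qed.

Lemma q_ext_adm (a : A) D : adm y a -> q_ext adm q (Some y) (Some a) D = q y a D.
Proof. by move=> ya; rewrite /q_ext patchE mem_set. Qed.

Lemma q_ext_not_adm (a : option A) D :
  ~ (exists2 b, a = Some b & adm y b) -> q_ext adm q (Some y) a D = 0.
Proof.
case: a => // a na; rewrite /q_ext patchE memNset// => ya.
by apply: na; exists a.
Qed.

Lemma q_ext_cases (a : option A) :
  (exists2 b, a = Some b & adm y b) \/ (forall D, q_ext adm q (Some y) a D = 0).
Proof.
have [h|h] := pselect (exists2 b, a = Some b & adm y b); [by left|right] => D.
exact: q_ext_not_adm.
Qed.

Lemma out_rate_ge0 a D : measurable D -> 0 <= out a D.
Proof.
move=> mD; have [[b -> yb]|->//] := q_ext_cases a.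
rewrite q_ext_adm//; case: rates => _ _ _ + _.
by apply; [by []|exact: mout|move=> [_ /(_ erefl)]].
Qed.

(** The rates are conservative: [q y a setT = 0] determines the mass at [y]. *)
Lemma q_ext_split a D : measurable D ->
  q_ext adm q (Some y) a D = out a D - (\1_D y)%:E * out a setT.
Proof.
move=> mD; have [[b -> yb]|q0] := q_ext_cases a; last first.
  by rewrite !q0 mule0 sube0.
rewrite !q_ext_adm// indicE; have [yD|yD] := pselect (D y); last first.
  by rewrite memNset// mul0e sube0 not_setD1.
have qfin B : measurable B -> q y b B \is a fin_num by move=> ?; rewrite fin_num_measure.
have split B : measurable B -> B y -> q y b B = q y b (B `\ y) + q y b [set y].
  move=> mB By; have {1}-> : B = (B `\ y) `|` [set y].
    apply/seteqP; split => x /=; last by move=> [[]|->].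
    by move=> Bx; have [->|xy] := pselect (x = y); [right|left].
  apply: chargeU; [exact: mout|exact: measurable_point|].
  by apply/seteqP; split => // x [[_ xy]] /xy.
have q0 : q y b setT = 0 by case: rates => _ _ _ _ [+ _]; apply.
rewrite mem_set// mul1e (split D)//; congr (_ + _).
have := split setT measurableT I; rewrite q0.
have := qfin _ (mout measurableT); have := qfin _ (measurable_point y).
case: (q y b [set y]) => // u _; case: (q y b (setT `\ y)) => // v _ /eqP.
by rewrite -EFinD eqe => /eqP uv; rewrite -EFinN; congr (_%:E); lra.
Qed.

Lemma out_rate_le_total a D : measurable D -> out a D <= out a setT.
Proof.
move=> mD; have [[b -> yb]|q0] := q_ext_cases a; last by rewrite !q0.
rewrite !q_ext_adm//.
rewrite (_ : setT `\ y = (D `\ y) `|` (setT `\` D `\ y)).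
  rewrite chargeU.
  - rewrite leeDl//; case: rates => _ _ _ + _.
    apply; [by []|by apply: mout; exact: measurableD|by move=> [_ /(_ erefl)]].
  - exact: mout.
  - by apply: mout; exact: measurableD.
  - by apply/seteqP; split => // x [[Dx _] [[_ []]]].
apply/seteqP; split => x /=; last by move=> [[]|[[]]].
by move=> [_ xy]; have [Dx|Dx] := pselect (D x); [left|right].
Qed.

Lemma out_total a b : a = Some b -> adm y b -> out a setT = - q y b [set y].
Proof.
move=> -> yb; have := q_ext_split (Some b) (measurable_point y).
rewrite q_ext_adm// indicE mem_set// mul1e.
have -> : [set y] `\ y = set0 by rewrite setDv.
by rewrite [q_ext _ _ _ _ set0]q_ext_adm// charge0 sub0e => ->; rewrite oppeK.
Qed.

Lemma out_total_le_qstar a (M : R) : (0 <= M)%R -> qstar adm q y <= M%:E ->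
  out a setT <= M%:E.
Proof.
move=> M0 qM; have [[b ab yb]|->] := q_ext_cases a; last by rewrite lee_fin.
rewrite (out_total ab yb); apply: le_trans qM.
apply: (@le_trans _ _ `|q y b [set y]|).
  by rewrite -abseN lee_abs.
by apply: ereal_sup_ubound; exists b.
Qed.

Lemma measurable_q_ext D : measurable D ->
  measurable_fun setT (fun a => q_ext adm q (Some y) a D).
Proof.
move=> mD _ Y mY; rewrite setTI.
have mpatch : measurable_fun setT
    ((fun yb => q yb.1 yb.2 D) \_ (adm_graph adm)).
  have [_ mgraph mq _ _] := rates.
  exact: (iffLR (measurable_restrictT _ mgraph) (mq D mD)).
have := measurableT_comp mpatch (pair1_measurable y).
move=> /(_ measurableT _ mY); rewrite setTI; apply.
Qed.

Import HBNNSimple.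

Lemma out_rate_drift (w : S -> R) (rho b : R) (s : {nnsfun S >-> R}) a :
  measurable_fun setT w -> (forall x, 1 <= w x)%R -> (0 <= rho)%R -> (0 <= b)%R ->
  (forall x a, adm x a ->
     charge_integral (q x a) (fun y => (w y)%:E) <= (rho * w x + b)%:E) ->
  (forall x, s x <= w x)%R ->
  \sum_(c \in range s) c%:E * out a (s @^-1` [set c]) <=
  (rho * w y + b)%:E + (w y)%:E * out a setT.
Proof.
move=> mw w1 rho0 b0 drift sw.
have w0 x : (0 <= w x)%R by exact: le_trans (w1 x).
have [[c ac yc]|q0] := q_ext_cases a; last first.
  rewrite fsbig1 ?q0 ?mule0 ?adde0 ?lee_fin ?addr_ge0 ?mulr_ge0//.
  by move=> c _; rewrite q0 mule0.
rewrite (out_total ac yc) muleN ac.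
under eq_fsbigr do rewrite q_ext_adm//.
apply: charge_integral_simple_le => //; last exact: drift.
by move=> D mD Dy; case: rates => _ _ _ + _; apply.
Qed.

End rates_at_a_state.

Section integrated_rates.
Local Open Scope ereal_scope.
Context d d' (S : measurableType d) (A : measurableType d') (R : realType).
Variables (adm : S -> set A) (q : S -> A -> {charge set S -> \bar R}).
Hypothesis rates : transition_rates adm q.
Hypothesis measurable_point : forall y : S, measurable [set y].
Variables (y : S) (p : {measure set (option A) -> \bar R}).
Hypothesis p1 : p setT <= 1.

(** The intensity, as a function of the current state [y] and of the law [p] of
    the action. *)
Definition mean_out_rate D :=
  \int[p]_(a in range Some) q_ext adm q (Some y) a (D `\ y).

Let mSome : measurable (range (@Some A)).
Proof.
rewrite /measurable/= (_ : _ @^-1` _ = setT); first exact: measurableT.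
by apply/seteqP; split => // a _; exists a.
Qed.

Let p_Some : p (range Some) <= 1.
Proof. by apply: le_trans p1; apply: le_measure; rewrite ?inE. Qed.

Let mout D : measurable D ->
  measurable_fun (range Some) (fun a => q_ext adm q (Some y) a (D `\ y)).
Proof.
by move=> mD; apply: measurable_funTS; apply: measurable_q_ext => //; exact: measurableD.
Qed.

Lemma mean_out_rate_ge0 D : measurable D -> 0 <= mean_out_rate D.
Proof. by move=> mD; apply: integral_ge0 => a _; apply: out_rate_ge0. Qed.

Lemma mean_out_rate_le_total D : measurable D ->
  mean_out_rate D <= mean_out_rate setT.
Proof.
move=> mD; apply: ge0_le_integral => //.
- by move=> a _; apply: out_rate_ge0.
- exact: mout.
- exact: mout.
- by move=> a _; apply: out_rate_le_total.
Qed.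

Let integral_p_cst (M : R) : (0 <= M)%R ->
  \int[p]_(a in range Some) M%:E <= M%:E.
Proof. by move=> M0; rewrite integral_cst// -[leRHS]mule1 lee_wpmul2l ?lee_fin. Qed.

Lemma mean_out_rate_total_le_qstar (M : R) : (0 <= M)%R -> qstar adm q y <= M%:E ->
  mean_out_rate setT <= M%:E.
Proof.
move=> M0 qM; apply: le_trans (integral_p_cst M0).
apply: ge0_le_integral => //.
- by move=> a _; apply: out_rate_ge0.
- exact: mout.
- by move=> a _; apply: out_total_le_qstar.
Qed.

Let qstar_bounded : exists2 M : R, (0 <= M)%R & qstar adm q y <= M%:E.
Proof.
by have [_ _ _ _ [_ /(_ y)/lty_bounded]] := rates.
Qed.

Lemma mean_out_rate_fin_num D : measurable D -> mean_out_rate D \is a fin_num.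
Proof.
move=> mD; have [M M0 qM] := qstar_bounded.
rewrite ge0_fin_numE ?mean_out_rate_ge0//.
apply: (le_lt_trans (mean_out_rate_le_total mD)).
by apply: (le_lt_trans (mean_out_rate_total_le_qstar M0 qM)); rewrite ltry.
Qed.

Let integrable_out D : measurable D ->
  p.-integrable (range Some) (fun a => q_ext adm q (Some y) a (D `\ y)).
Proof.
move=> mD; apply/integrableP; split; first exact: mout.
rewrite (eq_integral (fun a => q_ext adm q (Some y) a (D `\ y))).
  by have := mean_out_rate_fin_num mD; rewrite ge0_fin_numE ?mean_out_rate_ge0.
by move=> a _; rewrite gee0_abs//; apply: out_rate_ge0.
Qed.

Lemma integral_q_ext D : measurable D ->
  \int[p]_(a in range Some) q_ext adm q (Some y) a D =
  mean_out_rate D - (\1_D y)%:E * mean_out_rate setT.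
Proof.
move=> mD; rewrite /mean_out_rate.
under eq_integral do rewrite q_ext_split//.
rewrite integralB//; [|exact: integrable_out|by apply: integrableZl => //; exact: integrable_out].
by rewrite integralZl//; exact: integrable_out.
Qed.

Import HBNNSimple.

Lemma mean_out_rate_drift (w : S -> R) (rho b : R) (s : {nnsfun S >-> R}) :
  measurable_fun setT w -> (forall x, 1 <= w x)%R -> (0 <= rho)%R -> (0 <= b)%R ->
  (forall x a, adm x a ->
     charge_integral (q x a) (fun y => (w y)%:E) <= (rho * w x + b)%:E) ->
  (forall x, s x <= w x)%R ->
  \sum_(c \in range s) c%:E * mean_out_rate (s @^-1` [set c]) <=
  (rho * w y + b)%:E + (w y)%:E * mean_out_rate setT.
Proof.
move=> mw w1 rho0 b0 drift sw.
have w0 x : (0 <= w x)%R by exact: le_trans (w1 x).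
have C0 : (0 <= rho * w y + b)%R by rewrite addr_ge0 ?mulr_ge0.
have ms c : measurable (s @^-1` [set c]) by [].
apply: (@le_trans _ _ (\int[p]_(a in range Some)
    ((rho * w y + b)%:E + (w y)%:E * q_ext adm q (Some y) a (setT `\ y)))); last first.
  rewrite ge0_integralD//=.
  - rewrite ge0_integralZl//=; first by rewrite leeD2r ?integral_p_cst.
    + exact: mout.
    + by move=> a _; apply: out_rate_ge0.
    + by rewrite lee_fin.
  - by move=> a _; rewrite mule_ge0 ?lee_fin//; apply: out_rate_ge0.
  - by apply: measurable_funeM; exact: mout.
apply: (@le_trans _ _ (\int[p]_(a in range Some)
    \sum_(c \in range s) c%:E * q_ext adm q (Some y) a (s @^-1` [set c] `\ y))).
  rewrite ge0_integral_fsum//; last 2 first.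
  - by move=> c; apply: measurable_funeM; exact: mout.
  - move=> c a _; have [c0|c0] := leP 0%R c.
      by rewrite mule_ge0 ?lee_fin//; apply: out_rate_ge0.
    rewrite preimage_nnfun0// set0D.
    by have [[b' -> yb]|->] := q_ext_cases adm q y a;
      rewrite ?q_ext_adm ?charge0 ?mule0.
  rewrite le_eqVlt; apply/orP; left; apply/eqP; apply: eq_fsbigr => c.
  rewrite inE => -[x _ <-]; rewrite ge0_integralZl//.
  - exact: mout.
  - by move=> a _; apply: out_rate_ge0.
  - by rewrite lee_fin.
apply: ge0_le_integral => //.
- move=> a _; rewrite fsume_ge0// => c [x _ <-].
  by rewrite mule_ge0 ?lee_fin//; apply: out_rate_ge0.
- apply: emeasurable_fsum => // c.
  by apply: measurable_funeM; exact: mout.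
- by apply: emeasurable_funD => //; apply: measurable_funeM; exact: mout.
- by move=> a _; apply: out_rate_drift.
Qed.

End integrated_rates.

(** * Trajectories *)

Section trajectories.
Local Open Scope ereal_scope.
Context d (S : measurableType d) (R : realType).
Implicit Types (e : trajectory S R) (t : R) (k : nat).

Definition alive k : set (trajectory S R) := [set e | range Some (state e k)].

Lemma sojourn_gt0 e k : 0 < sojourn e k.
Proof.
case: (trajectoryP e) => [/(_ k)[_ /andP[]]//|[n [_ fin inf]]].
have [kn|nk] := ltnP k n; first by have /andP[] := fin k kn.
by have [-> _] := inf k nk.
Qed.

Lemma jump_time0 e : jump_time e 0 = 0.
Proof. by rewrite /jump_time big_ord0. Qed.

Lemma jump_timeS e k : jump_time e k.+1 = jump_time e k + sojourn e k.
Proof. by rewrite /jump_time big_ord_recr. Qed.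

Lemma jump_time_ge0 e k : 0 <= jump_time e k.
Proof. by apply: sume_ge0 => i _; exact/ltW/sojourn_gt0. Qed.

Lemma jump_time_nd e : nondecreasing_seq (jump_time e).
Proof.
apply/nondecreasing_seqP => k; rewrite jump_timeS leeDl//.
exact/ltW/sojourn_gt0.
Qed.

Lemma alive_jump_time e k : alive k e <-> jump_time e k < +oo.
Proof.
split.
  move=> ak; rewrite /jump_time; apply: lte_sum_pinfty => i _.
  case: (trajectoryP e) => [/(_ i)[_ /andP[]]//|[n [_ fin inf]]].
  have [/fin/andP[]//|ni] := ltnP i n.
  have := ltn_ord i; move: ak; case: k i ni => [|k] i ni; first by case: i ni.
  move=> + ik; rewrite /alive/=.
  by have [_ ->] := inf k (leq_trans ni ik); case.
move=> Tk; case: (trajectoryP e) => [/(_ k)[]//|[n [al _ inf]]].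
have [/al//|nk] := leqP k n.
have : jump_time e n.+1 <= jump_time e k by exact: jump_time_nd.
have [sn _] := inf n (leqnn n).
rewrite jump_timeS sn addey; last by rewrite -ltNye (lt_le_trans _ (jump_time_ge0 e n)).
by rewrite leye_eq => /eqP Tkoo; rewrite Tkoo ltxx in Tk.
Qed.

Lemma alive_le e k l : (l <= k)%N -> alive k e -> alive l e.
Proof.
by move=> lk /alive_jump_time Tk; apply/alive_jump_time;
  apply: le_lt_trans Tk; exact: jump_time_nd.
Qed.

Lemma aliveS e k : alive k.+1 e <-> alive k e /\ sojourn e k < +oo.
Proof.
rewrite !alive_jump_time jump_timeS; split=> [T|[Tk sk]]; last by rewrite lte_add_pinfty.
split; apply: le_lt_trans T; first by rewrite leeDl// ltW// sojourn_gt0.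
by rewrite leeDr// jump_time_ge0.
Qed.

Lemma alive_fin_num e k : alive k e -> jump_time e k \is a fin_num.
Proof. by move=> /alive_jump_time Tk; rewrite ge0_fin_numE// jump_time_ge0. Qed.

Lemma before_alive e k t : jump_time e k <= t%:E -> alive k e.
Proof. by move=> Tt; apply/alive_jump_time; rewrite (le_lt_trans Tt)// ltry. Qed.

(** The sojourns are disjoint, so that the point chosen in the definition of
    [xi_left] is unique. *)
Lemma xi_leftE e t k : jump_time e k < t%:E <= jump_time e k.+1 ->
  xi_left e t = state e k.
Proof.
move=> kt; rewrite /xi_left ifF; last first.
  apply/negbTE; rewrite gt_eqF// -lte_fin.
  by apply: le_lt_trans (jump_time_ge0 e k) _; have /andP[] := kt.
apply: xget_subset1; first by exists k.
have key j l : jump_time e j < t%:E <= jump_time e j.+1 ->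
    jump_time e l < t%:E <= jump_time e l.+1 -> (j <= l)%N.
  move=> /andP[jt _] /andP[_ tl]; rewrite leqNgt; apply/negP => lj.
  have := lt_le_trans jt tl; rewrite ltNge.
  by rewrite (jump_time_nd e lj).
move=> x y [j jt ->] [l lt ->]; congr (state e _).
by apply/eqP; rewrite eqn_leq !key.
Qed.

Lemma xi_left_None e t : (0 < t)%R ->
  (forall k, ~~ (jump_time e k < t%:E <= jump_time e k.+1)) -> xi_left e t = None.
Proof.
move=> t0 nk; rewrite /xi_left gt_eqF//; apply: xgetPN => x [k kt xk].
by have := nk k; rewrite kt.
Qed.

Lemma xiE e t k : jump_time e k <= t%:E < jump_time e k.+1 ->
  xi e t = state e k.
Proof.
move=> kt; apply: xget_subset1; first by exists k.
have key j l : jump_time e j <= t%:E < jump_time e j.+1 ->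
    jump_time e l <= t%:E < jump_time e l.+1 -> (j <= l)%N.
  move=> /andP[jt _] /andP[_ tl]; rewrite leqNgt; apply/negP => lj.
  have := le_lt_trans jt tl; rewrite ltNge.
  by rewrite (jump_time_nd e lj).
move=> x y [j jt ->] [l lt ->]; congr (state e _).
by apply/eqP; rewrite eqn_leq !key.
Qed.

Lemma xi_None e t :
  (forall k, ~~ (jump_time e k <= t%:E < jump_time e k.+1)) -> xi e t = None.
Proof. by move=> nk; apply: xgetPN => x [k kt xk]; have := nk k; rewrite kt. Qed.

Let truncate_trajectoryP e k : alive k e ->
  is_trajectory (fun l => if (l <= k)%N then state e l else None)
    (fun l => if (l < k)%N then sojourn e l else +oo).
Proof.
move=> ak; right; exists k; split => [l lk|l lk|l kl].
- by rewrite lk; exact: alive_le ak.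
- by rewrite lk sojourn_gt0/=; have /aliveS[] := alive_le lk ak.
- by rewrite !ltnNge kl.
Qed.

(** A representation of the intensity is tied to it only until the next jump. On
    the trajectory with the same history and no further jump, this is until the
    end of time. *)
Definition truncate e k (ak : alive k e) : trajectory S R :=
  Trajectory (truncate_trajectoryP ak).

Lemma history_truncate e k (ak : alive k e) :
  history k (truncate ak) = history k e.
Proof.
rewrite /history/=; congr (_, _); apply: eq_from_tnth => i.
by rewrite !tnth_mktuple/= !ltn_ord.
Qed.

Lemma jump_time_truncate e k (ak : alive k e) :
  jump_time (truncate ak) k = jump_time e k.
Proof. by apply: eq_bigr => i _ /=; rewrite ltn_ord. Qed.

Lemma jump_timeS_truncate e k (ak : alive k e) :
  jump_time (truncate ak) k.+1 = +oo.
Proof.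
rewrite jump_timeS jump_time_truncate /= ltnn addey//.
by rewrite -ltNye (lt_le_trans _ (jump_time_ge0 e k)).
Qed.

Lemma state_truncate e k (ak : alive k e) : state (truncate ak) k = state e k.
Proof. by rewrite /= leqnn. Qed.

End trajectories.
Arguments alive {d S R} k.

Section measurability.
Local Open Scope ereal_scope.
Context d (S : measurableType d) (R : realType).
Local Notation Om := (Omega S R).

Lemma measurable_state k : measurable_fun setT (fun e : Om => state e k).
Proof.
move=> _ D mD; rewrite setTI; apply: sub_sigma_algebra.
by left; exists k, D.
Qed.

Lemma measurable_sojourn k : measurable_fun setT (fun e : Om => sojourn e k).
Proof.
move=> _ D mD; rewrite setTI; apply: sub_sigma_algebra.
by right; exists k, D.
Qed.

Lemma measurable_jump_time k : measurable_fun setT (fun e : Om => jump_time e k).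
Proof. by apply: emeasurable_sum => i; exact: measurable_sojourn. Qed.

Lemma measurable_jumped k t : measurable [set e : Om | jump_time e k <= t%:E].
Proof.
rewrite -[X in measurable X]setTI.
by apply: emeasurable_fun_infty_c => //; exact: measurable_jump_time.
Qed.

(** The values of [history k], from which the current time and state can be read
    off by [hist_time] and [hist_state]. *)
Definition hist k := (option S * k.-tuple (\bar R * option S))%type.

Lemma measurable_history k :
  measurable_fun setT (history k : Om -> hist k).
Proof.
apply: measurable_fun_pair; first exact: measurable_state.
apply/measurable_fun_tnthP => i; rewrite /comp/=.
apply: (eq_measurable_fun (fun e : Om => (sojourn e i, state e i.+1))).
  by move=> e _; rewrite tnth_mktuple.
apply: measurable_fun_pair; first exact: measurable_sojourn.
exact: measurable_state.
Qed.

Definition hist_time k (h : hist k) : \bar R := \sum_(i < k) (tnth h.2 i).1.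

Lemma hist_timeE k e : hist_time (history k e) = jump_time e k.
Proof. by apply: eq_bigr => i _; rewrite tnth_mktuple. Qed.

Lemma measurable_hist_time k : measurable_fun setT (@hist_time k).
Proof.
apply: emeasurable_sum => i.
apply: (measurableT_comp (f := fst)) => //.
apply: (measurableT_comp (f := fun x => tnth x i)) => //.
exact: measurable_tnth.
Qed.

Definition hist_state k : hist k -> option S :=
  if k is k'.+1 then fun h => (tnth h.2 ord_max).2 else fst.

Lemma hist_stateE k e : hist_state (history k e) = state e k.
Proof. by case: k => [//|k]; rewrite /hist_state tnth_mktuple. Qed.

Lemma measurable_hist_state k : measurable_fun setT (@hist_state k).
Proof.
case: k => [|k] /=; first exact: measurable_fst.
apply: (measurableT_comp (f := snd)) => //.
apply: (measurableT_comp (f := fun x => tnth x ord_max)) => //.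
exact: measurable_tnth.
Qed.

Lemma measurable_Some (D : set S) : measurable D -> measurable (Some @` D).
Proof.
move=> mD; rewrite /measurable/= (_ : _ @^-1` _ = D)//.
by apply/seteqP; split => [x [y Dy [<-]]//|x Dx]; exists x.
Qed.

Lemma measurable_in_state k (D : set S) : measurable D ->
  measurable [set e : Om | (Some @` D) (state e k)].
Proof.
move=> mD; apply: (measurable_preimage (measurable_state k)).
exact: measurable_Some.
Qed.

Lemma measurable_alive k : measurable (alive k : set Om).
Proof. exact: measurable_in_state. Qed.

Lemma measurable_oapp (g : S -> R) : measurable_fun setT g ->
  measurable_fun setT (oapp g 0%R).
Proof.
move=> mg _ Y mY; rewrite setTI.
by have := mg measurableT Y mY; rewrite setTI.
Qed.

End measurability.
Arguments hist {d} S R k.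

(** * Jump rates along a trajectory *)

Definition jump_law d (S : measurableType d) (R : realType)
    (P : probability (Omega S R) R)
    (m : forall k, hist S R k -> R -> set S -> \bar R) : Prop :=
  forall k H (G : set R) D,
  measurable H -> measurable G -> G `<=` `]0%R, +oo[ -> measurable D ->
  (P [set e | [/\ H (history k e), range Some (state e k),
                 (EFin @` G) (sojourn e k) &
                 (Some @` D) (state e k.+1)]] =
  \int[P]_(e in [set e | H (history k e) /\ range Some (state e k)])
    \int[lebesgue_measure]_(u in G)
      (m k (history k e) u D *
       expeR (- \int[lebesgue_measure]_(v in `[0%R, u])
                  m k (history k e) v setT)))%E.

Section intensity_representation.
Local Open Scope ereal_scope.
Context d d' (S : measurableType d) (A : measurableType d') (R : realType).
Variables (adm : S -> set A) (q : S -> A -> {charge set S -> \bar R}).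
Hypothesis rates : transition_rates adm q.
Hypothesis measurable_point : forall y : S, measurable [set y].
Variable pi : R.-pker (predictableType S R) ~> (option A).
Variable m : forall k, hist S R k -> R -> set S -> \bar R.
Hypothesis repr : represents_intensity adm q pi m.
Local Notation Om := (Omega S R).
Local Notation leb := (@lebesgue_measure R).

(** Cutting the representation [m] down to positive times and values makes it
    nonnegative everywhere, and bounded in time along each trajectory, without
    changing it where it is the intensity. *)
Definition rate k (D : set S) (z : hist S R k * R) : \bar R :=
  (\1_(`]0%R, +oo[%classic : set R) z.2)%:E * maxe 0 (m z.1 z.2 D).

Lemma measurable_rate k D : measurable D -> measurable_fun setT (rate (k:=k) D).
Proof.
move=> mD; apply: emeasurable_funM; first exact: measurable_fun_indicE.
apply: measurable_maxe => //; exact: repr.1.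
Qed.

Lemma rate_ge0 k D z : 0 <= rate (k:=k) D z.
Proof. by rewrite /rate mule_ge0 ?lee_fin// le_max lexx. Qed.

Let intensityE (e : trajectory S R) t y D : xi_left e t = Some y ->
  intensity adm q pi e t D = mean_out_rate adm q y (pi (e, t)) D.
Proof.
move=> ey; rewrite /intensity /integrated_rate /mean_out_rate ey.
rewrite (_ : [set z | Some z = Some y] = [set y])//.
by apply/seteqP; split => [z [->]|z ->].
Qed.

(** Evaluated on the trajectory stopped after the k-th jump, the representation
    [m] is seen to be an average of the rates [q] at every time [u]. *)
Let m_mean (e : trajectory S R) k y u : state e k = Some y -> (0 < u)%R ->
  exists2 p : {measure set (option A) -> \bar R}, p setT <= 1 &
    forall D, measurable D -> m (history k e) u D = mean_out_rate adm q y p D.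
Proof.
move=> ey u0; have ak : alive k e by exists y.
have /fineK Tk := alive_fin_num ak.
pose e' := truncate ak; pose t := (fine (jump_time e k) + u)%R.
have kt : jump_time e' k < t%:E <= jump_time e' k.+1.
  rewrite jump_timeS_truncate leey andbT jump_time_truncate /t EFinD Tk.
  by rewrite lteDl ?alive_fin_num ?lte_fin.
exists (pi (e', t)); first by rewrite prob_kernel.
move=> D mD; rewrite -(@intensityE e' t y); last first.
  by rewrite (xi_leftE kt) state_truncate.
rewrite (repr.2 k e' t D mD kt) history_truncate jump_time_truncate /t.
by rewrite addrC addKr.
Qed.

Let rate_mean (e : trajectory S R) k y u : state e k = Some y -> (0 < u)%R ->
  exists2 p : {measure set (option A) -> \bar R}, p setT <= 1 &
    forall D, measurable D -> rate D (history k e, u) = mean_out_rate adm q y p D.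
Proof.
move=> ey u0; have [p p1 mp] := m_mean ey u0; exists p => // D mD.
rewrite /rate/= indicE mem_set ?mul1e/=; last by rewrite in_itv/= u0.
by rewrite mp//; apply/max_idPr; exact: mean_out_rate_ge0.
Qed.

Lemma rateE (e : trajectory S R) k u D : alive k e -> (0 < u)%R -> measurable D ->
  rate D (history k e, u) = m (history k e) u D.
Proof.
move=> [y _ /esym ey] u0 mD; have [p p1 mp] := m_mean ey u0.
rewrite /rate/= indicE mem_set ?mul1e/=; last by rewrite in_itv/= u0.
by rewrite mp//; apply/max_idPr; exact: mean_out_rate_ge0.
Qed.

Lemma rate_nonpos k (h : hist S R k) u D : (u <= 0)%R -> rate D (h, u) = 0.
Proof.
move=> u0; rewrite /rate/= indicE memNset ?mul0e//=.
by rewrite in_itv/= ltNge u0.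
Qed.

Lemma rate_total_le_qstar (e : trajectory S R) k y u (M : R) :
  state e k = Some y -> (0 <= M)%R -> qstar adm q y <= M%:E ->
  rate setT (history k e, u) <= M%:E.
Proof.
move=> ey M0 qM; have [u0|u0] := ltP 0%R u; last by rewrite rate_nonpos ?lee_fin.
by have [p p1 mp] := rate_mean ey u0; rewrite !mp// mean_out_rate_total_le_qstar.
Qed.

Lemma rate_total_bounded (e : trajectory S R) k : alive k e ->
  exists M : R, forall u, rate setT (history k e, u) <= M%:E.
Proof.
move=> [y _ /esym ey].
have [_ _ _ _ [_ /(_ y)/lty_bounded[M M0 qM]]] := rates.
by exists M => u; exact: rate_total_le_qstar ey M0 qM.
Qed.

Import HBNNSimple.

Lemma rate_drift (w : S -> R) (rho b : R) (s : {nnsfun S >-> R})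
    (e : trajectory S R) k y u :
  measurable_fun setT w -> (forall x, 1 <= w x)%R -> (0 <= rho)%R -> (0 <= b)%R ->
  (forall x a, adm x a ->
     charge_integral (q x a) (fun y => (w y)%:E) <= (rho * w x + b)%:E) ->
  (forall x, s x <= w x)%R -> state e k = Some y ->
  \sum_(c \in range s) c%:E * rate (s @^-1` [set c]) (history k e, u) <=
  (rho * w y + b)%:E + (w y)%:E * rate setT (history k e, u).
Proof.
move=> mw w1 rho0 b0 drift sw ey.
have w0 x : (0 <= w x)%R by exact: le_trans (w1 x).
have [u0|u0] := ltP 0%R u; last first.
  rewrite fsbig1 ?rate_nonpos ?mule0 ?adde0 ?lee_fin ?addr_ge0 ?mulr_ge0//.
  by move=> c _; rewrite rate_nonpos ?mule0.
have [p p1 mp] := rate_mean ey u0; rewrite mp//.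
under eq_fsbigr do rewrite mp//.
exact: mean_out_rate_drift.
Qed.

Lemma integrated_rateE (e : trajectory S R) k y t D : measurable D ->
  state e k = Some y -> jump_time e k < t%:E <= jump_time e k.+1 ->
  let u := (t - fine (jump_time e k))%R in
  integrated_rate adm q pi e t D =
  rate D (history k e, u) - (\1_D y)%:E * rate setT (history k e, u).
Proof.
move=> mD ey kt u; have ak : alive k e by exists y.
have u0 : (0 < u)%R.
  by rewrite subr_gt0 -lte_fin fineK ?alive_fin_num//; case/andP: kt.
have xiy : xi_left e t = Some y by rewrite (xi_leftE kt).
have mE B : measurable B ->
    rate B (history k e, u) = mean_out_rate adm q y (pi (e, t)) B.
  by move=> mB; rewrite rateE// -(repr.2 k e t B mB kt) (intensityE _ xiy).
rewrite !mE// /integrated_rate xiy integral_q_ext//.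
by rewrite prob_kernel.
Qed.

Lemma integrated_rate_None (e : trajectory S R) t D : (0 < t)%R ->
  (forall k, ~~ (jump_time e k < t%:E <= jump_time e k.+1)) ->
  integrated_rate adm q pi e t D = 0.
Proof.
move=> t0 nk; rewrite /integrated_rate xi_left_None//.
by apply: integral0_eq.
Qed.

Section law.
Variable P : probability Om R.
Hypothesis law : jump_law P m.

Let conditional_law_jump k (D : set S) : measurable D ->
  conditional_law P (history k : Om -> hist S R k) (alive k)
    (fun e => sojourn e k) (rate setT) (rate D)
    [set e | (Some @` D) (state e k.+1)].
Proof.
move=> mD H G mH mG G0.
transitivity (P [set e | [/\ H (history k e), range Some (state e k),
                 (EFin @` G) (sojourn e k) &
                 (Some @` D) (state e k.+1)]]).
  congr (P _); apply/seteqP; split => e /=.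
    move=> [De He Ge]; split => //.
    have /aliveS[//] : alive k.+1 e by case: De => y _ ey; exists y.
  by move=> [].
apply: etrans; first exact: (law mH mG G0 mD).
apply: eq_integral => e; rewrite inE => -[_ ak].
apply: eq_integral => u; rewrite inE => Gu.
have := G0 u Gu; rewrite /= in_itv/= andbT => u0.
rewrite rateE//; congr (_ * expeR (- _)).
have mfst (g : hist S R k * R -> \bar R) : measurable_fun setT g ->
    measurable_fun setT (fun v => g (history k e, v)).
  by move=> mg; exact: (measurableT_comp mg (pair1_measurable _)).
rewrite -integral_itv_obnd_cbnd; last first.
  apply: measurable_funTS.
  by apply: (mfst (fun z => m z.1 z.2 setT)); exact: repr.1.
rewrite -[RHS]integral_itv_obnd_cbnd; last first.
  by apply: measurable_funTS; apply: mfst; exact: measurable_rate.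
apply: eq_integral => v; rewrite inE/= in_itv/= => /andP[v0 _].
by rewrite rateE.
Qed.

Let conditional_law_total k :
  conditional_law P (history k : Om -> hist S R k) (alive k)
    (fun e => sojourn e k) (rate setT) (rate setT) (alive k).
Proof.
move=> H G mH mG G0; apply: etrans (conditional_law_jump measurableT mH mG G0).
congr (P _); apply/seteqP; split => e /=.
  move=> [ak He [u Gu ue]]; split => //; last by exists u.
  have /aliveS : alive k e /\ sojourn e k < +oo by split => //; rewrite -ue ltry.
  by [].
move=> [De He Ge]; split => //.
by have /aliveS[] : alive k.+1 e by case: De => y _ ey; exists y.
Qed.

(** The event that ends the k-th sojourn in [compensator_formula] is a jump into
    [D]. The total rate of jumps is the case [D = setT]. *)
Lemma jump_compensator k D (f : hist S R k * R -> \bar R) : measurable D ->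
  measurable_fun setT f -> (forall z, 0 <= f z) ->
  \int[P]_(e in [set e | (Some @` D) (state e k.+1)])
    f (history k e, fine (sojourn e k)) =
  \int[P]_(e in alive k)
    \int[leb]_(u in [set u : R | (0 < u%:E <= sojourn e k)%E])
      (f (history k e, u) * rate D (history k e, u)).
Proof.
move=> mD mf f0.
apply: (@compensator_formula _ _ Om (hist S R k) R P (history k) (alive k)
  (fun e => sojourn e k) _ _ _ _ (rate setT)) => //.
- exact: measurable_history.
- exact: measurable_alive.
- exact: measurable_sojourn.
- by move=> e; exact: sojourn_gt0.
- exact: measurable_rate.
- by move=> z; exact: rate_ge0.
- by move=> e; exact: rate_total_bounded.
- exact: conditional_law_total.
- exact: measurable_rate.
- by move=> z; exact: rate_ge0.
- exact: measurable_in_state.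
- move=> e /= De.
  by have /aliveS[] : alive k.+1 e by case: De => y _ ey; exists y.
- exact: conditional_law_jump.
Qed.

End law.
End intensity_representation.

(** * Arrivals, departures and the forward equation *)

Section translation.
Local Open Scope ereal_scope.
Context (R : realType).
Local Notation leb := (@lebesgue_measure R).

Let measurable_shift (a : R) :
  measurable_fun setT ((fun x => x + a)%R : measurableTypeR R -> measurableTypeR R).
Proof. exact: measurable_funD. Qed.

Lemma lebesgue_measure_translation (a : R) (A : set R) : measurable A ->
  pushforward leb ((fun x => x + a)%R : _ -> measurableTypeR R) A = leb A.
Proof.
move=> mA; apply/esym/lebesgue_measure_unique => //= _ [[x y]] _ <-.
rewrite /pushforward (_ : _ @^-1` _ = `](x - a)%R, (y - a)%R]%classic); last first.
  by apply/seteqP; split => z /=; rewrite !in_itv/= ltrBlDr lerBrDr.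
rewrite !lebesgue_measure_itv/= !lte_fin ltrD2r; case: ifPn => // _.
by rewrite -!EFinB; congr (_%:E); ring.
Qed.

Lemma integral_translation (a : R) (f : R -> \bar R) :
  measurable_fun setT f -> (forall x, 0 <= f x) ->
  \int[leb]_x f x = \int[leb]_x f (x + a)%R.
Proof.
move=> mf f0.
transitivity (\int[pushforward leb ((fun x => x + a)%R : _ -> measurableTypeR R)]_x f x).
  by apply: eq_measure_integral => A mA _; apply/esym/lebesgue_measure_translation.
by rewrite ge0_integral_pushforward.
Qed.

End translation.

Section arrivals.
Local Open Scope ereal_scope.
Context d d' (S : measurableType d) (A : measurableType d') (R : realType).
Variables (adm : S -> set A) (q : S -> A -> {charge set S -> \bar R}).
Hypothesis rates : transition_rates adm q.
Hypothesis measurable_point : forall y : S, measurable [set y].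
Variable pi : R.-pker (predictableType S R) ~> (option A).
Variable m : forall k, hist S R k -> R -> set S -> \bar R.
Hypothesis repr : represents_intensity adm q pi m.
Local Notation Om := (Omega S R).
Local Notation leb := (@lebesgue_measure R).
Variable P : probability Om R.
Hypothesis law : jump_law P m.

(** The k-th sojourn, up to time [t], on the space of pairs of a trajectory and a
    time. *)
Definition during (t : R) k : set (Om * R) :=
  [set z | (jump_time z.1 k < z.2%:E <= jump_time z.1 k.+1)%E /\ (z.2 <= t)%R].

Lemma measurable_during t k : measurable (during t k).
Proof.
have mT j : measurable_fun setT (fun z : Om * R => jump_time z.1 j).
  exact: (measurableT_comp (@measurable_jump_time _ S R j) measurable_fst).
have mS : measurable_fun setT (fun z : Om * R => z.2%:E).
  exact: measurableT_comp.
rewrite (_ : during t k =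
    (fun z : Om * R => (jump_time z.1 k < z.2%:E)%E) @^-1` [set true] `&`
    (fun z : Om * R => (z.2%:E <= jump_time z.1 k.+1)%E) @^-1` [set true] `&`
    snd @^-1` `]-oo, t]%classic).
  apply: measurableI; last exact: measurable_preimage.
  apply: measurableI; apply: measurable_preimage => //.
    exact: measurable_fun_lte.
  exact: measurable_fun_lee.
apply/seteqP; split => z; rewrite /during/= in_itv/=.
  by move=> [/andP[]].
by move=> [[-> ->]].
Qed.

(** The intensity of the jumps into [D] that end the k-th sojourn before time
    [t], restricted to the histories in [Z]. *)
Definition flow (t : R) k (Z : set (hist S R k)) (D : set S) (z : Om * R) : \bar R :=
  (\1_Z (history k z.1))%:E * ((\1_(during t k) z)%:E *
    rate m D (history k z.1 : hist S R k, z.2 - fine (jump_time z.1 k))%R).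

Lemma flow_ge0 t k Z D z : 0 <= flow (k:=k) t Z D z.
Proof.
by apply: mule_ge0; [rewrite lee_fin|apply: mule_ge0; [rewrite lee_fin|exact: rate_ge0]].
Qed.

Lemma measurable_flow t k Z D : measurable Z -> measurable D ->
  measurable_fun setT (flow (k:=k) t Z D).
Proof.
move=> mZ mD.
have mh : measurable_fun setT (fun z : Om * R => history k z.1 : hist S R k).
  exact: (measurableT_comp (@measurable_history _ S R k) measurable_fst).
apply: emeasurable_funM; first exact: measurable_fun_indicE.
apply: emeasurable_funM.
  by apply/measurable_EFinP/measurable_indic; exact: measurable_during.
have mz : measurable_fun setT (fun z : Om * R =>
    (history k z.1 : hist S R k, (z.2 - fine (jump_time z.1 k))%R)).
  apply: measurable_fun_pair => //; apply: measurable_funB => //.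
  apply: measurableT_comp => //.
  exact: (measurableT_comp (@measurable_jump_time _ S R k) measurable_fst).
exact: (measurableT_comp (measurable_rate repr (k:=k) mD) mz).
Qed.

(** The compensator formula for the indicator of the jumps before [t], with the
    time [u] since the last jump translated to the time [jump_time e k + u]. *)
Lemma arrival_formula (t : R) k Z D : measurable Z -> measurable D ->
  P [set e | [/\ Z (history k e), (Some @` D) (state e k.+1) &
                 jump_time e k.+1 <= t%:E]] =
  \int[P \x leb]_z flow (k:=k) t Z D z.
Proof.
move=> mZ mD.
pose before := [set z : hist S R k * R | (hist_time z.1 + z.2%:E <= t%:E)%E].
have mbefore : measurable before.
  rewrite (_ : before =
    (fun z : hist S R k * R => (hist_time z.1 + z.2%:E <= t%:E)%E) @^-1` [set true]).
    apply: measurable_preimage => //; apply: measurable_fun_lee => //.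
    apply: emeasurable_funD; last exact: measurableT_comp.
    exact: (measurableT_comp (@measurable_hist_time _ S R k) measurable_fst).
  by apply/seteqP; split.
pose f (z : hist S R k * R) : \bar R := (\1_Z z.1)%:E * (\1_before z)%:E.
have mf : measurable_fun setT f.
  apply: emeasurable_funM; first exact: measurable_fun_indicE.
  exact/measurable_EFinP/measurable_indic.
have f0 z : 0 <= f z by rewrite mule_ge0 ?lee_fin.
have mZ' : measurable [set e : Om | Z (history k e)].
  exact: (measurable_preimage (@measurable_history _ S R k)).
have mJ : measurable [set e : Om | (Some @` D) (state e k.+1)].
  exact: measurable_in_state.
have mT : measurable [set e : Om | jump_time e k.+1 <= t%:E].
  exact: measurable_jumped.
transitivity (\int[P]_(e in [set e | (Some @` D) (state e k.+1)])
    f (history k e, fine (sojourn e k))).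
  transitivity (\int[P]_(e in [set e | (Some @` D) (state e k.+1)])
     (\1_([set e | Z (history k e)] `&` [set e | (jump_time e k.+1 <= t%:E)%E]) e)%:E).
    rewrite integral_indic//; last exact: measurableI.
    congr (P _); apply/seteqP; split => e /=; first by move=> [].
    by move=> [[]].
  apply: eq_integral => e; rewrite inE/= => De.
  have /aliveS[ak sk] : alive k.+1 e by case: De => y _ ey; exists y.
  rewrite /f indicI EFinM; congr (_%:E * _%:E); apply: eq_indic => //.
  rewrite /before/= hist_timeE jump_timeS fineK// ge0_fin_numE//.
  exact/ltW/sojourn_gt0.
rewrite (jump_compensator rates measurable_point repr law mD mf f0).
rewrite fubini_tonelli1; [|exact: measurable_flow|by move=> z; exact: flow_ge0].
rewrite integral_indicM; apply: eq_integral => e _; rewrite /fubini_F.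
rewrite indicE; have [ak|ak] := pselect (alive k e); last first.
  rewrite memNset// mule0 integral0_eq// => s _.
  rewrite /flow [\1_(during _ _) _]indicE memNset ?mul0e ?mule0//=.
  move=> [/andP[Ts _] _]; apply: ak; apply: before_alive; exact: ltW Ts.
rewrite mem_set// mule1 [LHS]integral_indicM.
have Tk := alive_fin_num ak.
rewrite [RHS](@integral_translation _ (fine (jump_time e k))).
- apply: eq_integral => u _.
  have shiftK : (u + fine (jump_time e k) - fine (jump_time e k) = u :> R)%R by exact: addrK.
  rewrite /flow/= shiftK /f/=; move: (rate m D (history k e, u)) => r.
  rewrite -!muleA; congr (_ * _).
  rewrite muleC -muleA [RHS]muleC; congr (_ * _).
  rewrite -EFinM; congr (_%:E).
  transitivity (\1_([set u : R | (0 < u%:E <= sojourn e k)%E] `&`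
      [set u | before (history k e, u)]) u : R).
    by rewrite indicI/=; congr (_ * _)%R; apply: eq_indic.
  apply: eq_indic; rewrite /before/during/= hist_timeE jump_timeS.
  have [v ->] : exists v : R, jump_time e k = v%:E.
    by exists (fine (jump_time e k)); rewrite fineK.
  have -> : (v%:E < (u + fine v%:E)%:E) = (0 < u%:E) by rewrite !lte_fin ltrDr.
  have -> : ((u + fine v%:E)%:E <= v%:E + sojourn e k) = (u%:E <= sojourn e k).
    by rewrite /= addrC EFinD leeD2lE.
  have -> : (v%:E + u%:E <= t%:E) = (u + fine v%:E <= t)%R.
    by rewrite -EFinD addrC lee_fin.
  by split => [[/andP[-> ->]]|[/andP[-> ->]]].
- by apply: (measurableT_comp (measurable_flow _ mZ mD)); exact: pair1_measurable.
- by move=> s; exact: flow_ge0.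
Qed.

End arrivals.

Section forward_equation.
Local Open Scope ereal_scope.
Context d d' (S : measurableType d) (A : measurableType d') (R : realType).
Variables (adm : S -> set A) (q : S -> A -> {charge set S -> \bar R}).
Hypothesis rates : transition_rates adm q.
Hypothesis measurable_point : forall y : S, measurable [set y].
Variable pi : R.-pker (predictableType S R) ~> (option A).
Variable m : forall k, hist S R k -> R -> set S -> \bar R.
Hypothesis repr : represents_intensity adm q pi m.
Local Notation Om := (Omega S R).
Local Notation leb := (@lebesgue_measure R).
Variable P : probability Om R.
Hypothesis law : jump_law P m.

Lemma during_unique t j k (z : Om * R) : during t j z -> during t k z -> j = k :> nat.
Proof.
have key i l : during t i z -> during t l z -> (i <= l)%N.
  move=> [/andP[iz _] _] [/andP[_ zl] _]; rewrite leqNgt; apply/negP => li.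
  have := lt_le_trans iz zl; rewrite ltNge.
  by rewrite (jump_time_nd z.1 li).
by move=> jz kz; apply/eqP; rewrite eqn_leq !key.
Qed.

Lemma not_during_flow t k Z D (z : Om * R) : ~ during t k z -> flow m (k:=k) t Z D z = 0.
Proof. by move=> nz; rewrite /flow [\1_(during _ _) _]indicE memNset ?mul0e ?mule0. Qed.

Lemma during_flow t k Z D (z : Om * R) : during t k z -> flow m (k:=k) t Z D z =
  (\1_Z (history k z.1))%:E *
    rate m D (history k z.1 : hist S R k, z.2 - fine (jump_time z.1 k))%R.
Proof. by move=> kz; rewrite /flow [\1_(during _ _) _]indicE mem_set// mul1e. Qed.

Lemma sum_flow_single t (Z : forall k, set (hist S R k)) D (z : Om * R) k : during t k z ->
  \sum_(0 <= j <oo) flow m t (Z j) D z = flow m t (Z k) D z.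
Proof.
move=> kz; rewrite (nneseriesD1 (n := k))//; last by move=> j _; exact: flow_ge0.
rewrite eseries0 ?adde0// => j _ jk; apply: not_during_flow => jz.
by rewrite (during_unique jz kz) eqxx in jk.
Qed.

Lemma sum_flow_none t (Z : forall k, set (hist S R k)) D (z : Om * R) :
  (forall k, ~ during t k z) -> \sum_(0 <= j <oo) flow m t (Z j) D z = 0.
Proof. by move=> nz; apply: eseries0 => j _ _; exact: not_during_flow. Qed.

Definition at_state (D : set S) k : set (hist S R k) :=
  [set h | (Some @` D) (hist_state h)].
Arguments at_state : clear implicits.

Lemma measurable_at_state D k : measurable D -> measurable (at_state D k).
Proof.
by move=> mD; apply: (measurable_preimage (@measurable_hist_state _ S R k));
  exact: measurable_Some.
Qed.

Lemma departure_formula t k D : measurable D ->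
  P [set e | (Some @` D) (state e k) /\ jump_time e k.+1 <= t%:E] =
  \int[P \x leb]_z flow m t (at_state D k) setT z.
Proof.
move=> mD; rewrite -(arrival_formula rates measurable_point repr law)//; last first.
  exact: measurable_at_state.
congr (P _); apply/seteqP; split => e; rewrite /at_state/= hist_stateE.
  move=> [De Tt]; split => //.
  by have [y _ ey] := before_alive Tt; exists y.
by move=> [].
Qed.

(** At each time at most one sojourn is in progress, so at most one of the flows
    is nonzero, and it is a total jump rate at a state of [D]. *)
Lemma departure_rate_le t D (M : R) (z : Om * R) : measurable D -> (0 <= M)%R ->
  (forall y, D y -> qstar adm q y <= M%:E) ->
  \sum_(0 <= k <oo) flow m t (at_state D k) setT z <=
  M%:E * (\1_(`[0%R, t]%classic : set R) z.2)%:E.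
Proof.
move=> mD M0 qM.
have [[k kz]|nz] := pselect (exists k, during t k z); last first.
  rewrite sum_flow_none; first by rewrite mule_ge0 ?lee_fin.
  by move=> k kz; apply: nz; exists k.
have [/andP[Tz _] zt] := kz.
have z0 : (0 <= z.2)%R by rewrite -lee_fin (le_trans (jump_time_ge0 z.1 k))// ltW.
rewrite (sum_flow_single _ _ kz) during_flow// [in leRHS]indicE mem_set; last first.
  by rewrite /= in_itv/= z0.
rewrite mule1 indicE; have [Dz|Dz] := pselect (at_state D k (history k z.1)).
  rewrite mem_set// mul1e.
  move: Dz; rewrite /at_state/= hist_stateE => -[y Dy /esym ey].
  exact: (rate_total_le_qstar rates measurable_point repr _ ey M0 (qM y Dy)).
by rewrite memNset// mul0e lee_fin.
Qed.

Lemma integral_sum_flow t (Z : forall k, set (hist S R k)) D :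
  (forall k, measurable (Z k)) -> measurable D ->
  \int[P \x leb]_z (\sum_(0 <= k <oo) flow m t (Z k) D z) =
  \sum_(0 <= k <oo) \int[P \x leb]_z flow m t (Z k) D z.
Proof.
move=> mZ mD; apply: integral_nneseries => // k.
  by apply: (measurable_flow repr).
by move=> z _; exact: flow_ge0.
Qed.

Lemma sum_departures_le t D (M : R) : (0 <= t)%R -> measurable D -> (0 <= M)%R ->
  (forall y, D y -> qstar adm q y <= M%:E) ->
  \sum_(0 <= k <oo)
    P [set e | (Some @` D) (state e k) /\ jump_time e k.+1 <= t%:E] <=
  (M * t)%:E.
Proof.
move=> t0 mD M0 qM.
under eq_eseriesr do rewrite departure_formula//.
rewrite -integral_sum_flow//; last by move=> k; exact: measurable_at_state.
apply: (@le_trans _ _ (\int[P \x leb]_z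
    (M%:E * (\1_(`[0%R, t]%classic : set R) z.2)%:E))).
  apply: ge0_le_integral => //.
  - by move=> z _; apply: nneseries_ge0 => k _ _; exact: flow_ge0.
  - apply: ge0_emeasurable_sum => // [k z _ _|k _]; first exact: flow_ge0.
    by apply: (measurable_flow repr) => //; exact: measurable_at_state.
  - by apply: measurable_funeM; exact: measurable_fun_indicE.
  - by move=> z _; exact: departure_rate_le.
rewrite fubini_tonelli1; last 2 first.
- by apply: measurable_funeM; exact: measurable_fun_indicE.
- by move=> z; rewrite mule_ge0 ?lee_fin.
rewrite (eq_integral (cst (M * t)%:E)); last first.
  move=> e _; rewrite /fubini_F/= ge0_integralZl//; last first.
    exact/measurable_EFinP/measurable_indic.
  rewrite integral_indic//= setIT lebesgue_measure_itv/= lte_fin EFinM.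
  have [t_gt0|t_le0] := ltP 0%R t; first by rewrite -EFinB subr0.
  by have -> : t = 0%R by apply/le_anti/andP.
rewrite integral_cst// -[leRHS]mule1 lee_wpmul2l ?lee_fin ?mulr_ge0//.
exact: probability_le1.
Qed.

(** The arrivals in [D] are counted with the rate of jumping into [D] away from
    the current state, the departures with the total rate while in [D]; the
    difference is the rate [q] of [D] itself, by [q_ext_split]. *)
Lemma integrated_rate_flow e s t D : measurable D -> (0 < s <= t)%R ->
  integrated_rate adm q pi e s D =
  \sum_(0 <= k <oo) flow m t (fun _ : hist S R k => True) D (e, s) -
  \sum_(0 <= k <oo) flow m t (at_state D k) setT (e, s).
Proof.
move=> mD /andP[s0 st].
have [[k kes]|nes] := pselect (exists k, during t k ((e, s) : Om * R)); last first.
  rewrite !sum_flow_none ?sube0; last 2 first.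
  - by move=> k kes; apply: nes; exists k.
  - by move=> k kes; apply: nes; exists k.
  apply: integrated_rate_None => // k; apply/negP => ks.
  by apply: nes; exists k.
have [ks _] := kes; have /= Ts := ks.
have [y _ /esym ey] : alive k e.
  by apply: (@before_alive _ _ _ e k s); have /andP[/ltW] := Ts.
rewrite (sum_flow_single (fun k => fun _ : hist S R k => True) _ kes).
rewrite (sum_flow_single (at_state D) _ kes) !during_flow//=.
rewrite (integrated_rateE rates measurable_point repr mD ey Ts)/=.
rewrite [\1_(fun=> True) _]indicE mem_set// mul1e; congr (_ - _%:E * _).
apply: eq_indic; rewrite /at_state/= hist_stateE ey.
by split => [Dy|[z Dz [<-]]]//; exists y.
Qed.

(** The rates of arrivals and of departures have finite integrals, so that the
    integral of their difference may be split. *)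
Lemma integral_integrated_rate t D (M : R) : (0 <= t)%R -> measurable D ->
  (0 <= M)%R -> (forall y, D y -> qstar adm q y <= M%:E) ->
  \sum_(0 <= k <oo) P [set e | (Some @` D) (state e k.+1) /\
     jump_time e k.+1 <= t%:E] < +oo ->
  \int[P]_e \int[leb]_(s in `[0%R, t]) integrated_rate adm q pi e s D =
  \sum_(0 <= k <oo) P [set e | (Some @` D) (state e k.+1) /\
     jump_time e k.+1 <= t%:E] -
  \sum_(0 <= k <oo) P [set e | (Some @` D) (state e k) /\
     jump_time e k.+1 <= t%:E].
Proof.
move=> t0 mD M0 qM arr_fin.
pose arr (z : Om * R) := \sum_(0 <= k <oo) flow m t (fun _ : hist S R k => True) D z.
pose dep (z : Om * R) := \sum_(0 <= k <oo) flow m t (at_state D k) setT z.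
have mTrue k : measurable (fun _ : hist S R k => True) by exact: measurableT.
have marr : measurable_fun setT arr.
  apply: ge0_emeasurable_sum => // [k z _ _|k _]; first exact: flow_ge0.
  exact: (measurable_flow repr).
have mdep : measurable_fun setT dep.
  apply: ge0_emeasurable_sum => // [k z _ _|k _]; first exact: flow_ge0.
  by apply: (measurable_flow repr) => //; exact: measurable_at_state.
have arr0 z : 0 <= arr z by apply: nneseries_ge0 => k _ _; exact: flow_ge0.
have dep0 z : 0 <= dep z by apply: nneseries_ge0 => k _ _; exact: flow_ge0.
have int_arr : \int[P \x leb]_z arr z = \sum_(0 <= k <oo)
    P [set e | (Some @` D) (state e k.+1) /\ jump_time e k.+1 <= t%:E].
  rewrite integral_sum_flow//; apply: eq_eseriesr => k _.
  rewrite -(arrival_formula rates measurable_point repr law)//.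
  by congr (P _); apply/seteqP; split => e /= [].
have int_dep : \int[P \x leb]_z dep z = \sum_(0 <= k <oo)
    P [set e | (Some @` D) (state e k) /\ jump_time e k.+1 <= t%:E].
  rewrite integral_sum_flow//; last by move=> k; exact: measurable_at_state.
  by apply: eq_eseriesr => k _; rewrite -departure_formula.
have dep_fin : \int[P \x leb]_z dep z < +oo.
  by rewrite int_dep (le_lt_trans (sum_departures_le t0 mD M0 qM))// ltry.
have iarr : (P \x leb).-integrable setT arr.
  apply/integrableP; split => //; under eq_integral do rewrite gee0_abs//.
  by rewrite int_arr.
have idep : (P \x leb).-integrable setT dep.
  by apply/integrableP; split => //; under eq_integral do rewrite gee0_abs//.
rewrite -int_arr -int_dep -integralB//.
rewrite -(@integral12_prod_meas1 _ _ _ _ _ _ _ _ (integrableB measurableT iarr idep)).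
apply: eq_integral => e _; rewrite /fubini_F.
have out s : ~~ (0 < s <= t)%R -> arr (e, s) - dep (e, s) = 0.
  move=> ns; rewrite /arr /dep !sum_flow_none ?sube0// => k [/= /andP[Ts _] st].
    move: ns; rewrite st andbT -lte_fin.
    by rewrite (le_lt_trans (jump_time_ge0 e k) Ts).
  move: ns; rewrite st andbT -lte_fin.
  by rewrite (le_lt_trans (jump_time_ge0 e k) Ts).
have mdiff : measurable_fun setT (fun s => arr (e, s) - dep (e, s)).
  apply: emeasurable_funB.
    exact: (measurableT_comp marr (pair1_measurable e)).
  exact: (measurableT_comp mdep (pair1_measurable e)).
have rate_in s : (s \in `]0%R, t]%classic) -> integrated_rate adm q pi e s D =
    arr (e, s) - dep (e, s).
  by rewrite inE/= in_itv/= => st; exact: integrated_rate_flow.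
rewrite -integral_itv_obnd_cbnd; last first.
  apply: (eq_measurable_fun (fun s => arr (e, s) - dep (e, s))).
    by move=> s st; rewrite rate_in.
  exact: measurable_funTS.
transitivity (\int[leb]_(s in `]0%R, t]) (arr (e, s) - dep (e, s))).
  by apply: eq_integral => s; exact: rate_in.
rewrite [LHS]integral_mkcond; apply: eq_integral => s _ /=; rewrite patchE.
case: ifPn => // /negP; rewrite inE/= in_itv/= => /negP ns.
by rewrite out.
Qed.

End forward_equation.

Section occupation.
Local Open Scope ereal_scope.
Context d d' (S : measurableType d) (A : measurableType d') (R : realType).
Variables (adm : S -> set A) (q : S -> A -> {charge set S -> \bar R}).
Hypothesis rates : transition_rates adm q.
Hypothesis measurable_point : forall y : S, measurable [set y].
Variable pi : R.-pker (predictableType S R) ~> (option A).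
Variable m : forall k, hist S R k -> R -> set S -> \bar R.
Hypothesis repr : represents_intensity adm q pi m.
Local Notation Om := (Omega S R).
Local Notation leb := (@lebesgue_measure R).
Variable P : probability Om R.
Hypothesis law : jump_law P m.

Definition staying (t : R) (D : set S) k : set Om := [set e |
  (Some @` D) (state e k) /\ jump_time e k <= t%:E < jump_time e k.+1].

Lemma measurable_staying t D k : measurable D -> measurable (staying t D k).
Proof.
move=> mD; rewrite (_ : staying t D k = [set e | (Some @` D) (state e k)] `&`
  ([set e | jump_time e k <= t%:E] `\` [set e | jump_time e k.+1 <= t%:E])).
  by apply: measurableI; [exact: measurable_in_state|by apply: measurableD; exact: measurable_jumped].
apply/seteqP; split => e; rewrite /staying/=.
  by move=> [De /andP[kt tk]]; split => //; split => //; apply/negP; rewrite -ltNge.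
by move=> [De [-> /negP]]; rewrite -ltNge => ->.
Qed.

Lemma xi_staying t D :
  [set e : Om | (Some @` D) (xi e t)] = \bigcup_k staying t D k.
Proof.
apply/seteqP; split => e /=.
  have [[k kt]|nk] := pselect (exists k, jump_time e k <= t%:E < jump_time e k.+1).
    by rewrite (xiE kt) => De; exists k.
  rewrite xi_None; first by move=> [].
  by move=> k; apply/negP => kt; apply: nk; exists k.
by move=> [k _ [De kt]]; rewrite (xiE kt).
Qed.

Lemma trivIset_staying t D : trivIset setT (staying t D).
Proof.
have key i l e : staying t D i e -> staying t D l e -> (i <= l)%N.
  move=> [_ /andP[it _]] [_ /andP[_ tl]]; rewrite leqNgt; apply/negP => li.
  have := le_lt_trans it tl; rewrite ltNge.
  by rewrite (jump_time_nd e li).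
apply/trivIsetP => i j _ _; apply: contra_neqP => /eqP/set0P[e [ie je]].
by apply/eqP; rewrite eqn_leq (key _ _ e) ?(key _ _ e).
Qed.

Lemma prob_xi_staying t D : measurable D ->
  P [set e | (Some @` D) (xi e t)] = \sum_(0 <= k <oo) P (staying t D k).
Proof.
move=> mD; rewrite xi_staying; apply: measure_semi_bigcup.
- by move=> k; exact: measurable_staying.
- exact: trivIset_staying.
- by apply: bigcup_measurable => k _; exact: measurable_staying.
Qed.

Lemma prob_occupied t D k : measurable D ->
  P [set e | (Some @` D) (state e k) /\ jump_time e k <= t%:E] =
  P (staying t D k) +
  P [set e | (Some @` D) (state e k) /\ jump_time e k.+1 <= t%:E].
Proof.
move=> mD; rewrite -measureU//.
- congr (P _); apply/seteqP; split => e; rewrite /staying/=.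
    move=> [De kt]; have [tk|tk] := leP (jump_time e k.+1) t%:E; first by right.
    by left; rewrite kt.
  move=> [[De /andP[kt _]]//|[De kt]]; split => //.
  by apply: le_trans kt; exact: jump_time_nd.
- exact: measurable_staying.
- by apply: measurableI; [exact: measurable_in_state|exact: measurable_jumped].
- apply/seteqP; split => // e [[_ /andP[_ tk]] [_ kt]].
  by move: tk; rewrite ltNge kt.
Qed.

Lemma prob_initial t D : (0 <= t)%R -> 
  P [set e | (Some @` D) (state e 0%N) /\ jump_time e 0 <= t%:E] =
  P [set e | (Some @` D) (state e 0%N)].
Proof.
move=> t0; congr (P _); apply/seteqP; split => e /=; first by move=> [].
by rewrite jump_time0 lee_fin.
Qed.

(** Summing [prob_occupied] over [k], each visit to [D] that has begun is the
    initial one or follows an arrival, which balances the occupation of [D]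
    at [t] and the departures. *)
Lemma forward_equation t D (M : R) : (0 <= t)%R -> measurable D ->
  (0 <= M)%R -> (forall y, D y -> qstar adm q y <= M%:E) ->
  P [set e | (Some @` D) (xi e t)] =
  P [set e | (Some @` D) (state e 0%N)] +
  \int[P]_e \int[leb]_(s in `[0%R, t]) integrated_rate adm q pi e s D.
Proof.
move=> t0 mD M0 qM.
have mX : measurable [set e : Om | (Some @` D) (xi e t)].
  by rewrite xi_staying; apply: bigcup_measurable => k _; exact: measurable_staying.
have balance : P [set e | (Some @` D) (xi e t)] +
    \sum_(0 <= k <oo) P [set e | (Some @` D) (state e k) /\ jump_time e k.+1 <= t%:E] =
    P [set e | (Some @` D) (state e 0%N)] +
    \sum_(0 <= k <oo) P [set e | (Some @` D) (state e k.+1) /\ jump_time e k.+1 <= t%:E].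
  rewrite prob_xi_staying// -nneseriesD//.
  transitivity (\sum_(0 <= k <oo)
      P [set e | (Some @` D) (state e k) /\ jump_time e k <= t%:E]).
    by apply: eq_eseriesr => k _; rewrite [RHS]prob_occupied.
  rewrite nneseries_recl// prob_initial//; congr (_ + _).
  rewrite -(nneseries_addn (f := fun k =>
    P [set e | (Some @` D) (state e k) /\ jump_time e k <= t%:E])) => [|i]; last by [].
  by apply: eq_eseriesr => k _; rewrite addn1.
have dep := sum_departures_le rates measurable_point repr law t0 mD M0 qM.
have dep_ge0 : 0 <= \sum_(0 <= k <oo)
    P [set e | (Some @` D) (state e k) /\ jump_time e k.+1 <= t%:E].
  exact: nneseries_ge0.
have arr_ge0 : 0 <= \sum_(0 <= k <oo)
    P [set e | (Some @` D) (state e k.+1) /\ jump_time e k.+1 <= t%:E].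
  exact: nneseries_ge0.
have dep_fin : \sum_(0 <= k <oo) P [set e | (Some @` D) (state e k) /\
    jump_time e k.+1 <= t%:E] \is a fin_num.
  by rewrite ge0_fin_numE// (le_lt_trans dep)// ltry.
have Xfin : P [set e | (Some @` D) (xi e t)] \is a fin_num by rewrite fin_num_measure.
have X0fin : P [set e | (Some @` D) (state e 0%N)] \is a fin_num.
  by rewrite fin_num_measure//; exact: measurable_in_state.
have arr_fin : \sum_(0 <= k <oo) P [set e | (Some @` D) (state e k.+1) /\
    jump_time e k.+1 <= t%:E] \is a fin_num.
  rewrite ge0_fin_numE// (@le_lt_trans _ _ (P [set e | (Some @` D) (state e 0%N)] +
    \sum_(0 <= k <oo) P [set e | (Some @` D) (state e k.+1) /\
    jump_time e k.+1 <= t%:E]))//; first by rewrite leeDr.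
  by rewrite -balance lte_add_pinfty// -ge0_fin_numE.
rewrite (integral_integrated_rate rates measurable_point repr law t0 mD M0 qM); last first.
  by rewrite -ge0_fin_numE.
by rewrite addeA -balance addeK.
Qed.

End occupation.

(** * Energy balance of the weight function *)

Section growth.
Context (R : realType) (rho : R).

(** The antiderivative of [expR (rho * r)] that vanishes at [0]. *)
Definition growth (r : R) : R :=
  if rho == 0 then r else (expR (rho * r) - 1) / rho.

Lemma growth0 : growth 0 = 0.
Proof. by rewrite /growth mulr0 expR0 subrr mul0r if_same. Qed.

Lemma growthE r : expR (rho * r) = 1 + rho * growth r.
Proof.
rewrite /growth; case: eqP => [->|/eqP rho0]; first by rewrite !mul0r expR0 addr0.
by field.
Qed.

Lemma growth_ge0 r : 0 <= rho -> 0 <= r -> 0 <= growth r.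
Proof.
move=> rho0 r0; rewrite /growth; case: eqP => // _.
by rewrite divr_ge0// subr_ge0 -expR0 ler_expR mulr_ge0.
Qed.

Lemma measurable_growth : measurable_fun setT growth.
Proof.
rewrite /growth; case: eqP => // _.
apply: measurable_funM => //; apply: measurable_funB => //.
by apply: measurableT_comp => //; exact: measurable_funM.
Qed.

Let is_derive_growth (r u : R) :
  is_derive u 1 (fun v => - growth (r - v)) (expR (rho * (r - u))).
Proof.
have [rho0|rho0] := eqVneq rho 0.
  rewrite rho0 mul0r expR0.
  rewrite (_ : (fun v => - growth (r - v)) = (fun v => v - r)).
    by apply: is_derive_eq; rewrite subr0.
  by apply/funext => v; rewrite /growth rho0 eqxx opprB.
rewrite (_ : (fun v => - growth (r - v)) =
    (fun v => rho^-1 * (1 - expR (rho * (r - v))))); last first.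
  by apply/funext => v; rewrite /growth (negbTE rho0); field.
apply: is_derive_eq; rewrite /GRing.scale/=.
by field.
Qed.

Lemma integral_growth (r a : R) : 0 <= a ->
  (\int[lebesgue_measure]_(u in `]0%R, a]) (expR (rho * (r - u)))%:E =
   (growth r - growth (r - a))%:E)%E.
Proof.
rewrite le_eqVlt => /predU1P[<-|a0].
  by rewrite set_itvoc0 integral_set0 subr0 subrr.
have cont : continuous (fun u : R => expR (rho * (r - u))).
  move=> u; apply: continuous_comp; last exact: continuous_expR.
  apply: continuousM; first exact: cvg_cst.
  by apply: continuousB; [exact: cvg_cst|exact: cvg_id].
have contF : continuous (fun v => - growth (r - v)).
  move=> u; apply: differentiable_continuous; apply/derivable1_diffP.
  by have [] := is_derive_growth r u.
rewrite integral_itv_obnd_cbnd; last first.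
  by apply: measurable_funTS; apply/measurable_EFinP; exact: continuous_measurable_fun.
rewrite (@continuous_FTC2 _ _ (fun v => - growth (r - v)))//.
- by rewrite -EFinB subr0 opprK addrC.
- exact: continuous_subspaceT.
- split.
  + by move=> u _; have [] := is_derive_growth r u.
  + by apply: cvg_at_right_filter; exact: contF.
  + by apply: cvg_at_left_filter; exact: contF.
- by move=> u _; rewrite derive1E; exact: derive_val.
Qed.

End growth.

Section drift_of_a_jump.
Local Open Scope ereal_scope.
Context d d' (S : measurableType d) (A : measurableType d') (R : realType).
Variables (adm : S -> set A) (q : S -> A -> {charge set S -> \bar R}).
Hypothesis rates : transition_rates adm q.
Hypothesis measurable_point : forall y : S, measurable [set y].
Variable pi : R.-pker (predictableType S R) ~> (option A).
Variable m : forall k, hist S R k -> R -> set S -> \bar R.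
Hypothesis repr : represents_intensity adm q pi m.
Local Notation Om := (Omega S R).
Local Notation leb := (@lebesgue_measure R).
Variable P : probability Om R.
Hypothesis law : jump_law P m.

Variables (w : S -> R) (rho b : R).
Hypotheses (mw : measurable_fun setT w) (w_ge1 : forall y, (1 <= w y)%R).
Hypotheses (rho_ge0 : (0 <= rho)%R) (b_ge0 : (0 <= b)%R).
Hypothesis drift : forall y a, adm y a ->
  charge_integral (q y a) (fun z => (w z)%:E) <= (rho * w y + b)%:E.

Let w0 y : (0 <= w y)%R. Proof. exact: le_trans (w_ge1 y). Qed.

(** The times since the k-th jump at which the next one may still occur. *)
Definition exposure k (e : Om) : set R := [set u : R | (0 < u%:E <= sojourn e k)%E].

Lemma measurable_integral_exposure k (g : hist S R k * R -> \bar R) :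
  measurable_fun setT g -> (forall z, 0 <= g z) ->
  measurable_fun setT
    (fun e : Om => \int[leb]_(u in exposure k e) g (history k e, u)).
Proof.
move=> mg g0.
pose B : set (Om * R) := [set z | (0 < z.2%:E <= sojourn z.1 k)%E].
have mB : measurable B.
  exact: (measurable_exposure_graph (@measurable_sojourn _ S R k)).
pose G (z : Om * R) := g (history k z.1, z.2) * (\1_B z)%:E.
have mz : measurable_fun setT (fun z : Om * R => (history k z.1 : hist S R k, z.2)).
  apply: measurable_fun_pair => //.
  exact: (measurableT_comp (@measurable_history _ S R k) measurable_fst).
have mG : measurable_fun setT G.
  apply: emeasurable_funM; first exact: (measurableT_comp mg mz).
  exact/measurable_EFinP/measurable_indic.
rewrite (_ : (fun _ => _) = fubini_F leb G).
  by apply: measurable_fun_fubini_tonelli_F => // z; rewrite mule_ge0 ?lee_fin.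
apply/funext => e; rewrite integral_indicM; apply: eq_integral => u _.
by rewrite /G/=; congr (_ * _%:E); exact: eq_indic.
Qed.

Let W k (h : hist S R k) : R := oapp w 0%R (hist_state h).

Let W0 k (h : hist S R k) : (0 <= W h)%R.
Proof. by rewrite /W; case: (hist_state h). Qed.

Let mW k : measurable_fun setT (@W k).
Proof.
by apply: (measurableT_comp (measurable_oapp mw)); exact: measurable_hist_state.
Qed.

Section jump_drift.
Variables (k : nat) (f1 f2 : hist S R k * R -> \bar R).
Hypotheses (mf1 : measurable_fun setT f1) (mf2 : measurable_fun setT f2).
Hypotheses (f1_ge0 : forall z, 0 <= f1 z) (f2_ge0 : forall z, 0 <= f2 z).

Let mWz : measurable_fun setT (fun z : hist S R k * R => (W z.1)%:E).
Proof. by apply/measurable_EFinP; exact: (measurableT_comp (@mW k)). Qed.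

Let mrate D : measurable D -> measurable_fun setT (rate m (k:=k) D).
Proof. exact: (measurable_rate repr). Qed.

Let outer (e : Om) := \int[leb]_(u in exposure k e)
  (f1 (history k e, u) * (rho * W (history k e) + b)%:E).

Let inner (e : Om) := \int[leb]_(u in exposure k e)
  ((f1 (history k e, u) * (W (history k e))%:E + f2 (history k e, u)) *
   rate m setT (history k e, u)).

Import HBNNSimple.

(** For a simple function [s] below [w] the jump at the end of the sojourn is a
    finite sum of jumps into level sets of [s]. The compensator formula applies
    to each of them, and [rate_drift] bounds the sum pointwise. *)
Let jump_drift_simple (s : {nnsfun S >-> R}) : (forall y, s y <= w y)%R ->
  \int[P]_(e in [set e | (Some @` setT) (state e k.+1)])
    (f1 (history k e, fine (sojourn e k)) * (oapp s 0%R (state e k.+1))%:E +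
     f2 (history k e, fine (sojourn e k))) <=
  \int[P]_(e in alive k) (outer e + inner e).
Proof.
move=> sw.
pose E := [set e : Om | (Some @` setT) (state e k.+1)].
pose Ec c := [set e : Om | (Some @` (s @^-1` [set c])) (state e k.+1)].
(* On the range of [s] this is [c]; the sums need terms nonnegative for all [c]. *)
pose coef c : R := Num.max 0%R c.
have coef_ge0 c : 0 <= (coef c)%:E by rewrite lee_fin le_max lexx.
have coefE c : c \in range s -> coef c = c.
  by rewrite inE => -[y _ <-]; apply/max_idPr.
pose jh (e : Om) : hist S R k * R := (history k e, fine (sojourn e k)).
have mjh : measurable_fun setT jh.
  apply: measurable_fun_pair; first exact: measurable_history.
  by apply: measurableT_comp => //; exact: measurable_sojourn.
have mEc c : measurable (Ec c) by exact: measurable_in_state.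
have mE : measurable E by exact: measurable_in_state.
have mf1j : measurable_fun setT (f1 \o jh) by exact: measurableT_comp.
have mf2j : measurable_fun setT (f2 \o jh) by exact: measurableT_comp.
have jump_part : \int[P]_(e in E) (f1 (jh e) * (oapp s 0%R (state e k.+1))%:E) =
    \sum_(c \in range s) (coef c)%:E * \int[P]_(e in Ec c) f1 (jh e).
  transitivity (\int[P]_(e in E) \sum_(c \in range s)
      ((coef c)%:E * (f1 (jh e) * (\1_(Ec c) e)%:E))).
    apply: eq_integral => e; rewrite inE => -[z _ ez].
    rewrite -ez /= (fimfunE s z) -fsumEFin// ge0_mule_fsumr; last first.
      by move=> c; rewrite nnfun_muleindic_ge0.
    apply: eq_fsbigr => c cs; rewrite EFinM muleCA coefE//.
    congr (_ * (_ * _%:E)); apply: eq_indic; rewrite /Ec/= -ez.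
    by split=> [sz|[z' sz' [<-]]]//; exists z.
  rewrite ge0_integral_fsum//; last 2 first.
  - move=> c; apply: measurable_funeM; apply: measurable_funTS.
    by apply: emeasurable_funM => //; exact/measurable_EFinP/measurable_indic.
  - by move=> c e _; rewrite !mule_ge0// lee_fin.
  apply: eq_fsbigr => c cs; rewrite ge0_integralZl//; last 2 first.
  - apply: measurable_funTS.
    by apply: emeasurable_funM => //; exact/measurable_EFinP/measurable_indic.
  - by move=> e _; rewrite mule_ge0// lee_fin.
  congr (_ * _); rewrite [LHS]integral_indicM [RHS]integral_indicM.
  apply: eq_integral => e _; rewrite -muleA -EFinM; congr (_ * _%:E).
  rewrite !indicE -natrM mulnb; congr ((nat_of_bool _)%:R).
  apply/andP/idP; rewrite !inE; first by case.
  move=> Ee; split => //.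
  by case: Ee => z _ ez; exists z.
pose sum_rate (z : hist S R k * R) :=
  \sum_(c \in range s) (coef c)%:E * (f1 z * rate m (s @^-1` [set c]) z).
have msum_rate : measurable_fun setT sum_rate.
  apply: emeasurable_fsum => // c; apply: measurable_funeM.
  by apply: emeasurable_funM => //; exact: mrate.
have sum_rate0 z : 0 <= sum_rate z.
  by apply: fsume_ge0 => c _; apply: mule_ge0 => //; apply: mule_ge0 => //; exact: rate_ge0.
have mf1r D : measurable D -> measurable_fun setT (fun z => f1 z * rate m D z).
  by move=> mD; apply: emeasurable_funM => //; exact: mrate.
have f1r0 D z : 0 <= f1 z * rate m D z by apply: mule_ge0 => //; exact: rate_ge0.
have mf2r : measurable_fun setT (fun z => f2 z * rate m setT z).
  by apply: emeasurable_funM => //; exact: mrate.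
have f2r0 z : 0 <= f2 z * rate m setT z by apply: mule_ge0 => //; exact: rate_ge0.
have msec (g : hist S R k * R -> \bar R) (e : Om) : measurable_fun setT g ->
    measurable_fun (exposure k e) (fun u => g (history k e, u)).
  move=> mg; apply: measurable_funTS.
  exact: (measurableT_comp mg (pair1_measurable _)).
pose outz (z : hist S R k * R) := f1 z * (rho * W z.1 + b)%:E.
pose inz (z : hist S R k * R) := (f1 z * (W z.1)%:E + f2 z) * rate m setT z.
have outz_ge0 z : 0 <= outz z by rewrite mule_ge0// lee_fin addr_ge0// mulr_ge0.
have inz_ge0 z : 0 <= inz z.
  apply: mule_ge0; last exact: rate_ge0.
  by rewrite adde_ge0// mule_ge0// lee_fin.
have mout : measurable_fun setT outz.
  apply: emeasurable_funM => //; apply/measurable_EFinP.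
  apply: measurable_funD => //; apply: measurable_funM => //.
  by exact: (measurableT_comp (@mW k)).
have min_z : measurable_fun setT inz.
  apply: emeasurable_funM; last exact: mrate.
  by apply: emeasurable_funD => //; apply: emeasurable_funM.
rewrite ge0_integralD//; last 3 first.
- move=> e _; rewrite mule_ge0// lee_fin.
  by case: (state e k.+1) => //= y.
- apply: measurable_funTS; apply: emeasurable_funM => //.
  apply/measurable_EFinP.
  by apply: (measurableT_comp (measurable_oapp _)) => //; exact: measurable_state.
- exact: measurable_funTS.
rewrite jump_part.
have -> : \sum_(c \in range s) (coef c)%:E * \int[P]_(e in Ec c) f1 (jh e) =
    \int[P]_(e in alive k) \int[leb]_(u in exposure k e) sum_rate (history k e, u).
  transitivity (\sum_(c \in range s) \int[P]_(e in alive k) ((coef c)%:E *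
      \int[leb]_(u in exposure k e)
        (f1 (history k e, u) * rate m (s @^-1` [set c]) (history k e, u)))).
    apply: eq_fsbigr => c _.
    rewrite (jump_compensator rates measurable_point repr law _ mf1 f1_ge0)//.
    rewrite ge0_integralZl//.
    + exact: measurable_alive.
    + apply: measurable_funTS.
      exact: (measurable_integral_exposure (mf1r _ _)).
    + by move=> e _; apply: integral_ge0 => u _.
  rewrite -ge0_integral_fsum//; last 3 first.
  - exact: measurable_alive.
  - move=> c; apply: measurable_funeM; apply: measurable_funTS.
    exact: (measurable_integral_exposure (mf1r _ _)).
  - by move=> c e _; rewrite mule_ge0//; apply: integral_ge0 => u _.
  apply: eq_integral => e _; rewrite ge0_integral_fsum//.
  - apply: eq_fsbigr => c _; rewrite ge0_integralZl//.
    + exact: measurable_exposure.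
    + exact: (msec _ _ (mf1r _ _)).
  - exact: measurable_exposure.
  - by move=> c; apply: measurable_funeM; exact: (msec _ _ (mf1r _ _)).
  - by move=> c u _; rewrite mule_ge0.
rewrite (jump_compensator rates measurable_point repr law _ mf2 f2_ge0)//.
rewrite -ge0_integralD//; last 5 first.
- exact: measurable_alive.
- by move=> e _; apply: integral_ge0.
- by apply: measurable_funTS; exact: (measurable_integral_exposure msum_rate).
- by move=> e _; apply: integral_ge0.
- by apply: measurable_funTS; exact: (measurable_integral_exposure mf2r).
apply: ge0_le_integral.
- exact: measurable_alive.
- by move=> e _; rewrite adde_ge0// integral_ge0.
- apply: measurable_funTS; apply: emeasurable_funD.
    exact: (measurable_integral_exposure msum_rate).
  exact: (measurable_integral_exposure mf2r).
- apply: measurable_funTS; apply: emeasurable_funD.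
    exact: (measurable_integral_exposure mout outz_ge0).
  exact: (measurable_integral_exposure min_z inz_ge0).
move=> e [y _ /esym ey].
rewrite -ge0_integralD//; last 3 first.
- exact: measurable_exposure.
- exact: msec.
- exact: (msec _ _ mf2r).
rewrite [leRHS](_ : _ = \int[leb]_(u in exposure k e)
    (outz (history k e, u) + inz (history k e, u))); last first.
  rewrite ge0_integralD//.
  - exact: measurable_exposure.
  - exact: msec.
  - exact: msec.
apply: ge0_le_integral => //.
- exact: measurable_exposure.
- by move=> u _; rewrite adde_ge0.
- by apply: emeasurable_funD; [exact: msec|exact: (msec _ _ mf2r)].
- by apply: emeasurable_funD; exact: msec.
move=> u _; have Wy : W (history k e) = w y by rewrite /W hist_stateE ey.
have dr := rate_drift rates measurable_point repr u mw w_ge1 rho_ge0 b_ge0 drift sw ey.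
have -> : sum_rate (history k e, u) = f1 (history k e, u) *
    \sum_(c \in range s) c%:E * rate m (s @^-1` [set c]) (history k e, u).
  rewrite (eq_fsbigr (fun c => (coef c)%:E * rate m (s @^-1` [set c]) (history k e, u))).
    rewrite ge0_mule_fsumr; first by apply: eq_fsbigr => c _; rewrite muleCA.
    by move=> c; apply: mule_ge0 => //; exact: rate_ge0.
  by move=> c cs; rewrite coefE.
rewrite /outz /inz /= Wy.
move: (rate_ge0 m setT (history k e, u)) dr (f1_ge0 (history k e, u)) (f2_ge0 (history k e, u)).
move: (rate m setT (history k e, u)) (f1 (history k e, u)) (f2 (history k e, u)).
move=> r g1 g2 r0 dr g10 g20.
apply: (@le_trans _ _ (g1 * ((rho * w y + b)%:E + (w y)%:E * r) + g2 * r)).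
  by rewrite leeD2r// lee_wpmul2l.
rewrite ge0_muleDr ?mule_ge0 ?lee_fin ?addr_ge0 ?mulr_ge0//.
by rewrite ge0_muleDl ?mule_ge0 ?lee_fin// muleA addeA.
Qed.

Hypotheses (f1_fin : forall z, f1 z \is a fin_num) (f2_fin : forall z, f2 z \is a fin_num).

(** The mean of [w] after the jump exceeds its mean before the jump by at most the
    drift gathered during the sojourn. The weights [f1] and [f2] may depend on
    the time of the jump; the term in [f2] is there because the inequality is
    used for a time-dependent affine function of [w]. As the term in
    [w (state e k)] may be infinite on both sides, it is kept on the right. *)
Lemma jump_drift_le :
  \int[P]_(e in alive k.+1)
    (f1 (history k e, fine (sojourn e k)) * (oapp w 0%R (state e k.+1))%:E +
     f2 (history k e, fine (sojourn e k))) <=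
  \int[P]_(e in alive k) \int[leb]_(u in exposure k e)
    (f1 (history k e, u) * (rho * oapp w 0 (state e k) + b)%:E) +
  \int[P]_(e in alive k.+1)
    (f1 (history k e, fine (sojourn e k)) * (oapp w 0%R (state e k))%:E +
     f2 (history k e, fine (sojourn e k))).
Proof.
have mEw : measurable_fun setT (EFin \o w) by exact/measurable_EFinP.
pose s_ := nnsfun_approx measurableT mEw.
have w0' y : setT y -> 0 <= (EFin \o w) y by rewrite lee_fin.
have s_le j y : (s_ j y <= w y)%R.
  by rewrite -lee_fin /s_ nnsfun_approxE; exact: le_approx.
have s_cvg y : EFin \o s_ ^~ y @ \oo --> (w y)%:E by exact: cvg_nnsfun_approx.
have s_nd y : {homo (fun n => s_ n y) : i j / (i <= j)%N >-> (i <= j)%R}.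
  by move=> i j ij; exact/lefP/nd_nnsfun_approx.
pose jh (e : Om) : hist S R k * R := (history k e, fine (sojourn e k)).
have mjh : measurable_fun setT jh.
  apply: measurable_fun_pair; first exact: measurable_history.
  by apply: measurableT_comp => //; exact: measurable_sojourn.
have mf1j : measurable_fun setT (f1 \o jh) by exact: measurableT_comp.
have mf2j : measurable_fun setT (f2 \o jh) by exact: measurableT_comp.
have ms (g : S -> R) : measurable_fun setT g -> measurable_fun setT
    (fun e : Om => f1 (jh e) * (oapp g 0%R (state e k.+1))%:E + f2 (jh e)).
  move=> mg; apply: emeasurable_funD => //; apply: emeasurable_funM => //.
  apply/measurable_EFinP.
  by apply: (measurableT_comp (measurable_oapp mg)) => //; exact: measurable_state.
have s_ge0 (g : S -> R) e : (forall y, 0 <= g y)%R ->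
    0 <= f1 (jh e) * (oapp g 0%R (state e k.+1))%:E + f2 (jh e).
  move=> g0; rewrite adde_ge0// mule_ge0// lee_fin.
  by case: (state e k.+1).
have -> : \int[P]_(e in alive k.+1)
    (f1 (jh e) * (oapp w 0%R (state e k.+1))%:E + f2 (jh e)) =
    limn (fun j => \int[P]_(e in alive k.+1)
      (f1 (jh e) * (oapp (s_ j) 0%R (state e k.+1))%:E + f2 (jh e))).
  rewrite -monotone_convergence//.
  - apply: eq_integral => e; rewrite inE => -[y _ ey]; apply/esym/cvg_lim => //.
    rewrite -ey/=; apply: cvgeD.
    + by rewrite fin_num_adde_defl.
    + by apply: cvgeZl => //; exact: s_cvg.
    + exact: cvg_cst.
  - exact: measurable_alive.
  - by move=> j; apply: measurable_funTS; exact: ms.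
  - by move=> j e _; exact: s_ge0.
  - move=> e _ i j ij; rewrite leeD2r// lee_wpmul2l// lee_fin.
    by case: (state e k.+1) => //= y; exact: s_nd.
apply: lime_le.
  apply: ereal_nondecreasing_is_cvgn => i j ij; apply: ge0_le_integral => //.
  - exact: measurable_alive.
  - by move=> e _; exact: s_ge0.
  - by apply: measurable_funTS; exact: ms.
  - by apply: measurable_funTS; exact: ms.
  - move=> e _; rewrite leeD2r// lee_wpmul2l// lee_fin.
    by case: (state e k.+1) => //= y; exact: s_nd.
apply: nearW => j; apply: le_trans (jump_drift_simple (s_le j)) _.
pose g (z : hist S R k * R) := f1 z * (W z.1)%:E + f2 z.
have mg : measurable_fun setT g.
  by apply: emeasurable_funD => //; apply: emeasurable_funM.
have g0 z : 0 <= g z by rewrite adde_ge0// mule_ge0// lee_fin.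
have outz_ge0 z : 0 <= f1 z * (rho * W z.1 + b)%:E.
  by rewrite mule_ge0// lee_fin addr_ge0// mulr_ge0.
rewrite ge0_integralD//.
- rewrite -(jump_compensator rates measurable_point repr law measurableT mg g0).
  apply: leeD; apply: eq_lee.
    apply: eq_integral => e _; apply: eq_integral => u _.
    by rewrite /W hist_stateE.
  by apply: eq_integral => e _; rewrite /g/W/= hist_stateE.
- exact: measurable_alive.
- by move=> e _; apply: integral_ge0 => u _; exact: outz_ge0.
- apply: measurable_funTS; apply: (measurable_integral_exposure
    (g := fun z => f1 z * (rho * W z.1 + b)%:E)) => //.
  apply: emeasurable_funM => //; apply/measurable_EFinP.
  apply: measurable_funD => //; apply: measurable_funM => //.
  exact: (measurableT_comp (@mW k)).
- by move=> e _; apply: integral_ge0 => u _; apply: mule_ge0; [exact: g0|exact: rate_ge0].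
- apply: measurable_funTS; apply: (measurable_integral_exposure
    (g := fun z => g z * rate m setT z)).
    by apply: emeasurable_funM => //; exact: mrate.
  by move=> z; apply: mule_ge0; [exact: g0|exact: rate_ge0].
Qed.

End jump_drift.
End drift_of_a_jump.

Section energy_balance.
Local Open Scope ereal_scope.
Context d d' (S : measurableType d) (A : measurableType d') (R : realType).
Variables (adm : S -> set A) (q : S -> A -> {charge set S -> \bar R}).
Hypothesis rates : transition_rates adm q.
Hypothesis measurable_point : forall y : S, measurable [set y].
Variable pi : R.-pker (predictableType S R) ~> (option A).
Variable m : forall k, hist S R k -> R -> set S -> \bar R.
Hypothesis repr : represents_intensity adm q pi m.
Local Notation Om := (Omega S R).
Local Notation leb := (@lebesgue_measure R).
Variable P : probability Om R.
Hypothesis law : jump_law P m.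

Variables (w : S -> R) (rho b : R).
Hypotheses (mw : measurable_fun setT w) (w_ge1 : forall y, (1 <= w y)%R).
Hypotheses (rho_ge0 : (0 <= rho)%R) (b_ge0 : (0 <= b)%R).
Hypothesis drift : forall y a, adm y a ->
  charge_integral (q y a) (fun z => (w z)%:E) <= (rho * w y + b)%:E.
Variable t : R.

Let w0 y : (0 <= w y)%R. Proof. exact: le_trans (w_ge1 y). Qed.

(** The solution at time [r] of [z' = rho * z + b] that starts from [w]: the
    bound on the mean weight at a time [r] after a visit to [o]. *)
Definition weight (r : R) (o : option S) : R :=
  (expR (rho * r) * oapp w 0 o + b * growth rho r)%R.

Definition energy k : \bar R :=
  \int[P]_(e in [set e | jump_time e k <= t%:E])
    (weight (t - fine (jump_time e k)) (state e k))%:E.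

Lemma weight_Some r y : weight r (Some y) = (w y + (rho * w y + b) * growth rho r)%R.
Proof. by rewrite /weight/= growthE; ring. Qed.

Lemma weight_ge0 r o : (0 <= r)%R -> (0 <= weight r o)%R.
Proof.
move=> r0; rewrite /weight addr_ge0 ?mulr_ge0 ?expR_ge0 ?growth_ge0//.
by case: o.
Qed.

Section step.
Variable k : nat.
(** For a jump that occurs a time [z.2] after the k-th one, [gap z] is the time
    from this jump to [t]. If it is not negative, the weight after the jump is
    the affine function of [w] with coefficients [f1 z] and [f2 z]. *)
Let gap (z : hist S R k * R) : R := (t - fine (hist_time z.1) - z.2)%R.
Let ontime : set (hist S R k * R) := [set z | (0 <= gap z)%R].
Let f1 z : \bar R := (expR (rho * gap z))%:E * (\1_ontime z)%:E.
Let f2 z : \bar R := (b * growth rho (gap z))%:E * (\1_ontime z)%:E.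

Let mgap : measurable_fun setT gap.
Proof.
apply: measurable_funB => //; apply: measurable_funB => //.
apply: measurableT_comp => //.
exact: (measurableT_comp (@measurable_hist_time _ S R k) measurable_fst).
Qed.

Let montime : measurable ontime.
Proof.
rewrite (_ : ontime = gap @^-1` `[0%R, +oo[%classic).
  by apply: measurable_preimage.
by apply/seteqP; split => z; rewrite /ontime/= in_itv/= andbT.
Qed.

Let mf1 : measurable_fun setT f1.
Proof.
apply: emeasurable_funM; last exact/measurable_EFinP/measurable_indic.
apply/measurable_EFinP; apply: measurableT_comp => //.
exact: measurable_funM.
Qed.

Let mf2 : measurable_fun setT f2.
Proof.
apply: emeasurable_funM; last exact/measurable_EFinP/measurable_indic.
apply/measurable_EFinP; apply: measurable_funM => //.
by apply: measurableT_comp => //; exact: measurable_growth.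
Qed.

Let f1_ge0 z : 0 <= f1 z. Proof. by rewrite /f1 mule_ge0 ?lee_fin ?expR_ge0. Qed.

Let f2_ge0 z : 0 <= f2 z.
Proof.
rewrite /f2 indicE; have [oz|oz] := pselect (ontime z).
  by rewrite mem_set// mule1 lee_fin mulr_ge0// growth_ge0.
by rewrite memNset// mule0.
Qed.

Let jh (e : Om) : hist S R k * R := (history k e, fine (sojourn e k)).

Let mjh : measurable_fun setT jh.
Proof.
apply: measurable_fun_pair; first exact: measurable_history.
by apply: measurableT_comp => //; exact: measurable_sojourn.
Qed.

Let gap_history (e : Om) u : gap (history k e, u) = (t - fine (jump_time e k) - u)%R.
Proof. by rewrite /gap/= hist_timeE. Qed.

Let late (e : Om) u : (gap (history k e, u) < 0)%R -> \1_ontime (history k e, u) = 0%R :> R.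
Proof. by move=> lt0; rewrite indicE memNset// /ontime/= leNgt lt0. Qed.

Let in_time (e : Om) u : (0 <= gap (history k e, u))%R -> \1_ontime (history k e, u) = 1%R :> R.
Proof. by move=> ge0; rewrite indicE mem_set. Qed.

Let outer (e : Om) := \int[leb]_(u in exposure k e)
  (f1 (history k e, u) * (rho * oapp w 0 (state e k) + b)%:E).

Let outer_late (e : Om) : (t < fine (jump_time e k))%R -> outer e = 0.
Proof.
move=> lt; apply: integral0_eq => u; rewrite /exposure/= lte_fin => /andP[u0 _].
rewrite /f1 late ?mule0 ?mul0e// gap_history.
by move: lt u0; set T := fine _; lra.
Qed.

(** The sojourn is cut at [t], and [a] is the length of the part before [t]. *)
Let outer_value (e : Om) (a : R) : (0 <= a)%R ->
  (forall u, (0 < u)%R -> (u%:E <= sojourn e k) &&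
     (u <= t - fine (jump_time e k))%R = (u <= a)%R) ->
  outer e = ((rho * oapp w 0 (state e k) + b) *
    (growth rho (t - fine (jump_time e k)) -
     growth rho (t - fine (jump_time e k) - a)))%:E.
Proof.
move=> a0 uE; set r := (t - fine _)%R; set C := (rho * _ + b)%R.
have C0 : (0 <= C)%R.
  by rewrite addr_ge0// mulr_ge0//; case: (state e k).
rewrite mulrC EFinM -integral_growth// -ge0_integralZr//; last first.
- apply: measurable_funTS; apply/measurable_EFinP; apply: measurableT_comp => //.
  by apply: measurable_funM => //; exact: measurable_funB.
rewrite /outer [LHS]integral_indicM [RHS]integral_indicM; apply: eq_integral => u _.
rewrite /f1 gap_history -/r -/C.
rewrite -muleA [X in X = _](_ : _ = (expR (rho * (r - u)) * C *
  (\1_ontime (history k e, u) * \1_(exposure k e) u))%:E); last first.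
  by rewrite -!EFinM; congr (_%:E); ring.
rewrite -!EFinM; congr ((_ * _)%:E).
rewrite !indicE -natrM mulnb; congr ((nat_of_bool _)%:R).
have [u0|u0] := ltP 0%R u; last first.
  rewrite [u \in exposure _ _]memNset ?andbF//; last first.
    by rewrite /exposure/= lte_fin ltNge u0.
  by rewrite memNset//= in_itv/= ltNge u0.
apply/andP/idP; rewrite !inE /exposure /ontime /= in_itv/= gap_history lte_fin u0/=.
  by move=> [gu us]; rewrite -uE// us/= -subr_ge0.
by rewrite -uE// => /andP[us ur]; split => //; rewrite subr_ge0.
Qed.

Let fine_jump_timeS (e : Om) : alive k.+1 e ->
  fine (jump_time e k.+1) = (fine (jump_time e k) + fine (sojourn e k))%R.
Proof.
move=> /aliveS[ak sk]; rewrite jump_timeS fineD//; first exact: alive_fin_num.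
by rewrite ge0_fin_numE//; exact/ltW/sojourn_gt0.
Qed.

Let after_jump (e : Om) o : alive k.+1 e ->
  f1 (jh e) * (oapp w 0 o)%:E + f2 (jh e) =
  (\1_[set e : Om | (jump_time e k.+1 <= t%:E)%E] e)%:E *
  (weight (t - fine (jump_time e k.+1)) o)%:E.
Proof.
move=> ak; have gE : gap (jh e) = (t - fine (jump_time e k.+1))%R.
  by rewrite gap_history fine_jump_timeS// opprD addrA.
have TE : (jump_time e k.+1 <= t%:E) = (0 <= gap (jh e))%R.
  by rewrite gE subr_ge0 -lee_fin fineK//; exact: alive_fin_num.
rewrite indicE /f1 /f2; have [g0|g0] := leP 0%R (gap (jh e)).
  rewrite in_time// mem_set/= ?TE// !mule1 mul1e -EFinM -EFinD; congr (_%:E).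
  by rewrite /weight gE.
rewrite late// memNset/= ?TE ?mule0 ?mul0e ?adde0//.
by apply/negP; rewrite -ltNge.
Qed.

Let energyS : energy k.+1 = \int[P]_(e in alive k.+1)
  (f1 (jh e) * (oapp w 0 (state e k.+1))%:E + f2 (jh e)).
Proof.
rewrite /energy [LHS]integral_indicM [RHS]integral_indicM.
apply: eq_integral => e _; have [ak|ak] := pselect (alive k.+1 e).
  by rewrite after_jump// [\1_(alive _) _]indicE mem_set// mule1 muleC.
rewrite [\1_(alive _) _]indicE memNset// mule0 indicE memNset ?mule0//=.
by move=> Tt; apply: ak; exact: before_alive Tt.
Qed.

Let staying_set : set Om := [set e | (jump_time e k <= t%:E < jump_time e k.+1)%E].

(** Until the sojourn ends, or until [t] if this comes first, the weight of the
    current state decreases by the drift. If [t] comes first, what is left is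
    [w]; otherwise it is the weight at the time of the jump. *)
Let balance (e : Om) : alive k e ->
  (\1_staying_set e)%:E * (oapp w 0 (state e k))%:E +
  (outer e + (\1_(alive k.+1) e)%:E *
     (f1 (jh e) * (oapp w 0 (state e k))%:E + f2 (jh e))) =
  (\1_[set e : Om | (jump_time e k <= t%:E)%E] e)%:E *
  (weight (t - fine (jump_time e k)) (state e k))%:E.
Proof.
move=> ak; have [y _ /esym ey] := ak.
have Tk := alive_fin_num ak.
have jump_split : (\1_(alive k.+1) e)%:E *
     (f1 (jh e) * (oapp w 0 (state e k))%:E + f2 (jh e)) =
     (\1_[set e : Om | (jump_time e k.+1 <= t%:E)%E] e)%:E *
     (weight (t - fine (jump_time e k.+1)) (state e k))%:E.
  have [ak1|ak1] := pselect (alive k.+1 e).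
    by rewrite after_jump// [\1_(alive _) _]indicE mem_set// mul1e.
  rewrite [\1_(alive _) _]indicE memNset// mul0e indicE memNset ?mul0e//=.
  by move=> Tt; apply: ak1; exact: before_alive Tt.
rewrite jump_split; have [kt|tk] := leP (jump_time e k) t%:E; last first.
  have tk1 : t%:E < jump_time e k.+1.
    by apply: lt_le_trans tk _; exact: jump_time_nd.
  rewrite outer_late; last by rewrite -lte_fin fineK.
  rewrite !indicE !memNset ?mul0e ?adde0//=.
  - by apply/negP; rewrite -ltNge.
  - by apply/negP; rewrite -ltNge.
  - by rewrite /staying_set/= leNgt tk.
have r0 : (0 <= t - fine (jump_time e k))%R by rewrite subr_ge0 -lee_fin fineK.
rewrite [X in _ = X * _](_ : _ = 1) ?mul1e; last by rewrite indicE mem_set.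
have [k1t|tk1] := leP (jump_time e k.+1) t%:E.
  have ak1 : alive k.+1 e := before_alive k1t.
  have /aliveS[_ sk] := ak1.
  have s0 := sojourn_gt0 e k.
  have sE : sojourn e k = (fine (sojourn e k))%:E.
    by rewrite fineK// ge0_fin_numE// ltW.
  have sr : (fine (sojourn e k) <= t - fine (jump_time e k))%R.
    by rewrite lerBrDl -fine_jump_timeS// -lee_fin fineK//; exact: alive_fin_num.
  rewrite (@outer_value e (fine (sojourn e k))); last 2 first.
  - by rewrite fine_ge0// ltW.
  - move=> u u0; rewrite [in LHS]sE lee_fin.
    by apply/andP/idP => [[]//|us]; split => //; exact: le_trans sr.
  rewrite [X in X * _ + _](_ : _ = 0); last first.
    by rewrite indicE memNset// /staying_set/= [X in _ && X]ltNge k1t andbF.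
  rewrite indicE mem_set// mul1e mul0e add0e fine_jump_timeS// opprD addrA ey.
  by rewrite !weight_Some -EFinD/=; congr (_%:E); ring.
rewrite (@outer_value e (t - fine (jump_time e k)))//; last first.
  move=> u u0; apply/andP/idP => [[]//|ur]; split => //.
  have : t%:E < jump_time e k + sojourn e k by rewrite -jump_timeS.
  rewrite -[jump_time e k]fineK// => /ltW; rewrite -leeBlDl// -EFinB; apply: le_trans.
  by rewrite lee_fin.
rewrite [X in X * _ + _](_ : _ = 1); last first.
  by rewrite indicE mem_set// /staying_set/= kt.
rewrite [\1_[set _ | _] e]indicE memNset/= ?mul0e ?adde0 ?mul1e; last first.
  by apply/negP; rewrite -ltNge.
rewrite ey weight_Some subrr growth0 -EFinD/=; congr (_%:E); ring.
Qed.

(** [jump_drift_le] replaces the weight of the new state in [energy k.+1] by that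
    of the old one, at the price of the drift during the sojourn. What is then
    obtained is equal to [energy k] for each trajectory, by [balance]: the weight
    solves the differential equation in which the drift is the only source. *)
Lemma energy_step :
  \int[P]_(e in [set e : Om | (jump_time e k <= t%:E < jump_time e k.+1)%E])
    (oapp w 0 (state e k))%:E + energy k.+1 <= energy k.
Proof.
have mT j : measurable [set e : Om | jump_time e j <= t%:E].
  exact: measurable_jumped.
have mstay : measurable staying_set.
  rewrite (_ : staying_set = [set e : Om | jump_time e k <= t%:E] `\`
    [set e | jump_time e k.+1 <= t%:E]); first exact: measurableD.
  apply/seteqP; split => e; rewrite /staying_set/=.
    by move=> /andP[-> tk]; split => //; apply/negP; rewrite -ltNge.
  by move=> [-> /negP]; rewrite -ltNge => ->.
have mwk : measurable_fun setT (fun e : Om => (oapp w 0 (state e k))%:E).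
  apply/measurable_EFinP.
  by apply: (measurableT_comp (measurable_oapp mw)) => //; exact: measurable_state.
have wk0 (e : Om) : 0 <= (oapp w 0%R (state e k))%:E.
  by rewrite lee_fin; case: (state e k).
have mV : measurable_fun setT
    (fun e => f1 (jh e) * (oapp w 0 (state e k))%:E + f2 (jh e)).
  apply: emeasurable_funD; last exact: (measurableT_comp mf2 mjh).
  by apply: emeasurable_funM => //; exact: (measurableT_comp mf1 mjh).
have V0 e : 0 <= f1 (jh e) * (oapp w 0 (state e k))%:E + f2 (jh e).
  by rewrite adde_ge0// mule_ge0.
have outer0 e : 0 <= outer e.
  apply: integral_ge0 => u _; rewrite mule_ge0// lee_fin addr_ge0// mulr_ge0//.
  by case: (state e k).
have mouter : measurable_fun setT outer.
  pose g (z : hist S R k * R) := f1 z * (rho * oapp w 0 (hist_state z.1) + b)%:E.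
  rewrite (_ : outer = fun e => \int[leb]_(u in exposure k e) g (history k e, u));
    last by apply/funext => e; apply: eq_integral => u _; rewrite /g hist_stateE.
  apply: measurable_integral_exposure.
    apply: emeasurable_funM => //; apply/measurable_EFinP.
    apply: measurable_funD => //; apply: measurable_funM => //.
    apply: (measurableT_comp (measurable_oapp mw)).
    exact: (measurableT_comp (@measurable_hist_state _ S R k) measurable_fst).
  move=> z; rewrite mule_ge0// lee_fin addr_ge0// mulr_ge0//.
  by case: (hist_state z.1).
have f1_fin z : f1 z \is a fin_num by [].
have f2_fin z : f2 z \is a fin_num by [].
rewrite energyS.
apply: le_trans (leeD2l _ (jump_drift_le rates measurable_point repr law mw w_ge1
  rho_ge0 b_ge0 drift mf1 mf2 f1_ge0 f2_ge0 f1_fin f2_fin)) _.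
rewrite -/jh /energy.
have restrict (B : set Om) (f : Om -> \bar R) : B `<=` alive k ->
    \int[P]_(e in B) f e = \int[P]_(e in alive k) ((\1_B e)%:E * f e).
  by move=> Bk; rewrite -integral_setI_indicM setIidr.
rewrite [X in X + _ <= _]restrict; last first.
  by move=> e /andP[kt _]; exact: before_alive kt.
rewrite [X in _ + (_ + X) <= _]restrict; last by move=> e /aliveS[].
rewrite [leRHS]restrict; last by move=> e kt; exact: before_alive kt.
have malive := @measurable_alive _ S R.
have jump0 e : 0 <= (\1_(alive k.+1) e)%:E *
    (f1 (jh e) * (oapp w 0 (state e k))%:E + f2 (jh e)).
  by apply: mule_ge0; [rewrite lee_fin|exact: V0].
have mjump : measurable_fun setT (fun e : Om => (\1_(alive k.+1) e)%:E *
    (f1 (jh e) * (oapp w 0 (state e k))%:E + f2 (jh e))).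
  by apply: emeasurable_funM => //; exact/measurable_EFinP/measurable_indic.
have mwait : measurable_fun setT (fun e : Om =>
    (\1_staying_set e)%:E * (oapp w 0 (state e k))%:E).
  by apply: emeasurable_funM => //; exact/measurable_EFinP/measurable_indic.
rewrite -(ge0_integralD P (malive k) (fun e _ => outer0 e) (measurable_funTS mouter)
  (fun e _ => jump0 e) (measurable_funTS mjump)).
rewrite -(ge0_integralD P (malive k) _ (measurable_funTS mwait)
  (fun e _ => adde_ge0 (outer0 e) (jump0 e))
  (measurable_funTS (emeasurable_funD mouter mjump))); last first.
  by move=> e _; apply: mule_ge0; [rewrite lee_fin|exact: wk0].
apply: eq_lee; apply: eq_integral => e; rewrite inE => ak.
exact: balance.
Qed.

End step.
End energy_balance.

(** * Bounds on the weight and non-explosion *)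

Lemma measurable_sublevel d (S : measurableType d) (R : realType) (w : S -> R) (c : R) :
  measurable_fun setT w -> measurable [set y | w y <= c].
Proof.
move=> mw; rewrite (_ : [set _ | _] = w @^-1` `]-oo, c]).
  exact: measurable_preimage.
by apply/seteqP; split => y; rewrite /= in_itv/=.
Qed.

(** Besides the initial state, two facts about the process are used here: the
    energy balance [step] and, below, the summability of the departures from the
    sublevel sets of [w], [few_departures]. *)
Section stability.
Local Open Scope ereal_scope.
Context d (S : measurableType d) (R : realType).
Local Notation Om := (Omega S R).
Variable P : probability Om R.
Variables (w : S -> R) (rho b : R).
Hypotheses (mw : measurable_fun setT w) (w_ge1 : forall y, (1 <= w y)%R).
Hypotheses (rho_ge0 : (0 <= rho)%R) (b_ge0 : (0 <= b)%R).
Local Notation W := (weight w rho b).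
Local Notation En := (energy P w rho b).
Hypothesis step : forall t k,
  \int[P]_(e in [set e : Om | (jump_time e k <= t%:E < jump_time e k.+1)%E])
    (oapp w 0 (state e k))%:E + En t k.+1 <= En t k.
Variable x : S.
Hypothesis measurable_start : measurable [set x].
Hypothesis start : P [set e | (Some @` [set x]) (state e 0%N)] = 1.

Let w0 y : (0 <= w y)%R. Proof. exact: le_trans (w_ge1 y). Qed.

Let oapp_ge0 o : (0 <= oapp w 0 o)%R. Proof. by case: o. Qed.

Let moapp k : measurable_fun setT (fun e : Om => (oapp w 0 (state e k))%:E).
Proof.
apply/measurable_EFinP.
by apply: (measurableT_comp (measurable_oapp mw)) => //; exact: measurable_state.
Qed.

Let mweight t k : measurable_fun setT
  (fun e : Om => (W (t - fine (jump_time e k)) (state e k))%:E).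
Proof.
have mT : measurable_fun setT (fun e : Om => t - fine (jump_time e k))%R.
  apply: measurable_funB => //; apply: measurableT_comp => //.
  exact: measurable_jump_time.
have mwk : measurable_fun setT (fun e : Om => oapp w 0 (state e k))%R.
  by apply: (measurableT_comp (measurable_oapp mw)); exact: measurable_state.
apply/measurable_EFinP; apply: measurable_funD; apply: measurable_funM => //.
  by apply: measurableT_comp => //; exact: measurable_funM.
exact: (measurableT_comp (measurable_growth rho) mT).
Qed.

Let weight_late_ge0 t k (e : Om) : jump_time e k <= t%:E ->
  0 <= (W (t - fine (jump_time e k)) (state e k))%:E.
Proof.
move=> kt; rewrite lee_fin weight_ge0// subr_ge0 -lee_fin fineK//.
exact/alive_fin_num/before_alive/kt.
Qed.

Lemma energy_ge0 t k : 0 <= En t k.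
Proof. by apply: integral_ge0 => e; exact: weight_late_ge0. Qed.

Lemma energy0 (t : R) : (0 <= t)%R -> En t 0 = (W t (Some x))%:E.
Proof.
move=> t0; rewrite /energy (_ : [set _ | _] = setT); last first.
  by apply/seteqP; split => // e _ /=; rewrite jump_time0 lee_fin.
have mB : measurable [set e : Om | (Some @` [set x]) (state e 0%N)].
  exact: measurable_in_state.
have null : P (~` [set e : Om | (Some @` [set x]) (state e 0%N)]) = 0.
  by apply: etrans (probability_setC P mB) _; rewrite start subee.
rewrite (ge0_ae_eq_integral (g := cst (W t (Some x))%:E))//.
- apply: etrans (integral_cst P measurableT _) _.
  exact: etrans (congr1 (mule _) (probability_setT P)) (mule1 _).
- by move=> e _; apply: weight_late_ge0; rewrite jump_time0 lee_fin.
- by move=> e _; rewrite lee_fin weight_ge0.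
exists (~` [set e : Om | (Some @` [set x]) (state e 0%N)]); split.
- exact: measurableC.
- exact: null.
- apply: subsetC => e [_ -> ex] _ /=; rewrite /cst -ex jump_time0/= subr0.
  by [].
Qed.

Lemma energy_sum_le t N :
  \sum_(0 <= k < N) \int[P]_(e in staying t setT k) (oapp w 0 (state e k))%:E +
  En t N <= En t 0.
Proof.
elim: N => [|N IH]; first by rewrite big_nil add0e.
rewrite big_nat_recr//= -addeA; apply: le_trans IH; apply: leeD2l.
apply: le_trans (step t N); apply: leeD2r; apply: eq_lee; congr integral.
apply/seteqP; split => e; rewrite /staying/=; first by move=> [].
move=> kt; split => //; have /andP[/before_alive[y _ ey] _] := kt.
by exists y.
Qed.

Lemma energy_le t N : En t N <= En t 0.
Proof.
apply: le_trans (energy_sum_le t N); rewrite leeDr// sume_ge0// => k _.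
by apply: integral_ge0 => e _; rewrite lee_fin.
Qed.

Lemma expectation_weight_le (t : R) : (0 <= t)%R ->
  'E_P[fun e : Om => (oapp w 0 (xi e t))%R] <= (W t (Some x))%:E.
Proof.
move=> t0; rewrite unlock -energy0//.
have mk k : measurable (staying t setT k : set Om) by exact: measurable_staying.
have -> : \int[P]_e (oapp w 0 (xi e t))%:E =
    \int[P]_(e in \bigcup_k staying t setT k) (oapp w 0 (xi e t))%:E.
  rewrite [RHS]integral_indicM; apply: eq_integral => e _; rewrite indicE.
  have [eB|eB] := pselect ((\bigcup_k staying t setT k) e).
    by rewrite mem_set// mule1.
  rewrite memNset// mule0; move: eB; rewrite -xi_staying.
  by move=> /=; case: (xi e t) => [y|] nB //; exfalso; apply: nB; exists y.
have mxi k : measurable_fun (staying t setT k) (fun e : Om => (oapp w 0 (xi e t))%:E).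
  apply: (eq_measurable_fun (fun e : Om => (oapp w 0 (state e k))%:E)).
    by move=> e; rewrite inE => -[_ kt]; rewrite (xiE kt).
  exact: measurable_funTS.
rewrite ge0_integral_bigcup//; last 3 first.
- exact/measurable_fun_bigcup.
- by move=> e _; rewrite lee_fin.
- exact: trivIset_staying.
apply: lime_le.
  by apply: is_cvg_nneseries => k _ _; apply: integral_ge0 => e _; rewrite lee_fin.
apply: nearW => N.
apply: le_trans (energy_sum_le t N).
apply: le_trans (leeDl _ (energy_ge0 t N)); apply: lee_sum => k _.
apply: eq_lee; apply: eq_integral => e; rewrite inE => -[_ kt].
by rewrite (xiE kt).
Qed.

(** Markov's inequality for the energy, since [weight r (Some y)] is at least
    [w y]. *)
Lemma prob_escape_le (t : R) k (c : R) : (0 <= t)%R -> (0 <= c)%R ->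
  c%:E * P ([set e | jump_time e k <= t%:E] `\`
            [set e | (Some @` [set y | (w y <= c)%R]) (state e k)]) <=
  (W t (Some x))%:E.
Proof.
move=> t0 c0; rewrite -energy0//; apply: le_trans (energy_le t k).
have mD : measurable [set y | (w y <= c)%R] by exact: measurable_sublevel.
have mE : measurable ([set e : Om | jump_time e k <= t%:E] `\`
            [set e | (Some @` [set y | (w y <= c)%R]) (state e k)]).
  by apply: measurableD; [exact: measurable_jumped|exact: measurable_in_state].
rewrite -integral_cst//; apply: (@le_trans _ _ (\int[P]_(e in
  [set e : Om | (jump_time e k <= t%:E)%E] `\`
  [set e | (Some @` [set y | (w y <= c)%R]) (state e k)])
    (W (t - fine (jump_time e k)) (state e k))%:E)).
  apply: ge0_le_integral => //.
  - exact: measurable_funTS.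
  - move=> e [kt]; have [y _ ey] := before_alive kt; rewrite /= -ey => wy.
    have {}wy : (c <= w y)%R.
      by rewrite leNgt; apply/negP => /ltW yc; apply: wy; exists y.
    rewrite lee_fin weight_Some (le_trans wy)// lerDl mulr_ge0//.
      by rewrite addr_ge0// mulr_ge0.
    rewrite growth_ge0// subr_ge0 -lee_fin fineK//.
    exact/alive_fin_num/before_alive/kt.
apply: ge0_subset_integral => //.
- exact: measurable_jumped.
- exact: measurable_funTS.
- by move=> e; exact: weight_late_ge0.
Qed.

Hypothesis few_departures : forall c : R, exists M : R, forall t : R, (0 <= t)%R ->
  \sum_(0 <= k <oo) P [set e | (Some @` [set y | (w y <= c)%R]) (state e k) /\
                               jump_time e k.+1 <= t%:E] <= (M * t)%:E.

Lemma measurable_explosion (t : R) :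
  measurable [set e : Om | forall k, jump_time e k <= t%:E].
Proof.
rewrite (_ : [set _ | _] = \bigcap_k [set e : Om | jump_time e k <= t%:E]).
  by apply: bigcapT_measurable => k; exact: measurable_jumped.
by apply/seteqP; split => e /= kt k; [move=> _|]; exact: kt.
Qed.

(** Let [p] be the probability. If all jumps occur before [t], then so do the
    k-th one and the next one, for each [k]. With [c] such that the k-th state is
    above [c] with probability at most [p / 2], the departures from [w <= c] at
    the k-th state have probability at least [p / 2] for every [k], and their sum
    is infinite. *)
Lemma prob_explosion0 (t : R) : (0 <= t)%R ->
  P [set e | forall k, jump_time e k <= t%:E] = 0.
Proof.
move=> t0; set B : set Om := [set e | _]; apply/eqP; apply: contraT => PB0.
have mB : measurable B by exact: measurable_explosion.
have PBfin : P B \is a fin_num by exact: fin_num_measure.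
set p := fine (P B).
have p0 : (0 < p)%R.
  by rewrite -lte_fin fineK// lt_neqAle eq_sym PB0 measure_ge0.
set v := W t (Some x).
have v0 : (0 < v)%R.
  apply: (@lt_le_trans _ _ 1%R) => //; apply: le_trans (w_ge1 x) _.
  rewrite /v weight_Some lerDl mulr_ge0 ?growth_ge0//.
  by rewrite addr_ge0// mulr_ge0.
pose c := (2 * v / p)%R.
have c0 : (0 < c)%R by rewrite divr_gt0// mulr_gt0.
have [M depM] := few_departures c.
pose dep k := P [set e | (Some @` [set y | (w y <= c)%R]) (state e k) /\
                         jump_time e k.+1 <= t%:E].
have dep_ge k : (p / 2)%:E <= dep k.
  set Bk : set Om := [set e : Om | jump_time e k <= t%:E] `\`
            [set e | (Some @` [set y | (w y <= c)%R]) (state e k)].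
  have mD : measurable [set y | (w y <= c)%R] by exact: measurable_sublevel.
  have mBk : measurable Bk.
    by apply: measurableD; [exact: measurable_jumped|exact: measurable_in_state].
  have mdep : measurable [set e : Om | (Some @` [set y | (w y <= c)%R]) (state e k) /\
                         jump_time e k.+1 <= t%:E].
    by apply: measurableI; [exact: measurable_in_state|exact: measurable_jumped].
  have Bkfin : P Bk \is a fin_num by exact: fin_num_measure.
  have Bkp : P Bk <= (p / 2)%:E.
    have := prob_escape_le k t0 (ltW c0).
    rewrite -/Bk -/v -[P Bk]fineK// -EFinM !lee_fin => cB.
    rewrite -(ler_pM2l c0); apply: le_trans cB _.
    by rewrite /c le_eqVlt; apply/orP; left; apply/eqP; field; rewrite gt_eqF.
  have PB : P B <= dep k + P Bk.
    apply: le_trans (measureU2 P mdep mBk); apply: le_measure; rewrite ?inE//.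
      exact: measurableU.
    move=> e Be; have [De|De] :=
      pselect ((Some @` [set y | (w y <= c)%R]) (state e k)).
      by left; split => //; exact: Be.
    by right; split => //; exact: Be.
  have depfin : dep k \is a fin_num by exact: fin_num_measure.
  move: PB Bkp; rewrite -[P B]fineK// -/p -[dep k]fineK// -[P Bk]fineK//.
  by rewrite -EFinD !lee_fin; lra.
have [N N_gt] : exists N : nat, (M * t < N%:R * (p / 2))%R.
  exists (Num.bound (`|M * t| / (p / 2))%R); rewrite -ltr_pdivrMr ?divr_gt0//.
  apply: le_lt_trans (archi_boundP _); last by rewrite divr_ge0// divr_ge0// ltW.
  by rewrite ler_pM2r ?invr_gt0 ?divr_gt0// ler_norm.
have : (N%:R * (p / 2))%:E <= (M * t)%:E.
  apply: le_trans (depM t t0).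
  apply: le_trans (nneseries_lim_ge N _) => //.
  apply: (@le_trans _ _ (\sum_(0 <= k < N) (p / 2)%:E)).
    by rewrite sumEFin sumr_const_nat subn0 mulrC mulr_natr.
  by apply: lee_sum => k _; exact: dep_ge.
by rewrite lee_fin leNgt N_gt.
Qed.

Lemma prob_explosion_time : P [set e | explosion_time e = +oo] = 1.
Proof.
have -> : [set e : Om | explosion_time e = +oo] =
    ~` \bigcup_n [set e | forall k, jump_time e k <= n%:R%:E].
  have supE (e : Om) : explosion_time e = ereal_sup (range (jump_time e)).
    by apply/cvg_lim => //; apply: ereal_nondecreasing_cvgn; exact: jump_time_nd.
  apply/seteqP; split => e /=.
    rewrite supE => sup_oo [n _ Tn].
    suff : ereal_sup (range (jump_time e)) <= n%:R%:E by rewrite sup_oo leye_eq.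
    by apply: ub_ereal_sup => _ [k _ <-].
  move=> noexp; rewrite supE; apply/eqP; rewrite -leye_eq leNgt; apply/negP => sup_lt.
  apply: noexp; exists (Num.bound (fine (ereal_sup (range (jump_time e))))) => // k.
  have Tk_sup : jump_time e k <= ereal_sup (range (jump_time e)).
    by apply: ereal_sup_ubound; exists k.
  have sup0 : 0 <= ereal_sup (range (jump_time e)).
    exact: le_trans (jump_time_ge0 e k) Tk_sup.
  apply: le_trans Tk_sup _; rewrite -[leLHS]fineK ?ge0_fin_numE// lee_fin.
  by apply/ltW/archi_boundP; exact: fine_ge0.
apply: etrans (probability_setC P _) _.
  by apply: bigcup_measurable => n _; exact: measurable_explosion.
suff -> : P (\bigcup_n [set e | forall k, jump_time e k <= n%:R%:E]) = 0 by rewrite sube0.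
apply: measure_negligible.
  by apply: bigcup_measurable => n _; exact: measurable_explosion.
apply: negligible_bigcup => n; apply/negligibleP; first exact: measurable_explosion.
exact: prob_explosion0.
Qed.

Lemma prob_xi_alive (t : R) : (0 <= t)%R -> P [set e | range Some (xi e t)] = 1.
Proof.
move=> t0; have -> : [set e : Om | range Some (xi e t)] =
    ~` [set e | forall k, jump_time e k <= t%:E].
  apply/seteqP; split => e /=.
    move=> xe all; move: xe; rewrite xi_None; first by move=> [].
    by move=> k; rewrite ltNge (all k.+1) andbF.
  move=> nall; have ex : exists k, t%:E < jump_time e k.
    apply: contrapT => nex; apply: nall => k; rewrite leNgt; apply/negP => tk.
    by apply: nex; exists k.
  case: (ex_minnP ex) => -[|k] tk kmin.
    by move: tk; rewrite jump_time0 lte_fin ltNge t0.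
  have kt : jump_time e k <= t%:E.
    by rewrite leNgt; apply/negP => /kmin; rewrite ltnn.
  by rewrite (@xiE _ _ _ _ _ k) ?kt//; exact: before_alive kt.
apply: etrans (probability_setC P (measurable_explosion t)) _.
by rewrite prob_explosion0// sube0.
Qed.

End stability.

(** * Polish state spaces and the theorem *)

Section polish_borel.
Context (R : realType) (S : ptopologicalType).

Lemma polish_measurable_point : polish R S ->
  forall y : borelType S, measurable [set y].
Proof.
move=> [_ [dist [dist0 distC dist_tri dist_nbhs _]]] y.
rewrite -[X in measurable X]setCK; apply: measurableC; apply: sub_sigma_algebra.
have dist_ge0 u v : 0 <= dist u v.
  have := dist_tri u v u; rewrite (dist0 u u).2// (distC v u); lra.
rewrite /= openE => z /= zy; apply/dist_nbhs; exists (dist z y).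
  by rewrite lt_neqAle dist_ge0 andbT; apply/eqP => /esym /dist0.
by move=> u /= + uy; rewrite uy ltxx.
Qed.

Lemma continuous_borel_measurable (f : S -> R) : continuous f ->
  measurable_fun setT (f : borelType S -> R).
Proof.
move=> cf _; apply: (measurability _ (RGenOInfty.measurableE R)) => //.
move=> _ [_ [a ->] <-]; rewrite setTI; apply: sub_sigma_algebra => /=.
by apply: open_comp; [move=> z _; exact: cf|exact: rray_open].
Qed.

End polish_borel.

(** The sublevel set of [w] lies in some [Sk k]: beyond it, [w] exceeds [c]. *)
Lemma sublevel_bounded_rates (R : realType)
  d d' (S : measurableType d) (A : measurableType d')
  (adm : S -> set A) (q : S -> A -> {charge set S -> \bar R})
  (w : S -> R) (Sk : nat -> set S) (c : R) :
  (fun k => ereal_inf [set (w y)%:E | y in ~` Sk k]) @ \oo --> +oo%E ->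
  (forall k, (ereal_sup [set `|q ya.1 ya.2 [set ya.1]|%E
     | ya in [set ya | Sk k ya.1 /\ adm ya.1 ya.2]] < +oo)%E) ->
  exists2 M : R, 0 <= M & forall y, w y <= c -> (qstar adm q y <= M%:E)%E.
Proof.
move=> /cvgeyPgt /(_ c) [k _ /(_ k (leqnn k)) /= inf_gt] /(_ k) /lty_bounded[M M0 supM].
exists M => // y wy; have Sy : Sk k y.
  apply: contrapT => nSy; move: inf_gt; rewrite ltNge => /negP; apply.
  apply: (@le_trans _ _ (w y)%:E); last by rewrite lee_fin.
  by apply: ereal_inf_lbound; exists y.
apply: le_trans supM; apply: ub_ereal_sup => _ [a ya <-].
by apply: ereal_sup_ubound; exists (y, a).
Qed.

Theorem theorem3p1 (R : realType) (S A : ptopologicalType)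
    (polishS : polish R S) (polishA : polish R A)
    (adm : borelType S -> set (borelType A))
    (q : borelType S -> borelType A -> {charge set (borelType S) -> \bar R})
    (rates : transition_rates adm q)
    (w : S -> R) (rho b : R) (Sk : nat -> set S)
    (w_continuous : continuous w) (w_ge1 : forall x, 1 <= w x)
    (rho_ge0 : 0 <= rho) (b_ge0 : 0 <= b)
    (Sk_nondecreasing : forall m n, (m <= n)%N -> Sk m `<=` Sk n)
    (drift : forall x a, adm x a ->
       (charge_integral (q x a) (fun y => (w y)%:E) <= (rho * w x + b)%:E)%E)
    (w_infty :
       (fun k => ereal_inf [set (w x)%:E | x in ~` Sk k]) @ \oo --> +oo%E)
    (Sk_cover : \bigcup_k Sk k = setT)
    (Sk_bounded : forall k,
       (ereal_sup [set `|q xa.1 xa.2 [set xa.1]|%E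
                  | xa in [set xa | Sk k xa.1 /\ adm xa.1 xa.2]] < +oo)%E)
    (pi : R.-pker (predictableType (borelType S) R) ~> (option (borelType A)))
    (piP : policy adm pi)
    (x : borelType S) (t : R) (t_ge0 : 0 <= t)
    (P : probability (Omega (borelType S) R) R)
    (lawP : process_law adm q pi \d_x P) :
  [/\ P [set e | explosion_time e = +oo%E] = 1%E /\
      P [set e | range Some (xi e t)] = 1%E,
      (rho != 0 ->
       ('E_P[fun e => oapp w 0%R (xi e t)] <=
          (expR (rho * t) * w x + b / rho * (expR (rho * t) - 1))%:E)%E) /\
      (rho = 0 -> ('E_P[fun e => oapp w 0%R (xi e t)] <= (w x + b * t)%:E)%E) &
      forall D : set (borelType S), measurable D ->
        (ereal_sup [set qstar adm q y | y in D] < +oo)%E ->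
        (P [set e | (Some @` D) (xi e t)] =
         (\1_D x)%:E +
         \int[P]_e \int[lebesgue_measure]_(s in `[0%R, t])
           integrated_rate adm q pi e s D)%E].
Proof.
have mpoint := polish_measurable_point polishS.
have mw := continuous_borel_measurable w_continuous.
case: lawP => m repr [law0 law _].
have initial D : measurable D ->
    P [set e | (Some @` D) (state e 0%N)] = (\1_D x)%:E by exact: law0.
have start : P [set e | (Some @` [set x]) (state e 0%N)] = 1%E.
  by rewrite initial// indicE mem_set.
have step := energy_step rates mpoint repr law mw w_ge1 rho_ge0 b_ge0 drift.
have departures (c : R) : exists M : R, forall s : R, 0 <= s ->
    (\sum_(0 <= k <oo) P [set e | (Some @` [set y : borelType S | (w y <= c)%R]) (state e k) /\
       jump_time e k.+1 <= s%:E] <= (M * s)%:E)%E.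
  have [M M0 qM] := 
    @sublevel_bounded_rates _ _ _ _ _ adm q w Sk c w_infty Sk_bounded.
  exists M => s s0; apply: (sum_departures_le rates mpoint repr law s0 _ M0 qM).
  exact: measurable_sublevel.
have Ew := expectation_weight_le mw w_ge1 rho_ge0 b_ge0 step (mpoint x) start t_ge0.
split.
- split; first exact: (prob_explosion_time mw w_ge1 rho_ge0 b_ge0 step (mpoint x) start departures).
  exact: (prob_xi_alive mw w_ge1 rho_ge0 b_ge0 step (mpoint x) start departures).
- split => rho0; apply: le_trans Ew _; rewrite lee_fin /weight/= /growth.
    by rewrite (negbTE rho0) mulrA mulrAC.
  by rewrite rho0 eqxx mul0r expR0 mul1r.
- move=> D mD /lty_bounded[M M0 qM].
  rewrite (forward_equation rates mpoint repr law t_ge0 mD M0); last first.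
    by move=> y Dy; apply: le_trans qM; apply: ereal_sup_ubound; exists y.
  by rewrite initial.
Qed.
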